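(* Let $R>0$ and $\alpha\in(0,1)$. Assume that $\underline m$ is a constant and $\overline m$ is an integer with $\underline m\le 0$, $\overline m\ge 3$, and $p=1-(\underline m+\overline m)$, $q=\underline m\cdot\overline m$. Assume that $F$ is smooth in all its arguments and is linear in $\frac{v^2}{t^3},\frac{vv_t}{t^2},\frac{v_t^2}{t}$. Let $v\in C^{1,1}(\bar G_R)\cap C^\infty(G_R)$ be a solution of $$v_{tt}+p\frac{v_t}{t}+q\frac{v}{t^2}+F=0\quad\text{in }G_R$$ satisfying, for any $r\in(0,R)$ and any $\tau\ge0$, $$t^{-2}D_{y'}^\tau v,\quad t^{-1}DD_{y'}^\tau v,\quad D^2D_{y'}^\tau v\in C^\alpha(\bar G_r).$$ Then $v$ is smooth in $y'$, $t$, and $t^{\overline m-1}\log t$ in $\bar G_r$ for any $r\in(0,R)$. If, in addition, $\partial_t\partial_{t^{\overline m-1}\log t}v|_{t=0}=0$ on $B_R'$, then $v\in C^\infty(\bar G_r)$ for any $r\in(0,R)$.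
   Context: Points of $\mathbb R^n$ are $y=(y',t)$ with $y'\in\mathbb R^{n-1}$, $t\in\mathbb R$. $B_r'=\{y'\in\mathbb R^{n-1}:|y'|<r\}$ and $G_r=\{(y',t):|y'|<r,\ 0<t<r\}$. $D$ is the gradient in $(y',t)$, $D_{y'}$ the gradient in $y'$, and $D_{y'}^\tau$ stands for all partial derivatives of order $\tau$ in $y'$ ($\tau$ a nonnegative integer). A bar on the domain of a function space means up to the boundary. $p$ and $q$ are constants. In the equation, $F$ denotes a given function of $y'$, $t$ and the quantities $$\frac vt,\ v_t,\ \frac{D_{y'}v}{t},\ D_{y'}v_t,\ D_{y'}^2v,\ \frac{v^2}{t^3},\ \frac{vv_t}{t^2},\ \frac{v_t^2}{t},$$ i.e. $F=\mathcal F\big(y',t,\frac vt,v_t,\dots,\frac{v_t^2}{t}\big)$ for a given function $\mathcal F(y',t,\xi)$ on $B_R'\times[0,R)\times\mathbb R^N$; ''smooth in all its arguments'' means $\mathcal F\in C^\infty(B_R'\times[0,R)\times\mathbb R^N)$. ''$F$ is linear in $\frac{v^2}{t^3},\frac{vv_t}{t^2},\frac{v_t^2}{t}$'' means that $\mathcal F$ is a polynomial of degree at most one jointly in the corresponding three variables, with coefficients depending on the remaining arguments. ''$v$ is smooth in $y'$, $t$, and $t^{\overline m-1}\log t$ in $\bar G_r$'' means: there is a function $V=V(y',T,S)\in C^\infty(\bar B_r'\times[0,r]\times\mathbb R)$ such that $v(y',t)=V(y',t,t^{\overline m-1}\log t)$ on $\bar G_r$, where $t^{\overline m-1}\log t$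 is set equal to $0$ at $t=0$. The quantity $\partial_t\partial_{t^{\overline m-1}\log t}v|_{t=0}$ at $y'$ means $\partial_T\partial_SV(y',0,0)$ (with $r>|y'|$); it does not depend on the choice of $V$ and $r$. *)

(* Defs.v *)
From mathcomp Require Import all_boot all_order all_algebra.
From mathcomp Require Import all_classical all_reals all_analysis.

Set Implicit Arguments.
Unset Strict Implicit.
Unset Printing Implicit Defensive.

Import Order.TTheory GRing.Theory Num.Theory.
Import numFieldNormedType.Exports.

Local Open Scope classical_set_scope.
Local Open Scope ring_scope.

Section FunctionSpaces.
Context {R : realType} {k : nat}.
Implicit Types (f g : 'rV[R]_k -> R) (D O : set 'rV[R]_k) (i : 'I_k).

(* Euclidean norm; the norm provided by the library on row vectors is the
   sup norm (which defines the same topology). *)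
Definition enorm (x : 'rV[R]_k) : R := Num.sqrt (\sum_i x 0 i ^+ 2).

Definition pd i f : 'rV[R]_k -> R := 'D_(delta_mx 0 i) f.

Definition pds (s : seq 'I_k) f : 'rV[R]_k -> R := foldr pd f s.

(* [g] is the [i]-th partial derivative of [f] in the interior of [D], extended
   by continuity to [D]; it is determined on [D] when [D] is contained in the
   closure of its interior, as is the case for all the sets used below. *)
Definition is_pd_on D i f g : Prop :=
  (forall x, D° x -> is_derive x (delta_mx 0 i) f (g x)) /\
  {within D, continuous g}.

(* C^m(D): all partial derivatives of order at most [m] exist in the interior
   of [D] and extend continuously to [D]. For [D] open this is the usual C^m(D),
   for [D] the closure of an open set this is C^m up to the boundary. *)
Fixpoint Cspace (m : nat) D f : Prop :=
  {within D, continuous f} /\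
  if m is m'.+1 then forall i, exists g, is_pd_on D i f g /\ Cspace m' D g
  else True.

Definition Csmooth D f : Prop := forall m, Cspace m D f.

Definition holder (a : R) D f : Prop :=
  exists C : R, forall x y, D x -> D y ->
    `|f x - f y| <= C * enorm (x - y) `^ a.

(* C^{m,a}(D), for D bounded. *)
Fixpoint Cholder (m : nat) (a : R) D f : Prop :=
  if m is m'.+1 then
    {within D, continuous f} /\
    forall i, exists g, is_pd_on D i f g /\ Cholder m' a D g
  else holder a D f.

(* Membership in C^a(closure O) of a function that is only meaningful on the
   open set [O], such as v / t ^ 2: its boundary values are not those of [f]
   but those of the continuous extension of [f] restricted to [O]. *)
Definition holder_bar (a : R) O f : Prop :=
  exists g, holder a (closure O) g /\ forall x, O x -> g x = f x.

End FunctionSpaces.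

Section Cylinder.
Context {R : realType} {d : nat}.
Implicit Types (v : 'rV[R]_(d + 1) -> R) (y : 'rV[R]_(d + 1)) (r : R).

(* With n = d + 1, a point of R^n is y = (y', t), y' = lsubmx y, t = tco y. *)
Definition tix : 'I_(d + 1) := rshift d ord0.
Definition yix (i : 'I_d) : 'I_(d + 1) := lshift 1 i.
Definition tco y : R := y 0 tix.

Definition Bball r : set 'rV[R]_d := [set y' | enorm y' < r].

Definition Gcyl r : set 'rV[R]_(d + 1) :=
  [set y | Bball r (lsubmx y) /\ 0 < tco y < r].

(* Number of the arguments v/t, v_t, D_y' v / t, D_y' v_t, D_y'^2 v. *)
Definition nxi : nat := 1 + 1 + d + d + d * d.

Definition xi_args v y : 'rV[R]_nxi :=
  row_mx (row_mx (row_mx (row_mx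
    (v y / tco y)%:M
    (pd tix v y)%:M)
    (\row_(i < d) (pd (yix i) v y / tco y)))
    (\row_(i < d) pd (yix i) (pd tix v) y))
    (mxvec (\matrix_(i < d, j < d) pd (yix i) (pd (yix j) v) y)).

Definition quad_args v y : 'rV[R]_(1 + 1 + 1) :=
  row_mx (row_mx
    (v y ^+ 2 / tco y ^+ 3)%:M
    (v y * pd tix v y / tco y ^+ 2)%:M)
    (pd tix v y ^+ 2 / tco y)%:M.

Definition nargs : nat := nxi + (1 + 1 + 1).

(* The domain B'_r x [0, r) x R^nargs of the nonlinearity. *)
Definition Fdom r : set 'rV[R]_(d + 1 + nargs) :=
  [set z | Bball r (lsubmx (lsubmx z)) /\ 0 <= tco (lsubmx z) < r].

Definition linear_in_quad r (F : 'rV[R]_(d + 1 + nargs) -> R) : Prop :=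
  exists (a0 : 'rV[R]_(d + 1) -> 'rV[R]_nxi -> R)
         (a : 'rV[R]_(d + 1) -> 'rV[R]_nxi -> 'rV[R]_(1 + 1 + 1)),
  forall y (xi : 'rV[R]_nxi) (zeta : 'rV[R]_(1 + 1 + 1)),
    Fdom r (row_mx y (row_mx xi zeta)) ->
    F (row_mx y (row_mx xi zeta)) =
      a0 y xi + \sum_i a y xi 0 i * zeta 0 i.

Definition solves (p q r : R) (F : 'rV[R]_(d + 1 + nargs) -> R) v : Prop :=
  forall y, Gcyl r y ->
    pd tix (pd tix v) y + p * (pd tix v y / tco y) + q * (v y / tco y ^+ 2)
    + F (row_mx y (row_mx (xi_args v y) (quad_args v y))) = 0.

(* Points of the domain of V are (y', T, S), with (y', T) = lsubmx z. *)
Definition Six : 'I_(d + 1 + 1) := rshift (d + 1) ord0.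
Definition Tix : 'I_(d + 1 + 1) := lshift 1 tix.

Definition Vdom r : set 'rV[R]_(d + 1 + 1) :=
  [set z | closure (Gcyl r) (lsubmx z)].

(* V represents v as a smooth function of y', t and t^(m-1) log t; the last
   quantity vanishes at t = 0, since [ln 0 = 0] (and 0 ^+ m.-1 = 0 if m > 1). *)
Definition log_repr (m : nat) r v (V : 'rV[R]_(d + 1 + 1) -> R) : Prop :=
  Csmooth (Vdom r) V /\
  forall y, closure (Gcyl r) y ->
    v y = V (row_mx y (tco y ^+ m.-1 * ln (tco y))%:M).

(* The value at (y', t = 0) of the derivative of v with respect to t and
   t^(m-1) log t is c. It depends neither on V nor on r. *)
Definition is_dt_dlog (m : nat) (Rad : R) v (y' : 'rV[R]_d) (c : R) : Prop :=
  exists (r : R) (V V_S V_TS : 'rV[R]_(d + 1 + 1) -> R),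
    [/\ enorm y' < r < Rad, log_repr m r v V,
        is_pd_on (Vdom r) Six V V_S, is_pd_on (Vdom r) Tix V_S V_TS &
        V_TS (row_mx (row_mx y' 0) 0) = c].

End Cylinder.

Arguments nxi : clear implicits.
Arguments nargs : clear implicits.

(* Main.v *)
Require Import Defs.
From mathcomp Require polyrcf.
From mathcomp Require Import all_boot all_order all_algebra.
From mathcomp Require Import all_classical all_reals all_analysis.
From mathcomp Require Import ring lra zify.

Set Implicit Arguments.
Unset Strict Implicit.
Unset Printing Implicit Defensive.

Import Order.TTheory GRing.Theory Num.Theory.
Import numFieldNormedType.Exports.

Local Open Scope classical_set_scope.
Local Open Scope ring_scope.

(* Near [t = 0], write the equation as
   [(t d/dt - mlow) (t d/dt - mbar) v = - t^2 F].
   The Hoelder bounds first give conormality: [t^-2 v] stays bounded under all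
   words in [t d/dt] and [d/dy_i].  Indeed [t^2 F] gains one power of [t] over
   the error in [v], since [F] is at most linear in the quadratic quantities,
   and both Euler operators can be inverted.  Iterating, [v] has an expansion
   of every order in the monomials [c(y') t^i (ln t)^j] with
   [j (mbar - 1) + 1 <= i]; the only source of logarithms is the resonance
   [i = mbar], which creates [t^mbar ln t = t * (t^(mbar-1) ln t)].  Borel
   summation of the polynomials in [t] and [t^(mbar-1) ln t] gives a smooth [V0]
   such that [v - V0] is conormal of infinite order, so its extension by [0] to
   [t <= 0] is smooth and can be added to [V0].
   Comparing with the Taylor expansion of any representative [V], the
   coefficient of [t^mbar ln t] is the derivative of [V] in [T] and [S] at
   [(y', 0, 0)]; if it vanishes, no logarithm is ever created. *)

(** * Directional derivatives and the chain rule *)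

(** Put [M = mbar - 1]. Linearity of [F] in the quadratic quantities is what keeps the exponents of
    [v] in the range [M * j + 1 <= i]. The quantity [v^2/t^3] may contain [t^(2M-1) ln^2 t], one
    power short of the rule [M * j <= i] obeyed by [v/t]. The factor [t^2] in front of [F] makes up
    for one such defect, whereas a product of two of them would yield [t^(4M) ln^4 t], outside the
    range. Remainders have half-integer order for two reasons: the order never equals the root
    [mbar], so each inversion of an Euler operator falls on a definite side of it, and the spare
    half power absorbs logarithms. The root [mlow <= 0] contributes nothing because [v = O(t^2)]
    excludes [t^mlow]; the root [mbar] leaves a smooth coefficient that the local analysis does not
    determine. Normal and tangential derivatives are counted separately, since the hypotheses
    control every tangential derivative of [v] but only few normal ones; the equation has to supply
    the others. *)

Section Derivatives.
Context {R : realType}.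

(** Lines, slices, translations and dilations are all affine, so each such change of variable
    reduces to this identity of difference quotients. *)
Lemma is_derive_affine (V W U : normedModType R) (A : V -> W) (f : W -> U) x v w df :
  (forall h : R, A (h *: v + x) = h *: w + A x) ->
  is_derive (A x) w f df -> is_derive x v (f \o A) df.
Proof.
move=> HA [dv <-].
have E : (fun h : R => h^-1 *: ((f \o A) (h *: v + x) - (f \o A) x)) =
         (fun h : R => h^-1 *: (f (h *: w + A x) - f (A x))).
  by apply/funext => h; rewrite /= HA.
by apply: DeriveDef; [move: dv; rewrite /derivable/= -E | rewrite /derive/= -E].
Qed.

Lemma is_derive_line (V U : normedModType R) (f : V -> U) x v (s : R) df :
  is_derive (s *: v + x) v f df ->
  is_derive s 1 (fun h : R => f (h *: v + x)) df.
Proof.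
apply: (@is_derive_affine R V U (fun h : R => h *: v + x) f s 1 v) => h.
by rewrite -[h%:A]/(h * 1) mulr1 scalerDl addrA.
Qed.

Lemma is_derive_continuous (f : R -> R) (x df : R) :
  is_derive x 1 f df -> {for x, continuous f}.
Proof. by case=> h _; apply/differentiable_continuous/derivable1_diffP. Qed.

Lemma is_derive_of_line (V U : normedModType R) (f : V -> U) x v df :
  is_derive (0 : R) 1 (fun h : R => f (h *: v + x)) df -> is_derive x v f df.
Proof.
move=> [d1 d2]; apply: (@DeriveDef _ _ _ x v f df); first by apply: (derivable1P f x v).2.
rewrite -d2 /derive; set g1 := fun h => _; set g2 := fun h => _.
suff -> : g1 = g2 by [].
by rewrite funeqE /g1 /g2 => h /=; rewrite addr0 scale0r add0r [_%:A]mulr1.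
Qed.

Lemma isD_cst (V : normedModType R) x v (a : R) : is_derive x v (fun _ : V => a) 0.
Proof. exact: is_derive_cst. Qed.

Lemma isD_add (V : normedModType R) (f g : V -> R) x v df dg :
  is_derive x v f df -> is_derive x v g dg ->
  is_derive x v (fun y => f y + g y) (df + dg).
Proof. exact: is_deriveD. Qed.

Lemma isD_mul (V : normedModType R) (f g : V -> R) x v df dg :
  is_derive x v f df -> is_derive x v g dg ->
  is_derive x v (fun y => f y * g y) (df * g x + f x * dg).
Proof.
move=> df' dg'; have H := is_deriveM df' dg'.
by rewrite addrC [df * _]mulrC; exact: H.
Qed.

Lemma isD_scal (V : normedModType R) (f : V -> R) x v (a df : R) :
  is_derive x v f df -> is_derive x v (fun y => a * f y) (a * df).
Proof.
move=> df'; have := isD_mul (isD_cst x v a) df'.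
by rewrite mul0r add0r.
Qed.

Lemma isD_opp (V : normedModType R) (f : V -> R) x v df :
  is_derive x v f df -> is_derive x v (fun y => - f y) (- df).
Proof. exact: is_deriveN. Qed.

Lemma isD_sub (V : normedModType R) (f g : V -> R) x v df dg :
  is_derive x v f df -> is_derive x v g dg ->
  is_derive x v (fun y => f y - g y) (df - dg).
Proof. exact: is_deriveB. Qed.

Lemma isD_sum (V : normedModType R) n (f : 'I_n -> V -> R) x v (df : 'I_n -> R) :
  (forall i, is_derive x v (f i) (df i)) ->
  is_derive x v (fun y => \sum_i f i y) (\sum_i df i).
Proof.
move=> H; have -> : (fun y => \sum_i f i y) = \sum_i f i.
  by apply/funext => y; rewrite fct_sumE.
exact: is_derive_sum.
Qed.

Lemma is_derive_scale (V : normedModType R) (f : V -> R) x v (a df : R) :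
  is_derive x v f df -> is_derive x (a *: v) f (a * df).
Proof.
move=> dF; apply: is_derive_of_line.
have dl : is_derive (a * 0 : R) 1 (fun h : R => f (h *: v + x)) df.
  by apply: is_derive_line; rewrite mulr0 scale0r add0r.
have -> : (fun h : R => f (h *: (a *: v) + x)) = (fun h : R => f (h *: v + x)) \o ( *%R a).
  by apply/funext => h /=; rewrite scalerA mulrC.
have da : is_derive (0 : R) 1 ( *%R a) a.
  by rewrite -[X in is_derive _ _ _ X]mulr1; apply: isD_scal; exact: is_derive_id.
rewrite mulrC; exact: is_derive1_comp.
Qed.

Lemma MVT_line (V : normedModType R) (f g : V -> R) x v :
  (forall s : R, 0 <= s <= 1 -> is_derive (s *: v + x) v f (g (s *: v + x))) ->
  exists2 s : R, 0 < s < 1 & f (v + x) - f x = g (s *: v + x).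
Proof.
move=> H; pose F (h : R) := f (h *: v + x).
have dF (s : R) : 0 <= s <= 1 -> is_derive s 1 F (g (s *: v + x)).
  by move=> /H; exact: is_derive_line.
have dF' (s : R) : s \in `]0, 1[%R -> is_derive s 1 F (g (s *: v + x)).
  by rewrite in_itv /= => /andP[? ?]; apply: dF; rewrite !ltW.
have cF : {within `[0, 1], continuous F}.
  apply: continuous_in_subspaceT => s; rewrite inE /= in_itv /= => s01.
  exact: is_derive_continuous (dF _ s01).
have [c c01] := MVT ltr01 dF' cF.
rewrite /F scale1r scale0r add0r subr0 mulr1 => E; exists c; [by move: c01; rewrite in_itv | exact: E].
Qed.

End Derivatives.

Section ChainRule.
Context {R : realType} {N : nat}.
Implicit Types (F : 'rV[R]_N -> R) (G : 'I_N -> 'rV[R]_N -> R) (x w : 'rV[R]_N).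

Lemma norm_rowP x (e : R) : (0 <= e) -> (`|x| <= e) <-> (forall k, `|x 0 k| <= e).
Proof.
move=> e0; split=> H.
  move=> k; apply: le_trans H; rewrite [leRHS]/Num.norm /= mx_normrE.
  exact: (le_bigmax _ (fun k => `|x k.1 k.2|) (0, k)).
rewrite [leLHS]/Num.norm /= mx_normrE; apply: bigmax_le => // -[i j] _ /=.
by rewrite ord1.
Qed.

Lemma le_norm_row x k : `|x 0 k| <= `|x|.
Proof. by move: k; apply/norm_rowP. Qed.

(** The points [row_prefix k w + x] are the vertices of an axis-parallel path from [x] to [w + x];
    along its edges partial derivatives suffice. *)
Definition row_prefix (k : nat) w : 'rV[R]_N := \row_j (if (j < k)%N then w 0 j else 0).

Lemma row_prefix0 w : row_prefix 0 w = 0.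
Proof. by apply/rowP => j; rewrite !mxE. Qed.

Lemma row_prefixN w : row_prefix N w = w.
Proof. by apply/rowP => j; rewrite !mxE ltn_ord. Qed.

Lemma row_prefixS (k : 'I_N) w :
  row_prefix k.+1 w = w 0 k *: delta_mx 0 k + row_prefix k w.
Proof.
apply/rowP => j; rewrite !mxE ltnS leq_eqVlt eqxx /=.
have [->|/eqP nE] := eqVneq j k; first by rewrite eqxx ltnn mulr1 addr0.
have /negPf -> : (j : nat) != k by apply/eqP => /val_inj.
by rewrite mulr0 add0r.
Qed.

(** The increment telescopes over the edges of the axis-parallel path, with one mean value per edge.
    In the sup norm the whole path stays in the ball. *)
Lemma increment_le F G x (r e : R) : 0 <= e ->
  (forall y, ball x r y -> forall k, is_derive y (delta_mx 0 k) F (G k y)) ->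
  (forall y, ball x r y -> forall k, `|G k y - G k x| <= e) ->
  forall w, `|w| < r ->
    `|F (w + x) - F x - \sum_k w 0 k * G k x| <= N%:R * e * `|w|.
Proof.
move=> e0 dF cG w wr.
have -> : F (w + x) - F x = \sum_(k < N)
    (F (row_prefix k.+1 w + x) - F (row_prefix k w + x)).
  rewrite -(big_mkord xpredT (fun k => F (row_prefix k.+1 w + x) - F (row_prefix k w + x))).
  by rewrite telescope_sumr// row_prefixN row_prefix0 add0r.
rewrite -sumrB; apply: le_trans (ler_norm_sum _ _ _) _.
rewrite -mulrA mulr_natl -[X in _ *+ X]card_ord -sumr_const.
apply: ler_sum => k _.
have inball (s : R) : 0 <= s <= 1 ->
    ball x r (s *: (w 0 k *: delta_mx 0 k) + (row_prefix k w + x)).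
  move=> /andP[s0 s1]; rewrite -ball_normE /= distrC addrA addrK.
  apply: le_lt_trans wr; apply/norm_rowP => // j; rewrite !mxE.
  have wj := le_norm_row w j.
  case: (eqVneq j k) => [->|_]; rewrite eqxx/= ?mulr0 ?add0r; last by case: ifP; rewrite ?normr0.
  rewrite ltnn addr0 mulr1 normrM ger0_norm// -[leRHS]mul1r.
  by apply: ler_pM => //; exact: le_norm_row.
have dk (s : R) : 0 <= s <= 1 -> is_derive
    (s *: (w 0 k *: delta_mx 0 k) + (row_prefix k w + x)) (w 0 k *: delta_mx 0 k) F
    (w 0 k * G k (s *: (w 0 k *: delta_mx 0 k) + (row_prefix k w + x))).
  by move=> /inball/dF/(_ k) /is_derive_scale.
have [s /andP[s0 s1]] := MVT_line (g := fun y => w 0 k * G k y) dk.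
rewrite addrA -row_prefixS => ->.
rewrite -mulrBr normrM [leRHS]mulrC; apply: ler_pM => //; first exact: le_norm_row.
by apply: cG; rewrite -/(_ + _); apply: inball; rewrite !ltW.
Qed.

End ChainRule.

Section ChainRule2.
Context {R : realType}.

Lemma is_derive_cvgP (V U : normedModType R) (f : V -> U) x v df :
  is_derive x v f df <-> h^-1 *: (f (h *: v + x) - f x) @[h --> (0 : R)^'] --> df.
Proof.
split=> [[d <-]|H]; first exact: d.
by apply: DeriveDef; [apply/cvg_ex; exists df | exact: cvg_lim H].
Qed.

(** Continuity of the partials of [F] at [X y] makes [F] differentiable there, while [X] only has to
    be differentiable along [v]. *)
Lemma isD_comp (V : normedModType R) N (F : 'rV[R]_N -> R) (G : 'I_N -> 'rV[R]_N -> R)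
    (X : V -> 'rV[R]_N) y v (dX : 'I_N -> R) :
  (\forall z \near X y, forall k, is_derive z (delta_mx 0 k) F (G k z)) ->
  (forall k, {for X y, continuous (G k)}) ->
  (forall k, is_derive y v (fun z => X z 0 k) (dX k)) ->
  is_derive y v (fun z => F (X z)) (\sum_k G k (X y) * dX k).
Proof.
move=> dF cG dXk; apply/is_derive_cvgP/cvgrPdist_le => e e0.
have [D dX1] : exists D, is_derive y v X D.
  exists ('D_v X y); apply: derivableP; apply/derivable_mxP => i j; rewrite ord1.
  by case: (dXk j).
have sX : is_derive y v (fun z => \sum_k G k (X y) * X z 0 k) (\sum_k G k (X y) * dX k).
  by apply: isD_sum => k; exact: isD_scal.
have /cvgrPdist_le/(_ (e / 2)) {}sX := (is_derive_cvgP _ _ _ _).1 sX.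
have {}dX1 := (is_derive_cvgP _ _ _ _).1 dX1.
pose A := `|D| + 1.
have A0 : 0 < A by rewrite ltr_wpDl.
(* The increment error is at most [N * dl * |w|], and [|w| <= A * |h|] for small [h]; this [dl]
   brings the quotient by [|h|] below [e / 2]. *)
pose dl := e / 2 / (N%:R * A + 1).
have NA0 : 0 < N%:R * A + 1 by rewrite ltr_wpDl// mulr_ge0// ltW.
have dl0 : 0 < dl by rewrite !divr_gt0.
have [r r0 Hr] : exists2 r : R, 0 < r & forall z, ball (X y) r z ->
    (forall k, is_derive z (delta_mx 0 k) F (G k z)) /\ (forall k, `|G k z - G k (X y)| <= dl).
  have : \forall z \near X y, (forall k, is_derive z (delta_mx 0 k) F (G k z)) /\
                             (forall k, `|G k z - G k (X y)| <= dl).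
    near=> z; split; first by near: z.
    near: z; apply: filter_forall => k; have /cvgrPdist_le/(_ _ dl0) := cG k.
    by apply: filterS => z; rewrite distrC.
  by move=> /nbhs_ballP [r /= r0 Hr]; exists r => // z /Hr.
have w0 : (X (h *: v + y) - X y) @[h --> (0 : R)^'] --> (0 : 'rV[R]_N).
  have hid : h @[h --> (0:R)^'] --> (0 : R) by exact: nbhs_dnbhs.
  have : h *: (h^-1 *: (X (h *: v + y) - X y)) @[h --> (0 : R)^'] --> (0 : R) *: D.
    exact: cvgZ.
  rewrite scale0r; apply: cvg_trans.
  apply: near_eq_cvg; near=> h; rewrite scalerA divff ?scale1r//.
  by near: h; exact: nbhs_dnbhs_neq.
have nwr : \forall h \near (0 : R)^', `|X (h *: v + y) - X y| < r.
  have /cvgrPdist_lt/(_ _ r0) := w0.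
  by apply: filterS => h; rewrite sub0r normrN.
have nwA : \forall h \near (0 : R)^', `|h^-1 *: (X (h *: v + y) - X y)| <= A.
  have /cvgrPdist_le/(_ _ ltr01) := dX1.
  apply: filterS => h H; rewrite -[h^-1 *: _](subrK D) /A addrC.
  by apply: le_trans (ler_normD _ _) _; rewrite lerD2l distrC.
have e20 : 0 < e / 2 by rewrite divr_gt0.
move: {sX} (sX e20) => nsX.
near=> h.
have wr : `|X (h *: v + y) - X y| < r by near: h.
have wA : `|h^-1 *: (X (h *: v + y) - X y)| <= A by near: h.
have Hs' : `|\sum_k G k (X y) * dX k - h^-1 *: (\sum_k G k (X y) * X (h *: v + y) 0 k -
    \sum_k G k (X y) * X y 0 k)| <= e / 2 by near: h.
set w := X (h *: v + y) - X y in wr wA.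
have HF := increment_le (ltW dl0) (fun z hz => (Hr z hz).1) (fun z hz => (Hr z hz).2) wr.
have Es : \sum_k w 0 k * G k (X y) =
    \sum_k G k (X y) * X (h *: v + y) 0 k - \sum_k G k (X y) * X y 0 k.
  by rewrite -sumrB; apply: eq_bigr => k _; rewrite !mxE mulrC mulrBr.
have Hs : `|\sum_k G k (X y) * dX k - h^-1 *: \sum_k w 0 k * G k (X y)| <= e / 2.
  by rewrite Es; apply: Hs'.
rewrite /w subrK in HF; rewrite -/w in HF.
have -> : \sum_k G k (X y) * dX k - h^-1 *: (F (X (h *: v + y)) - F (X y)) =
  (\sum_k G k (X y) * dX k - h^-1 *: \sum_k w 0 k * G k (X y)) -
  h^-1 *: (F (X (h *: v + y)) - F (X y) - \sum_k w 0 k * G k (X y)).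
  by rewrite /GRing.scale /=; ring.
apply: le_trans (ler_normB _ _) _; rewrite [leRHS]splitr lerD//.
rewrite normrZ; apply: (@le_trans _ _ (`|h^-1| * (N%:R * dl * `|w|))).
  by rewrite ler_wpM2l.
rewrite normrZ in wA; rewrite mulrCA; apply: (@le_trans _ _ (N%:R * dl * A)).
  by rewrite ler_wpM2l// mulr_ge0// ltW.
rewrite mulrAC /dl mulrA ler_pdivrMr// mulrC ler_wpM2l//; last by rewrite lerDl.
by rewrite ltW.
Unshelve. all: by end_near. Qed.

(* The second difference quotient equals a value of either mixed partial
   derivative near the base point. *)
Lemma schwarz (V : normedModType R) (f fa fb fab fba : V -> R) x a b :
  (\forall y \near x, is_derive y a f (fa y)) ->
  (\forall y \near x, is_derive y b f (fb y)) ->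
  (\forall y \near x, is_derive y b fa (fab y)) ->
  (\forall y \near x, is_derive y a fb (fba y)) ->
  {for x, continuous fab} -> {for x, continuous fba} -> fab x = fba x.
Proof.
move=> da db dab dba cab cba; apply/eqP; rewrite -subr_eq0 -normr_le0.
apply/ler_addgt0Pr => e e0; rewrite add0r.
have e20 : 0 < e / 2 by rewrite divr_gt0.
have : \forall y \near x, [/\ is_derive y a f (fa y), is_derive y b f (fb y),
    is_derive y b fa (fab y), is_derive y a fb (fba y) &
    `|fab x - fab y| <= e / 2 /\ `|fba x - fba y| <= e / 2].
  near=> y; split; [by near: y|by near: y|by near: y|by near: y|split; near: y].
    by move/cvgrPdist_le : cab; apply.
  by move/cvgrPdist_le : cba; apply.
move=> /nbhs_ballP [r /= r0 Hr].
pose A := `|a| + `|b| + 1.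
have A0 : 0 < A by rewrite ltr_wpDl// addr_ge0.
have [h h0 hA] : exists2 h : R, 0 < h & h * A < r.
  exists (r / 2 / A); rewrite ?divr_gt0// mulfVK ?gt_eqF//.
  by rewrite gtr_pMr// invf_lt1// ltr1n.
have inb (s u : R) : 0 <= s <= 1 -> 0 <= u <= 1 ->
    ball x r (s *: (h *: a) + (u *: (h *: b) + x)).
  move=> /andP[s0 s1] /andP[u0 u1]; rewrite -ball_normE /= distrC addrA addrK.
  apply: (@le_lt_trans _ _ (h * (`|a| + `|b|))).
    apply: le_trans (ler_normD _ _) _; rewrite !normrZ (ger0_norm (ltW h0)) (ger0_norm s0) (ger0_norm u0).
    by rewrite mulrDr lerD// ler_piMl// mulr_ge0// (ltW h0).
  by apply: le_lt_trans hA; rewrite ler_pM2l// /A lerDl.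
have i0 : 0 <= (0:R) <= 1 by rewrite lexx ler01.
have i1 : 0 <= (1:R) <= 1 by rewrite lexx ler01.
have sh (g dg : V -> R) (c z w : V) : is_derive (c + z) w g (dg (c + z)) ->
    is_derive z w (fun y => g (c + y)) (dg (c + z)).
  by apply: (@is_derive_affine R V V R (fun y => c + y) g z w w) => k; rewrite addrCA.
have d1 (s : R) : 0 <= s <= 1 -> is_derive (s *: (h *: a) + x) (h *: a)
    (fun z => f (h *: b + z) - f z)
    (h * (fa (h *: b + (s *: (h *: a) + x)) - fa (s *: (h *: a) + x))).
  move=> s01; rewrite mulrBr; apply: isD_sub; last first.
    by apply: is_derive_scale; have := inb s 0 s01 i0; rewrite scale0r add0r => /Hr[].
  apply: (sh f (fun y => h * fa y)); apply: is_derive_scale.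
  by have := inb s 1 s01 i1; rewrite scale1r addrCA => /Hr[].
have [s s01 E1] := MVT_line (g := fun z => h * (fa (h *: b + z) - fa z)) d1.
have d2 (u : R) : 0 <= u <= 1 -> is_derive (u *: (h *: b) + x) (h *: b)
    (fun z => f (h *: a + z) - f z)
    (h * (fb (h *: a + (u *: (h *: b) + x)) - fb (u *: (h *: b) + x))).
  move=> s'01; rewrite mulrBr; apply: isD_sub; last first.
    by apply: is_derive_scale; have := inb 0 u i0 s'01; rewrite scale0r add0r => /Hr[].
  apply: (sh f (fun y => h * fb y)); apply: is_derive_scale.
  by have := inb 1 u i1 s'01; rewrite scale1r => /Hr[].
have [u u01 E2] := MVT_line (g := fun z => h * (fb (h *: a + z) - fb z)) d2.
have lt01 (t : R) : 0 < t < 1 -> 0 <= t <= 1 by move=> /andP[? ?]; rewrite !ltW.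
have d3 (t : R) : 0 <= t <= 1 -> is_derive (t *: (h *: b) + (s *: (h *: a) + x)) (h *: b)
    fa (h * fab (t *: (h *: b) + (s *: (h *: a) + x))).
  move=> t01; apply: is_derive_scale.
  by have := inb s t (lt01 _ s01) t01; rewrite addrCA => /Hr[].
have [t t01 E3] := MVT_line (g := fun z => h * fab z) d3.
have d4 (t' : R) : 0 <= t' <= 1 -> is_derive (t' *: (h *: a) + (u *: (h *: b) + x)) (h *: a)
    fb (h * fba (t' *: (h *: a) + (u *: (h *: b) + x))).
  move=> t'01; apply: is_derive_scale.
  by have := inb t' u t'01 (lt01 _ u01) => /Hr[].
have [t' t'01 E4] := MVT_line (g := fun z => h * fba z) d4.
(* Both iterated mean values compute the same second difference of [f], taken in the two possible
   orders. *)
have E : fab (t *: (h *: b) + (s *: (h *: a) + x)) = fba (t' *: (h *: a) + (u *: (h *: b) + x)).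
  have : h * (h * fab (t *: (h *: b) + (s *: (h *: a) + x))) =
         h * (h * fba (t' *: (h *: a) + (u *: (h *: b) + x))).
    rewrite -E3 -E4 -E1 -E2 [h *: b + (h *: a + x)]addrCA; ring.
  by move=> /(mulfI (lt0r_neq0 h0)) /(mulfI (lt0r_neq0 h0)).
have [_ _ _ _ [H1 _]] := Hr _ (inb s t (lt01 _ s01) (lt01 _ t01)).
have [_ _ _ _ [_ H2]] := Hr _ (inb t' u (lt01 _ t'01) (lt01 _ u01)).
rewrite addrCA E in H1.
rewrite -(subrKA (fba (t' *: (h *: a) + (u *: (h *: b) + x)))) [leRHS]splitr.
by apply: le_trans (ler_normD _ _) _; rewrite lerD// distrC.
Unshelve. all: by end_near. Qed.

End ChainRule2.

(** * Smooth functions *)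

Section SmoothFunctions.
Context {R : realType}.

Lemma isD_comp1 (V : normedModType R) (u : V -> R) (f : R -> R) x v du df :
  is_derive (u x) 1 f df -> is_derive x v u du ->
  is_derive x v (fun y => f (u y)) (df * du).
Proof.
move=> hf hu; apply: is_derive_of_line.
have hu' : is_derive (0 : R) 1 (fun h : R => u (h *: v + x)) du.
  by apply: is_derive_line; rewrite scale0r add0r.
have hf' : is_derive (u (0 *: v + x)) 1 f df by rewrite scale0r add0r.
exact: (@is_derive1_comp _ f _ _ _ _ hf' hu').
Qed.

Section Fixed.
Context {k : nat}.
Implicit Types (f g : 'rV[R]_k -> R) (D O : set 'rV[R]_k) (i : 'I_k).

Lemma is_derive_congr O f g x v df : open O -> (forall y, O y -> f y = g y) -> O x ->
  is_derive x v f df -> is_derive x v g df.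
Proof.
move=> oO fg Ox; apply: near_eq_is_derive.
by apply: filterS (open_nbhs_nbhs (conj oO Ox)).
Qed.

Lemma pd_congr O i f g x : open O -> (forall y, O y -> f y = g y) -> O x ->
  pd i f x = pd i g x.
Proof.
move=> oO fg Ox; apply: near_eq_derive.
by apply: filterS (open_nbhs_nbhs (conj oO Ox)).
Qed.

Lemma Cspace_cont m D f : Cspace m D f -> {within D, continuous f}.
Proof. by case: m => [|m] []. Qed.

Lemma Cspace_mono m D f : Cspace m.+1 D f -> Cspace m D f.
Proof.
elim: m f => [|m IH] f [cf H]; split=> // i.
by have [g [gi /IH gm]] := H i; exists g.
Qed.

Lemma Cspace_congr m D f g : (forall x, D x -> f x = g x) -> Cspace m D f -> Cspace m D g.
Proof.
move=> fg; have cfg : {within D, continuous f} -> {within D, continuous g}.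
  by apply: subspace_eq_continuous => x; rewrite inE => /fg.
case: m => [|m] [cf H]; split; rewrite ?H//; first exact: cfg.
  exact: cfg.
move=> i; have [h [[h1 h2] h3]] := H i; exists h; split=> //; split=> // x Dx.
apply: (is_derive_congr (open_interior D) _ Dx) (h1 _ Dx).
by move=> y /interior_subset /fg.
Qed.

Lemma Cspace_sub m D D' f : D' `<=` D -> Cspace m D f -> Cspace m D' f.
Proof.
move=> DD; elim: m f => [|m IH] f [cf H]; split=> //;
  try exact: continuous_subspaceW DD cf.
move=> i; have [h [[h1 h2] h3]] := H i; exists h; split; last exact: IH.
split; last exact: continuous_subspaceW DD h2.
by move=> x Dx; apply: h1; exact: interiorS DD _ Dx.
Qed.

Lemma within_open O f : open O ->
  {within O, continuous f} <-> (forall x, O x -> {for x, continuous f}).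
Proof.
move=> oO; rewrite continuous_open_subspace//; split=> H x; first by move=> Ox; apply: H; rewrite inE.
by rewrite inE; exact: H.
Qed.

Lemma Cspace_cont_at m O f x : open O -> Cspace m O f -> O x -> {for x, continuous f}.
Proof. by move=> oO H; apply: (within_open _ oO).1; exact: Cspace_cont H. Qed.

Lemma Cspace0 O f : open O -> (forall x, O x -> {for x, continuous f}) -> Cspace 0 O f.
Proof. by move=> oO H; split=> //; apply/within_open. Qed.

Lemma CspaceS m O f : open O -> (forall x, O x -> {for x, continuous f}) ->
  (forall i, exists g, (forall x, O x -> is_derive x (delta_mx 0 i) f (g x)) /\ Cspace m O g) ->
  Cspace m.+1 O f.
Proof.
move=> oO cf H; split; first exact/within_open.
move=> i; have [g [g1 g2]] := H i; exists g; split=> //; split; last exact: Cspace_cont g2.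
by move=> x /interior_subset; exact: g1.
Qed.

Lemma Cspace_pd m O f i : open O -> Cspace m.+1 O f ->
  (forall x, O x -> is_derive x (delta_mx 0 i) f (pd i f x)) /\ Cspace m O (pd i f).
Proof.
move=> oO [cf H]; have [g [[g1 g2] g3]] := H i.
have gE x : O x -> is_derive x (delta_mx 0 i) f (g x).
  by move=> Ox; apply: g1; move: oO; rewrite openE; apply.
have gp x : O x -> g x = pd i f x by move=> /gE [].
by split=> [x Ox|]; [rewrite -gp//; exact: gE | exact: Cspace_congr gp g3].
Qed.

Lemma Csmooth_congr D f g : (forall x, D x -> f x = g x) -> Csmooth D f -> Csmooth D g.
Proof. by move=> fg H m; exact: Cspace_congr fg (H m). Qed.

Lemma Csmooth_sub D D' f : D' `<=` D -> Csmooth D f -> Csmooth D' f.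
Proof. by move=> DD H m; exact: Cspace_sub DD (H m). Qed.

Lemma Csmooth_pd O f i : open O -> Csmooth O f -> Csmooth O (pd i f).
Proof. by move=> oO H m; case: (Cspace_pd i oO (H m.+1)). Qed.

Lemma Csmooth_pds O f s : open O -> Csmooth O f -> Csmooth O (pds s f).
Proof. by move=> oO H; elim: s => //= i s; exact: Csmooth_pd. Qed.

Lemma Csmooth_derive O f i x : open O -> Csmooth O f -> O x ->
  is_derive x (delta_mx 0 i) f (pd i f x).
Proof. by move=> oO H Ox; case: (Cspace_pd i oO (H 1%N)) => + _; apply. Qed.

Lemma Csmooth_cont O f x : open O -> Csmooth O f -> O x -> {for x, continuous f}.
Proof. by move=> oO H; exact: Cspace_cont_at (H 0%N). Qed.

Lemma pdC O f i j x : open O -> Csmooth O f -> O x -> pd i (pd j f) x = pd j (pd i f) x.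
Proof.
move=> oO H Ox; have nO := open_nbhs_nbhs (conj oO Ox).
apply: (@schwarz _ _ f (pd j f) (pd i f) (pd i (pd j f)) (pd j (pd i f)) x
          (delta_mx 0 j) (delta_mx 0 i));
  do ?[by apply: filterS nO => y Oy; apply: Csmooth_derive Oy => //; do ?exact: Csmooth_pd].
all: by apply: Csmooth_cont Ox => //; do 2?[exact: Csmooth_pd|apply: Csmooth_pd => //].
Qed.

Lemma pd_eq i f x df : is_derive x (delta_mx 0 i) f df -> pd i f x = df.
Proof. by case. Qed.

Lemma Cspace_cst m O (c : R) : open O -> Cspace m O (fun=> c).
Proof.
elim: m c => [|m IH] c oO; first by apply: Cspace0 => // x _; exact: cst_continuous.
apply: CspaceS => // [x _|i]; first exact: cst_continuous.
by exists (fun=> 0); split=> [x _|]; [exact: isD_cst | exact: IH].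
Qed.

Lemma Csmooth_cst O (c : R) : open O -> Csmooth O (fun=> c).
Proof. by move=> oO m; exact: Cspace_cst. Qed.

Lemma Csmooth_coord O j : open O -> Csmooth O (fun x => x 0 j).
Proof.
move=> oO [|m]; first by apply: Cspace0 => // x _; exact: coord_continuous.
apply: CspaceS => // [x _|i]; first exact: coord_continuous.
exists (fun=> (i == j)%:R); split=> [x _|]; last exact: Cspace_cst.
apply: is_derive_of_line; have -> : (fun h : R => (h *: delta_mx 0 i + x) 0 j) =
    (fun h => (i == j)%:R * h + x 0 j).
  by apply/funext => h; rewrite !mxE eqxx eq_sym mulrC.
have H := isD_add (isD_scal (i == j)%:R (is_derive_id (0 : R) 1)) (isD_cst (0 : R) 1 (x 0 j)).
by rewrite mulr1 addr0 in H.
Qed.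

Lemma Cspace_add m O f g : open O -> Cspace m O f -> Cspace m O g ->
  Cspace m O (fun x => f x + g x).
Proof.
move=> oO; elim: m f g => [|m IH] f g hf hg.
  by apply: Cspace0 => // x Ox; exact: (cvgD (Cspace_cont_at oO hf Ox) (Cspace_cont_at oO hg Ox)).
apply: CspaceS => // [x Ox|i].
  by exact: (cvgD (Cspace_cont_at oO hf Ox) (Cspace_cont_at oO hg Ox)).
have [f1 f2] := Cspace_pd i oO hf; have [g1 g2] := Cspace_pd i oO hg.
exists (fun x => pd i f x + pd i g x); split; last exact: IH.
by move=> x Ox; apply: isD_add; [exact: f1|exact: g1].
Qed.

Lemma Cspace_mul m O f g : open O -> Cspace m O f -> Cspace m O g ->
  Cspace m O (fun x => f x * g x).
Proof.
move=> oO; elim: m f g => [|m IH] f g hf hg.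
  by apply: Cspace0 => // x Ox; exact: (cvgM (Cspace_cont_at oO hf Ox) (Cspace_cont_at oO hg Ox)).
apply: CspaceS => // [x Ox|i].
  by exact: (cvgM (Cspace_cont_at oO hf Ox) (Cspace_cont_at oO hg Ox)).
have [f1 f2] := Cspace_pd i oO hf; have [g1 g2] := Cspace_pd i oO hg.
exists (fun x => pd i f x * g x + f x * pd i g x); split; last first.
  by apply: Cspace_add => //; apply: IH => //; exact: Cspace_mono.
by move=> x Ox; apply: isD_mul; [exact: f1|exact: g1].
Qed.

Lemma Csmooth_add O f g : open O -> Csmooth O f -> Csmooth O g ->
  Csmooth O (fun x => f x + g x).
Proof. by move=> oO hf hg m; exact: Cspace_add. Qed.

Lemma Csmooth_mul O f g : open O -> Csmooth O f -> Csmooth O g ->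
  Csmooth O (fun x => f x * g x).
Proof. by move=> oO hf hg m; exact: Cspace_mul. Qed.

Lemma Csmooth_scal O (c : R) f : open O -> Csmooth O f -> Csmooth O (fun x => c * f x).
Proof. by move=> oO; apply: Csmooth_mul => //; exact: Csmooth_cst. Qed.

Lemma Csmooth_opp O f : open O -> Csmooth O f -> Csmooth O (fun x => - f x).
Proof.
move=> oO /(Csmooth_scal (-1) oO); apply: Csmooth_congr => x _; exact: mulN1r.
Qed.

Lemma Csmooth_sub' O f g : open O -> Csmooth O f -> Csmooth O g ->
  Csmooth O (fun x => f x - g x).
Proof. by move=> oO hf hg; apply: Csmooth_add => //; exact: Csmooth_opp. Qed.

Lemma Cspace_sum m O (I : Type) (r : seq I) (P : pred I) (f : I -> 'rV[R]_k -> R) : open O ->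
  (forall j, Cspace m O (f j)) -> Cspace m O (fun x => \sum_(j <- r | P j) f j x).
Proof.
move=> oO H; elim: r => [|a r IH].
  by apply: Cspace_congr (Cspace_cst m 0 oO) => x _; rewrite big_nil.
case Pa: (P a); last by apply: Cspace_congr IH => x _; rewrite big_cons Pa.
by apply: Cspace_congr (Cspace_add oO (H a) IH) => x _; rewrite big_cons Pa.
Qed.

Lemma Csmooth_sum O (I : Type) (r : seq I) (P : pred I) (f : I -> 'rV[R]_k -> R) : open O ->
  (forall j, Csmooth O (f j)) -> Csmooth O (fun x => \sum_(j <- r | P j) f j x).
Proof. by move=> oO H m; apply: Cspace_sum => // j; exact: H. Qed.

Lemma Csmooth_exp O f n : open O -> Csmooth O f -> Csmooth O (fun x => f x ^+ n).
Proof.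
move=> oO hf; elim: n => [|n IH].
  by apply: Csmooth_congr (Csmooth_cst 1 oO) => x _; rewrite expr0.
by apply: Csmooth_congr (Csmooth_mul oO hf IH) => x _; rewrite exprS.
Qed.

(* [f] stands for the sequence of the derivatives of [f 0]. *)
Lemma Csmooth_comp1 O (I : set R) (f : nat -> R -> R) u : open O -> (forall x, O x -> I (u x)) ->
  (forall n x, I x -> is_derive x 1 (f n) (f n.+1 x)) -> Csmooth O u ->
  forall n, Csmooth O (fun x => f n (u x)).
Proof.
move=> oO uI df hu n m; have cf n' x : O x -> {for x, continuous (fun y => f n' (u y))}.
  move=> Ox; apply: (@continuous_comp _ _ _ u (f n')); first exact: Csmooth_cont Ox.
  by apply: is_derive_continuous; apply: df; exact: uI.
elim: m n => [|m IH] n; first by apply: Cspace0 => // x; exact: cf.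
apply: CspaceS => // [x|i]; first exact: cf.
exists (fun x => f n.+1 (u x) * pd i u x); split.
  move=> x Ox; apply: isD_comp1; first by apply: df; exact: uI.
  exact: Csmooth_derive Ox.
by apply: Cspace_mul => //; exact: (Csmooth_pd i oO hu).
Qed.

End Fixed.

(** The derivatives of [F (X x)] involve the compositions [pd j F (X x)], so the induction on the
    order runs over all smooth [F] at once. *)
Lemma Csmooth_comp k N (O : set 'rV[R]_k) (O' : set 'rV[R]_N) (F : 'rV[R]_N -> R)
    (X : 'rV[R]_k -> 'rV[R]_N) : open O -> open O' -> (forall x, O x -> O' (X x)) ->
  Csmooth O' F -> (forall j, Csmooth O (fun x => X x 0 j)) -> Csmooth O (fun x => F (X x)).
Proof.
move=> oO oO' XO hF hX m.
have dF G i x : Csmooth O' G -> O x ->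
    is_derive x (delta_mx 0 i) (fun z => G (X z)) (\sum_j pd j G (X x) * pd i (fun y => X y 0 j) x).
  move=> hG Ox; apply: (@isD_comp _ _ _ G (fun j => pd j G)).
  - apply: filterS (open_nbhs_nbhs (conj oO' (XO _ Ox))) => z Oz j.
    exact: Csmooth_derive Oz.
  - by move=> j; apply: (Csmooth_cont oO' (Csmooth_pd j oO' hG)); exact: XO.
  - by move=> j; exact: Csmooth_derive Ox.
have cX x : O x -> {for x, continuous X}.
  move=> Ox B /nbhs_ballP [e /= e0 eB].
  have e20 : 0 < e / 2 by rewrite divr_gt0.
  have H : \forall y \near x, forall j, `|X x 0 j - X y 0 j| <= e / 2.
    apply: (@filter_forall _ _ _ (nbhs x)) => j.
    by have /cvgrPdist_le/(_ _ e20) := Csmooth_cont oO (hX j) Ox.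
  rewrite /= nbhs_simpl; apply: filterS H => y H; apply: eB.
  rewrite -ball_normE /=; apply: (@le_lt_trans _ _ (e / 2)); last first.
    by rewrite ltr_pdivrMr// ltr_pMr// ltr1n.
  by apply: (norm_rowP _ (ltW e20)).2 => j; rewrite !mxE.
have cF G x : Csmooth O' G -> O x -> {for x, continuous (fun y => G (X y))}.
  move=> hG Ox; apply: (@continuous_comp _ _ _ X G); first exact: cX.
  exact: (Csmooth_cont oO' hG (XO _ Ox)).
elim: m F hF => [|m IH] F hF; first by apply: Cspace0 => // x; exact: cF.
apply: CspaceS => // [x|i]; first exact: cF.
exists (fun x => \sum_j pd j F (X x) * pd i (fun y => X y 0 j) x); split.
  by move=> x; exact: dF.
apply: Cspace_sum => // j; apply: Cspace_mul => //; last exact: (Csmooth_pd i oO (hX j)).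
by apply: IH; exact: Csmooth_pd.
Qed.

Lemma pd_comp k N (O : set 'rV[R]_k) (O' : set 'rV[R]_N) (F : 'rV[R]_N -> R)
    (X : 'rV[R]_k -> 'rV[R]_N) i x : open O -> open O' -> (forall x, O x -> O' (X x)) ->
  Csmooth O' F -> (forall j, Csmooth O (fun x => X x 0 j)) -> O x ->
  pd i (fun x => F (X x)) x = \sum_j pd j F (X x) * pd i (fun y => X y 0 j) x.
Proof.
move=> oO oO' XO hF hX Ox; apply: pd_eq; apply: (@isD_comp _ _ _ F (fun j => pd j F)).
- apply: filterS (open_nbhs_nbhs (conj oO' (XO _ Ox))) => z Oz j.
  exact: Csmooth_derive Oz.
- by move=> j; apply: (Csmooth_cont oO' (Csmooth_pd j oO' hF)); exact: XO.
- by move=> j; exact: Csmooth_derive Ox.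
Qed.

End SmoothFunctions.

(** * Points [(y', t)], balls and cylinders *)

Section Geometry.
Context {R : realType} {d : nat}.
Implicit Types (y : 'rV[R]_(d + 1)) (r t : R) (x : 'rV[R]_d) (i : 'I_(d + 1)).

Definition pt x t : 'rV[R]_(d + 1) := row_mx x t%:M.

Lemma lsub_pt x t : lsubmx (pt x t) = x.
Proof. exact: row_mxKl. Qed.

Lemma tco_pt x t : tco (pt x t) = t.
Proof. by rewrite /tco /pt /tix row_mxEr mxE eqxx mulr1n. Qed.

Lemma pt_eta y : pt (lsubmx y) (tco y) = y.
Proof.
rewrite -[RHS]hsubmxK /pt; congr row_mx; apply/matrixP => i j.
by rewrite !ord1 !mxE eqxx mulr1n.
Qed.

Lemma tix_or_yix i : i = tix \/ exists j, i = yix j.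
Proof.
by case: (split_ordP i) => j ->; [right; exists j|left; rewrite (ord1 j)].
Qed.

Lemma yix_neq (j : 'I_d) : (yix j == tix) = false.
Proof. by apply/eqP => /(congr1 val) /= E; have := ltn_ord j; rewrite E addn0 ltnn. Qed.

Lemma pt_add_t x t (h : R) : h *: delta_mx 0 tix + pt x t = pt x (t + h).
Proof.
apply/rowP => i; rewrite /pt mxE; case: (tix_or_yix i) => [->|[j ->]].
  by rewrite !row_mxEr !mxE !eqxx mulr1 !mulr1n addrC.
by rewrite !row_mxEl !mxE yix_neq andbF mulr0 add0r.
Qed.

Lemma pt_add_y x t (h : R) (j : 'I_d) :
  h *: delta_mx 0 (yix j) + pt x t = pt (h *: delta_mx 0 j + x) t.
Proof.
apply/rowP => i; rewrite /pt mxE; case: (tix_or_yix i) => [->|[l ->]].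
  by rewrite !row_mxEr !mxE [tix == _]eq_sym yix_neq andbF mulr0 add0r.
by rewrite !row_mxEl !mxE /yix (inj_eq (@lshift_inj _ _)).
Qed.

Lemma lsub_add_t y (h : R) : lsubmx (h *: delta_mx 0 tix + y) = lsubmx y.
Proof. by rewrite -{1}(pt_eta y) pt_add_t lsub_pt. Qed.

Lemma lsub_add_y y (h : R) (j : 'I_d) :
  lsubmx (h *: delta_mx 0 (yix j) + y) = h *: delta_mx 0 j + lsubmx y.
Proof. by rewrite -{1}(pt_eta y) pt_add_y lsub_pt. Qed.

Lemma is_derive_lsub_y (c : 'rV[R]_d -> R) y j dc :
  is_derive (lsubmx y) (delta_mx 0 j) c dc ->
  is_derive y (delta_mx 0 (yix j)) (fun z => c (lsubmx z)) dc.
Proof.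
by apply: (@is_derive_affine R _ _ R (@lsubmx R 1 d 1) c y _ _) => h; exact: lsub_add_y.
Qed.

Lemma is_derive_lsub_t (c : 'rV[R]_d -> R) y :
  is_derive y (delta_mx 0 tix) (fun z => c (lsubmx z)) 0.
Proof.
apply: (@is_derive_affine R _ _ R (@lsubmx R 1 d 1) c y _ 0).
  by move=> h; rewrite scaler0 add0r lsub_add_t.
exact: is_derive0.
Qed.

Lemma is_derive_pt_t (f : 'rV[R]_(d + 1) -> R) x t df :
  is_derive (pt x t) (delta_mx 0 tix) f df -> is_derive t 1 (fun s => f (pt x s)) df.
Proof.
apply: (@is_derive_affine R _ _ R (fun s : R => pt x s) f t 1 (delta_mx 0 tix)) => h.
by rewrite pt_add_t [h%:A]mulr1 addrC.
Qed.

Lemma is_derive_pt_y (f : 'rV[R]_(d + 1) -> R) x t j df :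
  is_derive (pt x t) (delta_mx 0 (yix j)) f df ->
  is_derive x (delta_mx 0 j) (fun z => f (pt z t)) df.
Proof.
apply: (@is_derive_affine R _ _ R (fun z => pt z t) f x _ (delta_mx 0 (yix j))) => h.
by rewrite pt_add_y.
Qed.

Lemma enorm_ge0 k (x : 'rV[R]_k) : 0 <= enorm x.
Proof. exact: sqrtr_ge0. Qed.

Lemma continuous_enorm k : continuous (@enorm R k).
Proof.
move=> x; apply: (@continuous_comp _ _ _ (fun x : 'rV[R]_k => \sum_i x 0 i ^+ 2) (@Num.sqrt R)).
  have H : Csmooth setT (fun x : 'rV[R]_k => \sum_i x 0 i ^+ 2).
    apply: Csmooth_sum => [|i]; first exact: openT.
    by apply: Csmooth_exp; [exact: openT|apply: Csmooth_coord; exact: openT].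
  exact: (Csmooth_cont openT H).
exact: sqrt_continuous.
Qed.

Lemma open_Bball r : open (@Bball R d r).
Proof.
rewrite (_ : Bball r = @enorm R d @^-1` [set x | x < r]) //.
by apply: open_comp; [move=> x _; exact: continuous_enorm | exact: open_lt].
Qed.

Lemma continuous_lsub : continuous (@lsubmx R 1 d 1).
Proof.
move=> y B /nbhs_ballP [e /= e0 eB]; apply/nbhs_ballP; exists e => //= z [_ yz].
by apply: eB; split=> // i j; rewrite !mxE; exact: yz.
Qed.

Lemma continuous_tco : continuous (@tco R d).
Proof. exact: coord_continuous. Qed.

Lemma open_Gcyl r : open (@Gcyl R d r).
Proof.
rewrite (_ : Gcyl r = (@lsubmx R 1 d 1 @^-1` Bball r) `&`
    ((@tco R d @^-1` [set x | 0 < x]) `&` (@tco R d @^-1` [set x | x < r]))); last first.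
  by apply/seteqP; split => [y [y1 /andP[]]|y [y1 [y2 y3]]]; split=> //; rewrite /= ?y2.
apply: openI; first by apply: open_comp; [move=> x _; exact: continuous_lsub|exact: open_Bball].
apply: openI; apply: open_comp; try by move=> x _; exact: continuous_tco.
  exact: open_gt.
exact: open_lt.
Qed.

Lemma Gcyl_pt x t r : Gcyl r (pt x t) <-> enorm x < r /\ 0 < t < r.
Proof. by rewrite /Gcyl /Bball /= lsub_pt tco_pt. Qed.

Lemma Gcyl_le r r' : r <= r' -> @Gcyl R d r `<=` Gcyl r'.
Proof.
move=> rr y [y1 /andP[y2 y3]]; split; first exact: lt_le_trans rr.
by rewrite y2 (lt_le_trans y3 rr).
Qed.

Lemma Gcyl_tco_gt0 r y : Gcyl r y -> 0 < tco y.
Proof. by case=> _ /andP[]. Qed.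

Lemma Bball_exists r x : 0 < r -> Bball r x -> exists2 r', 0 < r' < r & Bball r' x.
Proof.
move=> r0 xr; have m0 := enorm_ge0 x; rewrite /Bball /= in xr.
exists ((enorm x + r) / 2); first by rewrite divr_gt0 ?ltr_wpDl//= midf_lt.
by rewrite /Bball /= midf_lt.
Qed.

End Geometry.

Lemma powR_add (R : realType) (t k l : R) : 0 < t -> t `^ (k + l) = t `^ k * t `^ l.
Proof. by move=> t0; rewrite powRD// (gt_eqF t0) implybT. Qed.

(** * Conormal functions *)

Section Conormal.
Context {R : realType} {d : nat}.
Variable (Rad : R).
Implicit Types (y : 'rV[R]_(d + 1)) (f g : 'rV[R]_(d + 1) -> R) (r k l : R) (i : 'I_(d + 1)).

Notation G := (@Gcyl R d Rad).

(** The constant may depend on [r]: only the face [t = 0] matters, and nothing is claimed uniformly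
    up to the lateral side or the top. *)
Definition bound k f := forall r, 0 < r < Rad ->
  exists C, forall y, Gcyl r y -> `|f y| <= C * tco y `^ k.

Definition wt i y : R := if i == tix then tco y else 1.

Definition Z i f y : R := wt i y * pd i f y.

(* Bounds for the words of length at most [n], with at most [j] letters
   [t d/dt], in the vector fields [t d/dt] and [d/dy_i] tangent to [t = 0]. *)
Fixpoint con (n j : nat) k f : Prop :=
  bound k f /\
  if n is n'.+1 then
    forall i, ((i == tix) <= j)%N -> con n' (j - (i == tix)) k (Z i f)
  else True.

(** Tangential letters are unlimited and only the normal ones are counted: [j] is the quantity that
    the bootstrap through the equation increases. *)
Definition cn j k f := Csmooth G f /\ forall n, con n j k f.

Let oG : open G := @open_Gcyl R d Rad.

Lemma G_r r y : 0 < r < Rad -> Gcyl r y -> G y.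
Proof. by move=> /andP[_ /ltW rR]; exact: Gcyl_le. Qed.

Lemma bound_congr k f g : (forall y, G y -> f y = g y) -> bound k f -> bound k g.
Proof.
move=> fg H r rR; have [C HC] := H r rR; exists C => y yr.
by rewrite -fg; [exact: HC|exact: G_r yr].
Qed.

Lemma bound_ge0 k f r : bound k f -> 0 < r < Rad ->
  exists2 C, 0 <= C & forall y, Gcyl r y -> `|f y| <= C * tco y `^ k.
Proof.
move=> H rR; have [C HC] := H r rR; exists `|C| => // y /HC H'.
by apply: le_trans H' _; rewrite ler_wpM2r ?powR_ge0 ?ler_norm.
Qed.

Lemma bound_add k f g : bound k f -> bound k g -> bound k (fun y => f y + g y).
Proof.
move=> hf hg r rR; have [C HC] := hf r rR; have [C' HC'] := hg r rR.
exists (C + C') => y yr; rewrite mulrDl; apply: le_trans (ler_normD _ _) _.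
by rewrite lerD ?HC ?HC'.
Qed.

Lemma bound_mul k l f g : bound k f -> bound l g -> bound (k + l) (fun y => f y * g y).
Proof.
move=> hf hg r rR; have [C C0 HC] := bound_ge0 hf rR; have [C' C'0 HC'] := bound_ge0 hg rR.
exists (C * C') => y yr; rewrite normrM powR_add ?(Gcyl_tco_gt0 yr)//.
by rewrite mulrACA ler_pM ?HC ?HC'.
Qed.

Lemma powR_le_pos k l r t : 0 < t < r -> l <= k -> t `^ k <= r `^ (k - l) * t `^ l.
Proof.
move=> /andP[t0 tr] lk; rewrite -{1}(subrK l k) (powR_add (k - l) l t0).
rewrite ler_wpM2r ?powR_ge0// ge0_ler_powR ?subr_ge0// ?nnegrE ltW// (lt_trans t0)//.
Qed.

Lemma bound_le k l f : l <= k -> bound k f -> bound l f.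
Proof.
move=> lk hf r rR; have [C C0 HC] := bound_ge0 hf rR.
exists (C * r `^ (k - l)) => y yr; apply: le_trans (HC _ yr) _.
by rewrite -mulrA ler_wpM2l// powR_le_pos//; case: yr.
Qed.

Lemma Z_congr i f g y : (forall y, G y -> f y = g y) -> G y -> Z i f y = Z i g y.
Proof. by move=> fg Gy; rewrite /Z (pd_congr i oG fg Gy). Qed.

Lemma con_bound n j k f : con n j k f -> bound k f.
Proof. by case: n => [|n] []. Qed.

Lemma con_congr n j k f g : (forall y, G y -> f y = g y) -> con n j k f -> con n j k g.
Proof.
elim: n j f g => [|n IH] j f g fg [bf H]; split=> //; try exact: bound_congr fg bf.
by move=> i ij; apply: IH (H i ij) => y; exact: Z_congr.
Qed.

Lemma con_weak n j k n' j' k' f : (n' <= n)%N -> (j' <= j)%N -> k' <= k ->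
  con n j k f -> con n' j' k' f.
Proof.
elim: n n' j j' f => [|n IH] [|n'] j j' f //= nn jj kk [bf H]; split=> //;
  try exact: bound_le bf.
move=> i ij; apply: IH (H i _) => //; first exact: leq_sub2r.
exact: leq_trans jj.
Qed.

Lemma Z_add i f g y : Csmooth G f -> Csmooth G g -> G y ->
  Z i (fun y => f y + g y) y = Z i f y + Z i g y.
Proof.
move=> hf hg Gy; rewrite /Z -mulrDr; congr (_ * _); apply: pd_eq.
by apply: isD_add; exact: Csmooth_derive Gy.
Qed.

Lemma Z_mul i f g y : Csmooth G f -> Csmooth G g -> G y ->
  Z i (fun y => f y * g y) y = Z i f y * g y + f y * Z i g y.
Proof.
move=> hf hg Gy; rewrite /Z.
rewrite (pd_eq (isD_mul (Csmooth_derive i oG hf Gy) (Csmooth_derive i oG hg Gy))).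
by ring.
Qed.

Lemma Csmooth_tco (O : set 'rV[R]_(d + 1)) : open O -> Csmooth O (@tco R d).
Proof. exact: Csmooth_coord. Qed.

Lemma Csmooth_wt (O : set 'rV[R]_(d + 1)) i : open O -> Csmooth O (wt i).
Proof.
rewrite /wt => oO; case: (i == tix); first exact: Csmooth_tco.
exact: Csmooth_cst.
Qed.

Lemma Csmooth_Z i f : Csmooth G f -> Csmooth G (Z i f).
Proof.
move=> hf; apply: Csmooth_mul => //; [exact: Csmooth_wt|exact: Csmooth_pd].
Qed.

Lemma con_add n j k f g : Csmooth G f -> Csmooth G g -> con n j k f -> con n j k g ->
  con n j k (fun y => f y + g y).
Proof.
elim: n j f g => [|n IH] j f g sf sg [bf hf] [bg hg]; split=> //; try exact: bound_add.
move=> i ij; apply: (con_congr (f := fun y => Z i f y + Z i g y)).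
  by move=> y Gy; rewrite Z_add.
by apply: IH; [exact: Csmooth_Z|exact: Csmooth_Z|exact: hf|exact: hg].
Qed.

Lemma con_mul n j k l f g : Csmooth G f -> Csmooth G g -> con n j k f -> con n j l g ->
  con n j (k + l) (fun y => f y * g y).
Proof.
elim: n j f g => [|n IH] j f g sf sg cf cg; split=> //;
  try exact: bound_mul (con_bound cf) (con_bound cg).
move=> i ij; apply: (con_congr (f := fun y => Z i f y * g y + f y * Z i g y)).
  by move=> y Gy; rewrite Z_mul.
have sZf := Csmooth_Z i sf; have sZg := Csmooth_Z i sg.
have jj : (j - (i == tix) <= j)%N by exact: leq_subr.
apply: con_add.
- exact: Csmooth_mul.
- exact: Csmooth_mul.
- by apply: IH => //; [case: cf => _; apply|exact: con_weak cg].
- by apply: IH => //; [exact: con_weak cf|case: cg => _; apply].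
Qed.

(** The weight [t] is constant in the tangential directions, so the fields commute and letters of a
    word may be reordered. *)
Lemma ZC i i' f y : Csmooth G f -> G y -> Z i (Z i' f) y =
  Z i' (Z i f) y.
Proof.
move=> sf Gy; case: (eqVneq i i') => [->//|ii'].
have key (a b : 'I_(d + 1)) : a != b -> Z a (Z b f) y = wt a y * wt b y * pd a (pd b f) y.
  move=> ab; rewrite /Z (pd_eq (isD_mul (Csmooth_derive a oG (Csmooth_wt b oG) Gy)
    (Csmooth_derive a oG (Csmooth_pd b oG sf) Gy))).
  suff -> : pd a (wt b) y = 0 by ring.
  have [bt|/negPf bt] := eqVneq b tix; last first.
    by rewrite (_ : wt b = fun=> 1) ?(pd_eq (isD_cst y _ 1))//; rewrite /wt bt.
  rewrite (_ : wt b = @tco R d); last by rewrite /wt bt eqxx.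
  move: ab; rewrite bt; case: (tix_or_yix a) => [->|[a' ->]]; rewrite ?eqxx// => _.
  apply: pd_eq; apply: is_derive_of_line; rewrite (_ : (fun _ => _) = fun=> tco y) ?isD_cst//.
    exact: isD_cst.
  by apply/funext => h; rewrite -{1}(pt_eta y) pt_add_y tco_pt.
rewrite (key _ _ ii') (key i' i); last by rewrite eq_sym.
by rewrite (pdC i i' oG sf Gy) [wt i' y * _]mulrC.
Qed.

Lemma cn_congr j k f g : (forall y, G y -> f y = g y) -> cn j k f -> cn j k g.
Proof. by move=> fg [sf cf]; split=> [|n]; [exact: Csmooth_congr sf|exact: con_congr (cf n)]. Qed.

Lemma cn_weak j k j' k' f : (j' <= j)%N -> k' <= k -> cn j k f -> cn j' k' f.
Proof. by move=> jj kk [sf cf]; split=> // n; exact: con_weak (cf n). Qed.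

Lemma cn_add j k f g : cn j k f -> cn j k g -> cn j k (fun y => f y + g y).
Proof. by move=> [sf cf] [sg cg]; split=> [|n]; [exact: Csmooth_add|exact: con_add]. Qed.

Lemma cn_mul j k l f g : cn j k f -> cn j l g -> cn j (k + l) (fun y => f y * g y).
Proof. by move=> [sf cf] [sg cg]; split=> [|n]; [exact: Csmooth_mul|exact: con_mul]. Qed.

Lemma cn_Z j k i f : ((i == tix) <= j)%N -> cn j k f -> cn (j - (i == tix)) k (Z i f).
Proof.
move=> ij [sf cf]; split=> [|n]; first exact: Csmooth_Z.
by case: (cf n.+1) => _; apply.
Qed.

Lemma cn_Zt j k f : cn j.+1 k f -> cn j k (Z tix f).
Proof. by move=> /(@cn_Z _ _ tix); rewrite eqxx subn1; apply. Qed.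

Lemma cn_Zy j k (i : 'I_d) f : cn j k f -> cn j k (Z (yix i) f).
Proof. by move=> /(@cn_Z _ _ (yix i)); rewrite yix_neq subn0; apply. Qed.

(* One more letter [t d/dt] can always be moved to the innermost position. *)
Lemma cn_gain j k f : cn j k f -> cn j k (Z tix f) -> cn j.+1 k f.
Proof.
move=> [sf cf] [_ cZ]; split=> // n.
have {cf} cf n' : con n' j k f by [].
elim: n f sf cf cZ => [|n IH] f sf cf cZ; first by split=> //; exact: con_bound (cf 0%N).
split; first exact: con_bound (cf 0%N).
move=> i; case: (tix_or_yix i) => [-> _|[i' ->]].
  by rewrite eqxx subn1; exact: cZ.
rewrite yix_neq subn0 => _; apply: IH; first exact: Csmooth_Z.
  by move=> n'; case: (cf n'.+1) => _ /(_ (yix i')); rewrite yix_neq subn0; apply.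
move=> n'; apply: (con_congr (f := Z (yix i') (Z tix f))) => [y Gy|]; first exact: ZC.
by case: (cZ n'.+1) => _ /(_ (yix i')); rewrite yix_neq subn0; apply.
Qed.

(** The conormal version of [O(t^k)]: the bound survives every word in the tangential fields, so it
    may be differentiated freely. *)
Definition Oc k f := forall j, cn j k f.

Lemma Oc_congr k f g : (forall y, G y -> f y = g y) -> Oc k f -> Oc k g.
Proof. by move=> fg hf j; exact: cn_congr (hf j). Qed.

Lemma Oc_le k l f : l <= k -> Oc k f -> Oc l f.
Proof. by move=> lk hf j; exact: cn_weak (hf j). Qed.

Lemma Oc_add k f g : Oc k f -> Oc k g -> Oc k (fun y => f y + g y).
Proof. by move=> hf hg j; exact: cn_add. Qed.

Lemma Oc_mul k l f g : Oc k f -> Oc l g -> Oc (k + l) (fun y => f y * g y).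
Proof. by move=> hf hg j; exact: cn_mul. Qed.

Lemma Oc_Z k i f : Oc k f -> Oc k (Z i f).
Proof.
move=> hf j; have := cn_Z (i := i) _ (hf (j + (i == tix))%N); rewrite addnK; apply.
exact: leq_addl.
Qed.

Lemma Oc_smooth k f : Oc k f -> Csmooth G f.
Proof. by move=> /(_ 0%N)[]. Qed.

Lemma Oc_bound k f : Oc k f -> bound k f.
Proof. by move=> /(_ 0%N)[_ /(_ 0%N)] []. Qed.

(** A class stable under the fields carries its common bound through every word. Explicit functions
    are then treated by naming a small stable class, such as the constant multiples of [t^a]. *)
Lemma Oc_ind (P : ('rV[R]_(d + 1) -> R) -> Prop) k :
  (forall f, P f -> Csmooth G f /\ bound k f) ->
  (forall f i, P f -> exists2 g, P g & forall y, G y -> Z i f y = g y) ->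
  forall f, P f -> Oc k f.
Proof.
move=> H1 H2 f Pf j; split=> [|n]; first by case: (H1 f Pf).
elim: n j f Pf => [|n IH] j f Pf; split=> //; try by case: (H1 f Pf).
move=> i ij; have [g Pg fg] := H2 f i Pf.
by apply: (con_congr (f := g)) => [y /fg//|]; exact: IH.
Qed.

Lemma Csmooth_powR a : Csmooth G (fun y => tco y `^ a).
Proof.
move=> m; elim: m a => [|m IH] a.
  apply: Cspace0 => // y Gy; apply: (@continuous_comp _ _ _ (@tco R d) (fun t => t `^ a)).
    exact: continuous_tco.
  by apply: is_derive_continuous; apply: is_derive1_powR; exact: Gcyl_tco_gt0 Gy.
apply: CspaceS => // [y Gy|i].
  apply: (@continuous_comp _ _ _ (@tco R d) (fun t => t `^ a)); first exact: continuous_tco.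
  by apply: is_derive_continuous; apply: is_derive1_powR; exact: Gcyl_tco_gt0 Gy.
exists (fun y => a * tco y `^ (a - 1) * pd i (@tco R d) y); split.
  move=> y Gy; apply: (isD_comp1 (f := fun t => t `^ a)).
    by apply: is_derive1_powR; exact: Gcyl_tco_gt0 Gy.
  exact: (Csmooth_derive i oG (Csmooth_tco oG) Gy).
apply: Cspace_mul => //; last exact: (Csmooth_pd i oG (Csmooth_tco oG)).
by apply: Cspace_mul => //; exact: Cspace_cst.
Qed.

Lemma pd_tco y : pd tix (@tco R d) y = 1.
Proof.
apply: pd_eq; apply: is_derive_of_line.
rewrite (_ : (fun _ => _) = fun h => tco y + h); last first.
  by apply/funext => h; rewrite -{1}(pt_eta y) pt_add_t tco_pt.
by have := isD_add (isD_cst (0 : R) 1 (tco y)) (is_derive_id (0 : R) 1); rewrite add0r.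
Qed.

Lemma pd_y_of_t (f : R -> R) (i : 'I_d) y : pd (yix i) (fun y => f (tco y)) y = 0.
Proof.
apply: pd_eq; apply: is_derive_of_line.
rewrite (_ : (fun _ => _) = fun=> f (tco y)); first exact: isD_cst.
by apply/funext => h; rewrite -{1}(pt_eta y) pt_add_y tco_pt.
Qed.

Lemma Z_tE f y : Z tix f y = tco y * pd tix f y.
Proof. by rewrite /Z /wt eqxx. Qed.

Lemma Z_yE (i : 'I_d) f y : Z (yix i) f y = pd (yix i) f y.
Proof. by rewrite /Z /wt yix_neq mul1r. Qed.

Lemma Z_t_of_t (f : R -> R) y df : is_derive (tco y) 1 f df ->
  Z tix (fun y => f (tco y)) y = tco y * df.
Proof.
move=> hf; rewrite Z_tE (pd_eq (isD_comp1 hf (Csmooth_derive tix openT (Csmooth_tco openT) I))).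
by rewrite pd_tco mulr1.
Qed.

Lemma powR_succ (t a : R) : 0 < t -> t * t `^ (a - 1) = t `^ a.
Proof.
move=> t0; rewrite -{1}(powRr1 (ltW t0)) -powR_add//.
by rewrite addrC subrK.
Qed.

Lemma Oc_powR a : Oc a (fun y => tco y `^ a).
Proof.
apply: (Oc_congr (f := fun y => 1 * tco y `^ a)); first by move=> y _; rewrite mul1r.
pose P f := exists c : R, f = fun y => c * tco y `^ a.
apply: (@Oc_ind P); last by exists 1.
  move=> _ [c ->]; split; first by apply: Csmooth_scal => //; exact: Csmooth_powR.
  move=> r rR; exists `|c| => y yr; rewrite normrM [`|_ `^ _|]ger0_norm//.
  exact: powR_ge0.
move=> _ i [c ->]; case: (tix_or_yix i) => [->|[i' ->]].
  exists (fun y => c * a * tco y `^ a); first by exists (c * a).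
  move=> y Gy; have t0 := Gcyl_tco_gt0 Gy.
  rewrite (Z_t_of_t (isD_scal c (is_derive1_powR a t0))).
  by rewrite -(powR_succ a t0); ring.
exists (fun y => 0 * tco y `^ a); first by exists 0.
by move=> y Gy; rewrite Z_yE (pd_y_of_t (fun t => c * t `^ a)) mul0r.
Qed.

Lemma Oc_cst c : Oc 0 (fun=> c).
Proof.
pose P (f : 'rV[R]_(d + 1) -> R) := exists c : R, f = fun=> c.
apply: (@Oc_ind P); last by exists c.
  move=> _ [c' ->]; split; first exact: Csmooth_cst.
  by move=> r rR; exists `|c'| => y yr; rewrite powRr0 mulr1.
move=> _ i [c' ->]; exists (fun=> 0); first by exists 0.
by move=> y Gy; rewrite /Z (pd_eq (isD_cst _ _ _)) mulr0.
Qed.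

Lemma Oc_zero k : Oc k (fun=> 0).
Proof.
apply: (Oc_congr (f := fun y => 0 * tco y `^ k)); first by move=> y _; rewrite mul0r.
by rewrite -(add0r k); apply: Oc_mul; [exact: Oc_cst|rewrite add0r; exact: Oc_powR].
Qed.

Lemma Oc_scal k c f : Oc k f -> Oc k (fun y => c * f y).
Proof. by move=> hf; rewrite -(add0r k); apply: Oc_mul => //; exact: Oc_cst. Qed.

Lemma Oc_opp k f : Oc k f -> Oc k (fun y => - f y).
Proof. by move=> /(Oc_scal (-1)); apply: Oc_congr => y _; rewrite mulN1r. Qed.

Lemma Oc_sub k f g : Oc k f -> Oc k g -> Oc k (fun y => f y - g y).
Proof. by move=> hf hg; apply: Oc_add => //; exact: Oc_opp. Qed.

Lemma Oc_sum k (I : Type) (r : seq I) (P : pred I) (f : I -> 'rV[R]_(d + 1) -> R) :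
  (forall j, P j -> Oc k (f j)) -> Oc k (fun y => \sum_(j <- r | P j) f j y).
Proof.
move=> H; elim: r => [|a r IH].
  by apply: Oc_congr (Oc_zero k) => y _; rewrite big_nil.
case Pa: (P a); last by apply: Oc_congr IH => y _; rewrite big_cons Pa.
by apply: Oc_congr (Oc_add (H a Pa) IH) => y _; rewrite big_cons Pa.
Qed.

Lemma Oc_tpow n : Oc n%:R (fun y => tco y ^+ n).
Proof.
apply: Oc_congr (Oc_powR n%:R) => y Gy.
by rewrite powR_mulrn// ltW// (Gcyl_tco_gt0 Gy).
Qed.

Lemma Oc_tco : Oc 1 (@tco R d).
Proof. exact: Oc_tpow 1. Qed.

Lemma Oc_tinv : Oc (-1) (fun y => (tco y)^-1).
Proof.
apply: Oc_congr (Oc_powR (-1)) => y Gy.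
by rewrite powR_inv1// ltW// (Gcyl_tco_gt0 Gy).
Qed.

Lemma Oc_div k f : Oc k f -> Oc (k - 1) (fun y => f y / tco y).
Proof. by move=> hf; apply: Oc_mul => //; exact: Oc_tinv. Qed.

(** For [t <= 1] apply [ln x < x] to [x = t^(-e)]; for [t > 1] use [ln t < t = t^(1+e) * t^(-e)] and
    [t < r]. *)
Lemma abs_ln_le (e r t : R) : 0 < e -> 0 < t < r -> `|ln t| <= (e^-1 + r `^ (1 + e)) * t `^ (- e).
Proof.
move=> e0 /andP[t0 tr]; have te0 : 0 < t `^ (- e) by rewrite powR_gt0.
rewrite mulrDl; have [t1|t1] := leP t 1.
  rewrite ler0_norm; last exact: ln_le0.
  have := ltW (ln_sublinear te0); rewrite ln_powR mulNr -mulrN => H.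
  rewrite -ler_pdivlMl// in H.
  by apply: le_trans H _; rewrite lerDl mulr_ge0 ?powR_ge0.
rewrite ger0_norm; last by rewrite ln_ge0// ltW.
apply: (@le_trans _ _ (r `^ (1 + e) * t `^ (- e))); last by rewrite lerDr mulr_ge0 ?invr_ge0// ltW.
apply: (@le_trans _ _ t); first exact: ltW (ln_sublinear t0).
rewrite -[leLHS](powRr1 (ltW t0)) -{1}(addrK e 1) powR_add//.
rewrite ler_wpM2r ?powR_ge0// ge0_ler_powR ?nnegrE ?addr_ge0 ?ltW//.
exact: lt_trans tr.
Qed.

Lemma pd_ln_derive i y : G y ->
  is_derive y (delta_mx 0 i) (fun y => ln (tco y)) ((tco y)^-1 * pd i (@tco R d) y).
Proof.
move=> Gy; apply: (isD_comp1 (f := @ln R)).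
  by apply: is_derive1_ln; exact: Gcyl_tco_gt0 Gy.
exact: (Csmooth_derive i oG (Csmooth_tco oG) Gy).
Qed.

Lemma Csmooth_ln : Csmooth G (fun y => ln (tco y)).
Proof.
have cl y : G y -> {for y, continuous (fun y => ln (tco y))}.
  move=> Gy; apply: (@continuous_comp _ _ _ (@tco R d) (@ln R)); first exact: continuous_tco.
  by apply: continuous_ln; exact: Gcyl_tco_gt0 Gy.
case=> [|m]; first exact: Cspace0.
apply: CspaceS => // i; exists (fun y => (tco y)^-1 * pd i (@tco R d) y); split.
  by move=> y; exact: pd_ln_derive.
apply: Cspace_mul => //; last exact: (Csmooth_pd i oG (Csmooth_tco oG)).
exact: Oc_smooth Oc_tinv _.
Qed.

Lemma Z_ln y : G y -> Z tix (fun y => ln (tco y)) y = 1.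
Proof.
move=> Gy; have t0 := Gcyl_tco_gt0 Gy.
by rewrite (Z_t_of_t (is_derive1_ln t0)) divff// gt_eqF.
Qed.

Lemma Oc_ln e : 0 < e -> Oc (- e) (fun y => ln (tco y)).
Proof.
move=> e0; pose P (f : 'rV[R]_(d + 1) -> R) := f = (fun y => ln (tco y)) \/ exists c, f = fun=> c.
apply: (@Oc_ind P); last by left.
  move=> _ [->|[c ->]].
    split; first exact: Csmooth_ln.
    move=> r rR; exists (e^-1 + r `^ (1 + e)) => y [_ yr]; exact: abs_ln_le.
  split; first exact: Csmooth_cst.
  by apply: bound_le (Oc_bound (Oc_cst c)); rewrite oppr_le0 ltW.
move=> _ i [->|[c ->]]; last first.
  exists (fun=> 0); first by right; exists 0.
  by move=> y Gy; rewrite /Z (pd_eq (isD_cst _ _ _)) mulr0.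
case: (tix_or_yix i) => [->|[i' ->]].
  by exists (fun=> 1); [right; exists 1|exact: Z_ln].
exists (fun=> 0); first by right; exists 0.
by move=> y Gy; rewrite Z_yE (pd_y_of_t (@ln R)).
Qed.

Lemma Oc_lnX e n : 0 < e -> Oc (- e) (fun y => ln (tco y) ^+ n).
Proof.
move=> e0; case: n => [|n].
  apply: (Oc_congr (f := fun=> 1)); first by move=> y _; rewrite expr0.
  by apply: Oc_le (Oc_cst 1); rewrite oppr_le0 ltW.
(* The loss [e] is shared equally among the logarithmic factors. *)
have e1 : 0 < e / n.+1%:R by rewrite divr_gt0.
have H m : Oc (- (e / n.+1%:R) * m%:R) (fun y => ln (tco y) ^+ m).
  elim: m => [|m IH].
    rewrite mulr0; apply: (Oc_congr (f := fun=> 1)); last exact: Oc_cst.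
    by move=> y _; rewrite expr0.
  rewrite -[m.+1%:R]natr1 mulrDr mulr1; apply: (Oc_congr (f := fun y => ln (tco y) ^+ m * ln (tco y))).
    by move=> y _; rewrite exprSr.
  by apply: Oc_mul => //; exact: Oc_ln.
by have := H n.+1; rewrite mulNr divfK// pnatr_eq0.
Qed.

(** Normal letters kill [c], tangential ones give another smooth function of [y'], and such
    functions are bounded on the compact ball of radius [r < Rad]. *)
Lemma Oc_lsub (c : 'rV[R]_d -> R) : Csmooth (Bball Rad) c -> Oc 0 (fun y => c (lsubmx y)).
Proof.
have oB := @open_Bball R d Rad.
pose P (f : 'rV[R]_(d + 1) -> R) := exists2 c : 'rV[R]_d -> R, Csmooth (Bball Rad) c &
  f = fun y => c (lsubmx y).
move=> sc; apply: (@Oc_ind P); last by exists c.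
  move=> _ [c' sc' ->]; split.
    apply: (Csmooth_comp oG oB (F := c') (X := @lsubmx R 1 d 1)) => //; first by move=> y [].
    move=> j; apply: Csmooth_congr (Csmooth_coord (yix j) oG) => y _.
    by rewrite mxE.
  move=> r /andP[r0 rR].
  have cB : compact [set x : 'rV[R]_d | enorm x <= r].
    apply: bounded_closed_compact.
      exists r; split; first exact: num_real.
      move=> M rM x /= xr; apply: (norm_rowP _ (ltW (lt_trans r0 rM))).2 => j.
      apply: le_trans (ltW rM); apply: le_trans xr.
      rewrite -sqrtr_sqr /enorm ler_sqrt ?sumr_ge0// => [|i _]; last exact: sqr_ge0.
      by rewrite (bigD1 j)//= lerDl sumr_ge0// => i _; exact: sqr_ge0.
    rewrite (_ : [set _ | _] = @enorm R d @^-1` [set x | x <= r])//.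
    by apply: preimage_closed; [move=> x _; exact: continuous_enorm|exact: closed_le].
  have cc : {within [set x : 'rV[R]_d | enorm x <= r], continuous (fun x => `|c' x|)}.
    apply: continuous_in_subspaceT => x; rewrite inE /= => xr.
    apply: (@continuous_comp _ _ _ c' Num.norm); last exact: norm_continuous.
    by apply: (Csmooth_cont oB sc'); rewrite /Bball /=; exact: le_lt_trans rR.
  have n0 : [set x : 'rV[R]_d | enorm x <= r] !=set0.
    exists 0; rewrite /= /enorm (eq_bigr (fun=> 0)) ?big1 ?sqrtr0 ?ltW// => i _.
    by rewrite mxE expr0n.
  have [x _ Hx] := EVT_max_rV n0 cB cc.
  exists `|c' x| => y [yr _]; rewrite powRr0 mulr1; apply: Hx.
  by rewrite inE /= ltW.
move=> _ i [c' sc' ->]; case: (tix_or_yix i) => [->|[i' ->]].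
  exists (fun=> 0); first by exists (fun=> 0) => //; exact: Csmooth_cst.
  by move=> y Gy; rewrite /Z (pd_eq (is_derive_lsub_t c' y)) mulr0.
exists (fun y => pd i' c' (lsubmx y)); first by exists (pd i' c') => //; exact: Csmooth_pd.
move=> y Gy; rewrite Z_yE; apply: pd_eq; apply: is_derive_lsub_y.
by apply: (Csmooth_derive i' oB sc'); case: Gy.
Qed.

End Conormal.

Lemma Oc_restrict (R : realType) d (r Rad k : R) (f : 'rV[R]_(d + 1) -> R) :
  r <= Rad -> Oc Rad k f -> Oc r k f.
Proof.
move=> rR hf j; have [sf cf] := hf j; split=> [|n].
  by apply: Csmooth_sub sf; exact: Gcyl_le.
have br g : bound Rad k g -> bound r k g.
  by move=> H r' /andP[r'0 r'r]; apply: H; rewrite r'0 (lt_le_trans r'r).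
move: (cf n); elim: n j f {hf sf cf} => [|n IH] j f [bf H]; split=> //; try exact: br.
by move=> i ij; apply: IH; exact: H.
Qed.

(** * Inversion of Euler operators *)

Section UniformLimits.
Context {R : realType}.

Lemma continuous_uniform_limit (V : normedModType R) (F : V -> R) (x : V) (r : R) : 0 < r ->
  (forall e, 0 < e -> exists2 f : V -> R, {for x, continuous f} &
     forall y, ball x r y -> `|f y - F y| <= e) -> {for x, continuous F}.
Proof.
move=> r0 H; apply/cvgrPdist_le => e e0.
have e30 : 0 < e / 3 by rewrite divr_gt0.
have [f cf Hf] := H _ e30.
have /cvgrPdist_le/(_ _ e30) cf' := cf.
near=> y.
have yr : ball x r y by near: y; exact: nbhsx_ballx.
have -> : F x - F y = (f x - f y) - (f x - F x) + (f y - F y) by ring.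
have -> : e = e / 3 + e / 3 + e / 3 by field.
apply: le_trans (ler_normD _ _) _; rewrite lerD ?Hf//.
apply: le_trans (ler_normB _ _) _; rewrite lerD ?Hf//; last exact: ballxx.
by near: y.
Unshelve. all: by end_near. Qed.

Lemma is_derive_uniform_limit (V : normedModType R) (F F' : V -> R) (x v : V) (r : R) : 0 < r ->
  (forall e, 0 < e -> exists f f' : V -> R, forall y, ball x r y ->
     [/\ is_derive y v f (f' y), `|f y - F y| <= e & `|f' y - F' y| <= e]) ->
  {for x, continuous F'} -> is_derive x v F (F' x).
Proof.
move=> r0 H cF'; apply/is_derive_cvgP/cvgrPdist_le => e e0.
have e20 : 0 < e / 2 by rewrite divr_gt0.
have /cvgrPdist_le/(_ _ e20)/nbhs_ballP [r1 /= r10 Hr1] := cF'.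
pose r2 := Num.min r r1.
have r20 : 0 < r2 by rewrite lt_min r0.
have nv : \forall h \near (0 : R)^', `|h *: v| < r2.
  have : (h *: v) @[h --> (0 : R)^'] --> (0 : R) *: v.
    by apply: cvgZr_tmp; exact: nbhs_dnbhs.
  rewrite scale0r => /cvgrPdist_lt/(_ _ r20).
  by apply: filterS => h; rewrite sub0r normrN.
near=> h.
have h0 : h != 0 by near: h; exact: nbhs_dnbhs_neq.
have hv : `|h *: v| < r2 by near: h.
suff S : `|F (h *: v + x) - F x - h * F' x| <= e * `|h|.
  have hp : 0 < `|h| by rewrite normr_gt0.
  rewrite -(ler_pM2l hp) -normrM mulrBr.
  have -> : h * (h^-1 *: (F (h *: v + x) - F x)) = F (h *: v + x) - F x.
    by rewrite /GRing.scale /= mulVKf.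
  by rewrite distrC [leRHS]mulrC.
apply/ler_addgt0Pr => e' e'0.
(* The approximant is chosen after [h]: its errors in the two values and in the derivative add up to
   [e1 * (2 + |h|) = e'], and [e'] is arbitrary. *)
pose e1 := e' / (2 + `|h|).
have h20 : 0 < 2 + `|h| by rewrite ltr_pwDl.
have e10 : 0 < e1 by rewrite divr_gt0.
have [f [f' Hf]] := H _ e10.
have inb (s : R) : 0 <= s <= 1 -> ball x r2 (s *: (h *: v) + x).
  move=> /andP[s0 s1]; rewrite -ball_normE /= distrC addrK normrZ ger0_norm//.
  by apply: le_lt_trans hv; rewrite ler_piMl.
have inr s : 0 <= s <= 1 -> ball x r (s *: (h *: v) + x).
  by move=> /inb; apply: le_ball; rewrite ge_min lexx.
have dl (s : R) : 0 <= s <= 1 ->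
    is_derive (s *: (h *: v) + x) (h *: v) f (h * f' (s *: (h *: v) + x)).
  by move=> /inr/Hf[d _ _]; exact: is_derive_scale.
have [s /andP[s0 s1] E] := MVT_line (g := fun z => h * f' z) dl.
have s01 : 0 <= s <= 1 by rewrite !ltW.
have i1 : 0 <= (1 : R) <= 1 by rewrite ler01 lexx.
have i0 : 0 <= (0 : R) <= 1 by rewrite ler01 lexx.
have [_ A1 _] := Hf _ (inr 1 i1); have [_ A2 _] := Hf _ (inr 0 i0).
rewrite scale1r in A1; rewrite scale0r add0r in A2.
have [_ _ A3] := Hf _ (inr s s01).
have A4 : `|F' x - F' (s *: (h *: v) + x)| <= e / 2.
  by apply: Hr1; apply: le_ball (inb s s01); rewrite ge_min lexx orbT.
have -> : F (h *: v + x) - F x - h * F' x =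
   - (f (h *: v + x) - F (h *: v + x)) + (f x - F x)
   + h * (f' (s *: (h *: v) + x) - F' (s *: (h *: v) + x))
   - h * (F' x - F' (s *: (h *: v) + x))
   + (f (h *: v + x) - f x - h * f' (s *: (h *: v) + x)) by ring.
rewrite E subrr addr0.
have -> : e * `|h| + e' = e1 + e1 + `|h| * e1 + `|h| * e.
  have -> : e1 + e1 + `|h| * e1 = e1 * (2 + `|h|) by ring.
  by rewrite /e1 divfK ?gt_eqF// addrC mulrC.
apply: le_trans (ler_normB _ _) _; rewrite lerD//; last first.
  by rewrite normrM ler_wpM2l// (le_trans A4)//; lra.
apply: le_trans (ler_normD _ _) _; rewrite lerD//; last by rewrite normrM ler_wpM2l.
by apply: le_trans (ler_normD _ _) _; rewrite normrN lerD.
Unshelve. all: by end_near. Qed.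

(** Both [g - f] and [g + f] are nondecreasing on the interval. *)
Lemma increment_comparison (f f' g g' : R -> R) (a b : R) : a <= b ->
  (forall s, a <= s <= b -> [/\ is_derive s 1 f (f' s), is_derive s 1 g (g' s) & `|f' s| <= g' s]) ->
  `|f b - f a| <= g b - g a.
Proof.
move=> ab H.
have key (u : R -> R) (u' : R -> R) : (forall s, a <= s <= b -> is_derive s 1 u (u' s)) ->
    (forall s, a <= s <= b -> 0 <= u' s) -> u a <= u b.
  move=> du u0.
  have du' (s : R) : s \in `]a, b[%R -> is_derive s 1 u (u' s).
    by rewrite in_itv /= => /andP[? ?]; apply: du; rewrite !ltW.
  have cu : {within `[a, b], continuous u}.
    apply: continuous_in_subspaceT => s; rewrite inE /= in_itv /= => s01.
    exact: is_derive_continuous (du _ s01).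
  have [c cab E] := MVT_segment ab du' cu.
  have {}cab : a <= c <= b by move: cab; rewrite in_itv.
  by rewrite -subr_ge0 E mulr_ge0 ?subr_ge0// u0.
have K1 := key (fun s => g s - f s) (fun s => g' s - f' s).
have K2 := key (fun s => g s + f s) (fun s => g' s + f' s).
rewrite ler_norml; apply/andP; split.
  have : g a + f a <= g b + f b; last lra.
  apply: K2 => s /H [hf hg hl]; first exact: isD_add.
  by move: hl; rewrite ler_norml => /andP[? _]; lra.
have : g a - f a <= g b - f b; last lra.
apply: K1 => s /H [hf hg hl]; first exact: isD_sub.
by move: hl; rewrite ler_norml => /andP[_ ?]; lra.
Qed.

(** The comparison function [C / e * s^e] has derivative [C * s^(e-1)] for either sign of [e]; both
    signs occur, on the two sides of an indicial root. *)
Lemma increment_powR (f f' : R -> R) (C e a b : R) : 0 < a -> a <= b -> e != 0 ->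
  (forall s, a <= s <= b -> is_derive s 1 f (f' s) /\ `|f' s| <= C * s `^ (e - 1)) ->
  `|f b - f a| <= C / e * (b `^ e - a `^ e).
Proof.
move=> a0 ab e0 H; rewrite mulrBr.
apply: (@increment_comparison f f' (fun s => C / e * s `^ e) (fun s => C * s `^ (e - 1))) => // s sab.
have [h1 h2] := H s sab; split=> //.
have s0 : 0 < s by case/andP: sab => as_ _; exact: lt_le_trans as_.
have := isD_scal (C / e) (is_derive1_powR e s0).
by rewrite mulrA divfK.
Qed.

(** Every [phi s - E s] lies below every [phi s' + E s'], so the supremum of the former can serve as
    [c]. It is the limit at [0] as soon as [E] tends to [0]. *)
Lemma limit_at_0 (phi E : R -> R) (r : R) : 0 < r ->
  (forall a b, 0 < a -> a <= b -> b < r -> `|phi b - phi a| <= E b) ->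
  exists c, forall t, 0 < t < r -> `|phi t - c| <= E t.
Proof.
move=> r0 H.
have E0 t : 0 < t < r -> 0 <= E t.
  by move=> /andP[t0 tr]; have := H t t t0 (lexx t) tr; rewrite subrr normr0.
pose S := [set phi s - E s | s in [set s | 0 < s < r]].
have SP s s' : 0 < s < r -> 0 < s' < r -> phi s - E s <= phi s' + E s'.
  move=> sr s'r; have := E0 _ sr; have := E0 _ s'r => e1 e2.
  move: sr s'r => /andP[s0 sr] /andP[s'0 s'r].
  have [ss|/ltW ss] := leP s s'.
    by have := H s s' s0 ss s'r; rewrite ler_norml => /andP[? _]; lra.
  by have := H s' s s'0 ss sr; rewrite ler_norml => /andP[_ ?]; lra.
have r2 : 0 < r / 2 < r by rewrite divr_gt0//= ltr_pdivrMr// ltr_pMr// ltr1n.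
have Sub s' : 0 < s' < r -> ubound S (phi s' + E s').
  by move=> s'r _ [s sr <-]; exact: SP.
have S0 : S !=set0 by exists (phi (r / 2) - E (r / 2)), (r / 2).
have hS : has_sup S by split=> //; exists (phi (r / 2) + E (r / 2)); exact: Sub.
exists (sup S) => s sr.
have h1 : phi s - E s <= sup S by apply: sup_upper_bound => //; exists s.
have h2 : sup S <= phi s + E s by apply: ge_sup => //; exact: Sub.
by rewrite ler_norml; lra.
Qed.

(** This stands in for letting [t] tend to [0] in an inequality. *)
Lemma le0_of_powR (a C e p : R) : 0 < e -> 0 < p ->
  (forall t, 0 < t < p -> a <= C * t `^ e) -> a <= 0.
Proof.
move=> e0 p0 H; rewrite leNgt; apply/negP => a0.
(* If [t^e <= c], then [C * t^e <= a / 2 < a]. *)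
pose c := a / (2 * (`|C| + 1)).
have C0 : 0 < `|C| + 1 by rewrite ltr_wpDl.
have c0 : 0 < c by rewrite divr_gt0 ?mulr_gt0.
pose t := Num.min (p / 2) (c `^ e^-1).
have t0 : 0 < t by rewrite lt_min divr_gt0//= powR_gt0.
have tp : t < p by rewrite gt_min ltr_pdivrMr// ltr_pMr// ltr1n.
have te : t `^ e <= c.
  rewrite -[leRHS](powRr1 (ltW c0)) -(mulVf (lt0r_neq0 e0)) powRrM.
  by rewrite ge0_ler_powR ?nnegrE ?powR_ge0 ?(ltW e0) ?(ltW t0)// ge_min lexx orbT.
have := H t; rewrite t0 tp => /(_ isT).
apply/negP; rewrite -ltNge; apply: (@le_lt_trans _ _ ((`|C| + 1) * c)).
  apply: (@le_trans _ _ ((`|C| + 1) * t `^ e)); last by rewrite ler_wpM2l// ltW.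
  by rewrite ler_wpM2r ?powR_ge0// (le_trans (ler_norm _))// lerDl.
rewrite /c invfM mulrCA [_ * (_ * _^-1)]mulrCA mulfV ?gt_eqF// mulr1.
by rewrite gtr_pMr// invf_lt1// ltr1n.
Qed.

End UniformLimits.

(** * The operator [t d/dt - lam] on conormal functions *)

Section EulerOperator.
Context {R : realType} {d : nat}.
Variable (Rad : R).
Hypothesis Rad0 : 0 < Rad.
Implicit Types (y : 'rV[R]_(d + 1)) (f g u : 'rV[R]_(d + 1) -> R) (r k l : R) (i : 'I_(d + 1)).

Notation G := (@Gcyl R d Rad).
Let oG : open G := @open_Gcyl R d Rad.

Lemma con_sum n j k m (f : 'I_m -> 'rV[R]_(d + 1) -> R) :
  (forall a, Csmooth G (f a)) -> (forall a, con Rad n j k (f a)) ->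
  con Rad n j k (fun y => \sum_a f a y).
Proof.
move=> sf cf; have H (r : seq 'I_m) : con Rad n j k (fun y => \sum_(a <- r) f a y).
  elim: r => [|a r IH].
    apply: (con_congr (f := fun=> 0)); first by move=> y _; rewrite big_nil.
    by case: (Oc_zero (d := d) Rad k j) => _; apply.
  apply: (con_congr (f := fun y => f a y + \sum_(b <- r) f b y)).
    by move=> y _; rewrite big_cons.
  by apply: con_add => //; exact: Csmooth_sum.
exact: H.
Qed.

(** Each letter turns [pds s F (X y)] into a sum of products [pds (a :: s) F (X y) * Z X_a].
    Induction on the word length for all [s] together needs only bounds on the derivatives of [F]
    along [X]. *)
Lemma cn_comp N (O' : set 'rV[R]_N) (F : 'rV[R]_N -> R) (X : 'rV[R]_(d + 1) -> 'rV[R]_N) j :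
  open O' -> (forall y, G y -> O' (X y)) -> Csmooth O' F ->
  (forall s, bound Rad 0 (fun y => pds s F (X y))) ->
  (forall a, cn Rad j 0 (fun y => X y 0 a)) -> cn Rad j 0 (fun y => F (X y)).
Proof.
move=> oO XO sF bF cX; have sX a : Csmooth G (fun y => X y 0 a) by case: (cX a).
split=> [|n]; first exact: Csmooth_comp sF sX.
suff H s : con Rad n j 0 (fun y => pds s F (X y)) by exact: (H [::]).
elim: n j cX s => [|n IH] j cX s; first by split=> //; exact: bF.
split; first exact: bF.
move=> i ij; have sFs := Csmooth_pds s oO sF.
apply: (con_congr (f := fun y => \sum_a pds (a :: s) F (X y) * Z i (fun y => X y 0 a) y)).
  move=> y Gy; rewrite {2}/Z (pd_comp i oG oO XO sFs sX Gy) mulr_sumr.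
  by apply: eq_bigr => a _; rewrite /Z /=; ring.
have cX' a : cn Rad (j - (i == tix)) 0 (fun y => X y 0 a).
  by apply: cn_weak (cX a) => //; exact: leq_subr.
have sFX a : Csmooth G (fun y => pds (a :: s) F (X y)).
  exact: (Csmooth_comp oG oO XO (Csmooth_pds (a :: s) oO sF) sX).
apply: con_sum => a.
  by apply: Csmooth_mul => //; exact: Csmooth_Z.
rewrite -(addr0 0); apply: con_mul => //; first exact: Csmooth_Z.
  exact: IH.
by case: (cn_Z ij (cX a)).
Qed.

Variable lam : R.

Definition euler u y := Z tix u y - lam * u y.

(** The power [t^(-lam)] is the integrating factor of [t d/dt - lam]. *)
Lemma euler_derive u x t : Csmooth G u -> Gcyl Rad (pt x t) ->
  is_derive t 1 (fun s => s `^ (- lam) * u (pt x s)) (t `^ (- lam - 1) * euler u (pt x t)).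
Proof.
move=> su Gx; have t0 : 0 < t by have := Gcyl_tco_gt0 Gx; rewrite tco_pt.
have H := isD_mul (is_derive1_powR (- lam) t0)
  (is_derive_pt_t (Csmooth_derive tix oG su Gx)).
move: H; rewrite -(powR_succ (- lam) t0) /euler Z_tE tco_pt => H.
by apply: is_derive_eq H _; ring.
Qed.

Lemma euler_increment u k r : k != lam -> Csmooth G u -> bound Rad k (euler u) -> 0 < r < Rad ->
  exists2 C, 0 <= C & forall x a b, enorm x < r -> 0 < a -> a <= b -> b < r ->
    `|b `^ (- lam) * u (pt x b) - a `^ (- lam) * u (pt x a)| <=
    C / (k - lam) * (b `^ (k - lam) - a `^ (k - lam)).
Proof.
move=> kl su bu rR; have [C C0 HC] := bound_ge0 bu rR; exists C => // x a b xr a0 ab br.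
apply: (increment_powR (f := fun s => s `^ (- lam) * u (pt x s))
  (f' := fun t => t `^ (- lam - 1) * euler u (pt x t))) => //; first by rewrite subr_eq0.
move=> s /andP[as_ sb].
have s0 : 0 < s by exact: lt_le_trans as_.
have Gs : Gcyl r (pt x s) by apply/Gcyl_pt; rewrite xr s0 (le_lt_trans sb).
split; first by apply: euler_derive => //; exact: G_r Gs.
rewrite normrM ger0_norm ?powR_ge0// mulrC.
apply: le_trans (ler_wpM2r (powR_ge0 _ _) (HC _ Gs)) _.
rewrite tco_pt -mulrA -powR_add// ler_wpM2l// (_ : k + _ = k - lam - 1)//; ring.
Qed.

(** For [k < lam] integrate downwards from a positive height. The a priori bound of order [l] serves
    only at that height, where [t] does not degenerate, and the boundary term decays like [t^lam],
    faster than [t^k]. *)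
Lemma bound_euler_lt u k l : k < lam -> Csmooth G u -> bound Rad l u ->
  bound Rad k (euler u) -> bound Rad k u.
Proof.
move=> kl su bu be r /andP[r0 rR].
(* The starting slice [t = r] lies outside [Gcyl r], hence the larger cylinder. *)
pose r1 := (r + Rad) / 2.
have rr1 : r < r1 by rewrite midf_lt.
have r1R : 0 < r1 < Rad by rewrite (lt_trans r0 rr1) midf_lt.
have [C C0 HC] := euler_increment (negbT (lt_eqF kl)) su be r1R.
have [C1 C10 HC1] := bound_ge0 bu r1R.
(* The first summand comes from the integral, the second from the value at [t = r] together with
   [t^lam <= r^(lam-k) * t^k]. *)
pose K := C / (lam - k) + C1 * r `^ l * r `^ (- lam) * r `^ (lam - k).
exists K => y [yr /andP[t0 tr]]; rewrite -(pt_eta y) tco_pt.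
set x := lsubmx y in yr *; set t := tco y in t0 tr *.
have xr1 : enorm x < r1 by exact: lt_trans rr1.
have := HC x t r xr1 t0 (ltW tr) rr1.
have Gr : Gcyl r1 (pt x r) by apply/Gcyl_pt; rewrite xr1 r0.
have := HC1 _ Gr; rewrite tco_pt => Hr Hi.
have kl' : 0 < lam - k by rewrite subr_gt0.
have S : `|t `^ (- lam) * u (pt x t)| <= C / (lam - k) * t `^ (k - lam) + C1 * r `^ l * r `^ (- lam).
  have -> : t `^ (- lam) * u (pt x t) = r `^ (- lam) * u (pt x r) -
    (r `^ (- lam) * u (pt x r) - t `^ (- lam) * u (pt x t)) by ring.
  apply: le_trans (ler_normB _ _) _; rewrite addrC lerD//; last first.
    rewrite normrM ger0_norm ?powR_ge0// mulrC ler_wpM2r ?powR_ge0//.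
  apply: le_trans Hi _.
  have -> : C / (k - lam) = - (C / (lam - k)) by rewrite -opprB invrN mulrN.
  rewrite mulNr -mulrN opprB ler_wpM2l ?(divr_ge0 C0 (ltW kl'))//.
  by rewrite gerBl powR_ge0.
rewrite normrM ger0_norm ?powR_ge0// powRN in S.
have tl : 0 < t `^ lam by rewrite powR_gt0.
rewrite mulrC ler_pdivrMr// mulrDl -(mulrA (C / (lam - k))) -powR_add// subrK in S.
apply: le_trans S _; rewrite /K mulrDl lerD2l -[leRHS]mulrA ler_wpM2l//.
  by rewrite !mulr_ge0 ?powR_ge0.
by apply: powR_le_pos; [rewrite t0|exact: ltW].
Qed.

(** Because of this commutation, every estimate for [u] applies to each of its conormal
    derivatives. *)
Lemma Z_euler i u y : Csmooth G u -> G y -> Z i (euler u) y = euler (Z i u) y.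
Proof.
move=> su Gy; have sZ := Csmooth_Z tix su.
have sl : Csmooth G (fun y => - lam * u y) by exact: Csmooth_scal.
rewrite (@Z_congr _ _ Rad i (euler u) (fun y => Z tix u y + - lam * u y))//; last first.
  by move=> z _; rewrite /euler mulNr.
rewrite (Z_add i sZ sl Gy) (ZC i tix su Gy) (Z_mul i (Csmooth_cst _ oG) su Gy).
have -> : Z i (fun=> - lam) y = 0 by rewrite /Z (pd_eq (isD_cst _ _ _)) mulr0.
by rewrite /euler; ring.
Qed.

Lemma Csmooth_euler u : Csmooth G u -> Csmooth G (euler u).
Proof.
by move=> su; apply: Csmooth_sub' => //; [exact: Csmooth_Z|exact: Csmooth_scal].
Qed.

Lemma Oc_euler k u : Oc Rad k u -> Oc Rad k (euler u).
Proof. by move=> hu; apply: Oc_sub; [exact: Oc_Z|exact: Oc_scal]. Qed.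

Lemma Oc_euler_lt u k l : k < lam -> Oc Rad l u -> Oc Rad k (euler u) -> Oc Rad k u.
Proof.
move=> kl hu he.
apply: (@Oc_ind _ _ _ (fun u => Oc Rad l u /\ Oc Rad k (euler u))) => //.
  move=> f [f1 f2]; split; first exact: Oc_smooth f1.
  exact: bound_euler_lt kl (Oc_smooth f1) (Oc_bound f1) (Oc_bound f2).
move=> f i [f1 f2]; exists (Z i f) => //; split; first exact: Oc_Z.
apply: Oc_congr (Oc_Z i f2) => y Gy; apply: Z_euler => //.
exact: Oc_smooth f1.
Qed.

Section Limit.
Variable k : R.
Hypothesis lk : lam < k.
Let dl := k - lam.
Let dl0 : 0 < dl. Proof. by rewrite subr_gt0. Qed.

Definition euler_lim_at u x c := exists p K, 0 < p /\
  forall t, 0 < t < p -> `|t `^ (- lam) * u (pt x t) - c| <= K * t `^ dl.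

(** The limit of [t^(-lam) * u] at [t = 0], chosen point by point so that it becomes a function of
    [x] before any regularity is known. *)
Definition euler_lim u x := xget 0 [set c | euler_lim_at u x c].

Definition euler_ok u := Csmooth G u /\ Oc Rad k (euler u).

Lemma euler_lim_uniq u x c c' : euler_lim_at u x c -> euler_lim_at u x c' -> c = c'.
Proof.
move=> [p [K [p0 H]]] [p' [K' [p'0 H']]].
apply/eqP; rewrite -subr_eq0 -normr_le0.
have pp0 : 0 < Num.min p p' by rewrite lt_min p0.
apply: (le0_of_powR (C := K + K') dl0 pp0) => t; rewrite lt_min => /and3P[t0 tp tp'].
have -> : c - c' = (t `^ (- lam) * u (pt x t) - c') - (t `^ (- lam) * u (pt x t) - c) by ring.
apply: le_trans (ler_normB _ _) _; rewrite addrC mulrDl lerD ?H ?H' ?t0//.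
Qed.

Lemma euler_limP u r : euler_ok u -> 0 < r < Rad -> exists2 K, 0 <= K & forall y, Gcyl r y ->
  `|tco y `^ (- lam) * u y - euler_lim u (lsubmx y)| <= K * tco y `^ dl.
Proof.
move=> [su hu] rR.
have kl : k != lam by rewrite gt_eqF.
have [C C0 HC] := euler_increment kl su (Oc_bound hu) rR.
pose K := C / dl; have K0 : 0 <= K by rewrite divr_ge0// ltW.
exists K => // y [xr tr]; set x := lsubmx y in xr *; set t := tco y in tr *.
rewrite -[in u y](pt_eta y) -/x -/t.
pose phi s := s `^ (- lam) * u (pt x s).
have Hphi (a b : R) : 0 < a -> a <= b -> b < r -> `|phi b - phi a| <= K * b `^ dl.
  move=> a0 ab br; apply: le_trans (HC x a b xr a0 ab br) _.
  by rewrite -/dl -/K ler_wpM2l// gerBl powR_ge0.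
have r0 : 0 < r by case/andP: rR.
have [c Hc] := limit_at_0 r0 Hphi.
have Lc : euler_lim_at u x c by exists r, K.
suff -> : euler_lim u x = c by exact: Hc.
apply: (euler_lim_uniq _ Lc).
exact: (@xgetI _ 0 [set c | euler_lim_at u x c] c Lc).
Qed.

Lemma euler_ok_Z u i : euler_ok u -> euler_ok (Z i u).
Proof.
move=> [su hu]; split; first exact: Csmooth_Z.
by apply: Oc_congr (Oc_Z i hu) => y Gy; exact: Z_euler.
Qed.

(** The convergence is uniform on each smaller ball: one height [t] works for all its points.
    Continuity of the limit follows. *)
Lemma euler_lim_approx u r : euler_ok u -> 0 < r < Rad -> forall e, 0 < e ->
  exists2 t, 0 < t < r & forall z, Bball r z -> `|t `^ (- lam) * u (pt z t) - euler_lim u z| <= e.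
Proof.
move=> hu rR e e0; have [K K0 HK] := euler_limP hu rR.
have r0 : 0 < r by case/andP: rR.
apply: contrapT => /forall2NP H.
have : e <= 0; last by rewrite leNgt e0.
apply: (le0_of_powR (C := K) dl0 r0) => t tr.
have [//|/existsNP [z /not_implyP [zr /negP]]] := H t.
rewrite -ltNge => /ltW /le_trans; apply.
have Gz : Gcyl r (pt z t) by apply/Gcyl_pt.
by have := HK _ Gz; rewrite lsub_pt tco_pt.
Qed.

Lemma ball_in_Bball (x : 'rV[R]_d) : Bball Rad x -> exists r s : R, [/\ 0 < r < Rad, 0 < s &
  forall z, ball x s z -> Bball r z].
Proof.
move=> xR; have [r rR xr] := Bball_exists Rad0 xR.
have oB := @open_Bball R d r.
have /nbhs_ballP [s /= s0 Hs] := open_nbhs_nbhs (conj oB xr).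
by exists r, s.
Qed.

Lemma continuous_euler_lim u (x : 'rV[R]_d) : euler_ok u -> Bball Rad x -> {for x, continuous (euler_lim u)}.
Proof.
move=> hu xR; have [r [s [rR s0 Hs]]] := ball_in_Bball xR.
apply: (continuous_uniform_limit s0) => e e0.
have [t tr Ht] := euler_lim_approx hu rR e0.
exists (fun z => t `^ (- lam) * u (pt z t)); last by move=> z /Hs; exact: Ht.
have xr : enorm x < r by apply: Hs; exact: ballxx.
have Gx : G (pt x t) by apply: (G_r rR); apply/Gcyl_pt.
have cu : {for x, continuous (fun z => u (pt z t))}.
  apply: (@continuous_comp _ _ _ (fun z => pt z t) u); last exact: (Csmooth_cont oG hu.1 Gx).
  move=> B /nbhs_ballP [e' /= e'0 eB]; apply/nbhs_ballP; exists e' => //= z [_ xz].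
  apply: eB; split=> // i j; rewrite ord1; case: (tix_or_yix j) => [->|[j' ->]].
    by rewrite /pt /tix !row_mxEr; exact: ballxx.
  by rewrite /pt /yix !row_mxEl; exact: xz.
exact: (cvgM (@cst_continuous _ _ (t `^ (- lam)) x) cu).
Qed.

(** The tangential derivative of [u] satisfies the same hypotheses, so [t^(-lam) * u] and its
    derivative both converge uniformly. *)
Lemma is_derive_euler_lim u (x : 'rV[R]_d) (i : 'I_d) : euler_ok u -> Bball Rad x ->
  is_derive x (delta_mx 0 i) (euler_lim u) (euler_lim (Z (yix i) u) x).
Proof.
move=> hu xR; have [r [s [rR s0 Hs]]] := ball_in_Bball xR.
have hZ := euler_ok_Z (yix i) hu.
apply: (is_derive_uniform_limit s0); last exact: continuous_euler_lim.
move=> e e0.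
have [K K0 HK] := euler_limP hu rR; have [K' K'0 HK'] := euler_limP hZ rR.
have r0 : 0 < r by case/andP: rR.
have [t tr Ht] : exists2 t, 0 < t < r & (K + K') * t `^ dl <= e.
  apply: contrapT => /forall2NP H.
  have : e <= 0; last by rewrite leNgt e0.
  apply: (le0_of_powR (C := K + K') dl0 r0) => t tr.
  by have [//|/negP] := H t; rewrite -ltNge => /ltW.
have p1 : 0 <= K * t `^ dl by rewrite mulr_ge0 ?powR_ge0.
have p2 : 0 <= K' * t `^ dl by rewrite mulr_ge0 ?powR_ge0.
exists (fun z => t `^ (- lam) * u (pt z t)), (fun z => t `^ (- lam) * Z (yix i) u (pt z t)).
move=> z /Hs zr; have Gz : Gcyl r (pt z t) by apply/Gcyl_pt.
split.
- apply: isD_scal; rewrite Z_yE; apply: is_derive_pt_y.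
  exact: (Csmooth_derive _ oG hu.1 (G_r rR Gz)).
- by have := HK _ Gz; rewrite lsub_pt tco_pt; lra.
- by have := HK' _ Gz; rewrite lsub_pt tco_pt; lra.
Qed.

Lemma Csmooth_euler_lim u : euler_ok u -> Csmooth (Bball Rad) (euler_lim u).
Proof.
have oB := @open_Bball R d Rad.
move=> hu m; elim: m u hu => [|m IH] u hu.
  by apply: Cspace0 => // x; exact: continuous_euler_lim.
apply: CspaceS => // [x|i]; first exact: continuous_euler_lim.
exists (euler_lim (Z (yix i) u)); split; last by apply: IH; exact: euler_ok_Z.
by move=> x; exact: is_derive_euler_lim.
Qed.

(** For [k > lam] integrate upwards from [t = 0]. What remains is the kernel element [c(y') t^lam],
    with [c] the limit of [t^(-lam) * u]. *)
Lemma Oc_euler_gt u : Csmooth G u -> Oc Rad k (euler u) ->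
  exists2 c, Csmooth (Bball Rad) c & Oc Rad k (fun y => u y - c (lsubmx y) * tco y `^ lam).
Proof.
move=> su hu; exists (euler_lim u); first exact: Csmooth_euler_lim.
have scu u' : euler_ok u' -> Csmooth G (fun y => u' y - euler_lim u' (lsubmx y) * tco y `^ lam).
  move=> hu'; apply: Csmooth_sub' => //; first by case: hu'.
  apply: Csmooth_mul => //; last exact: Csmooth_powR.
  exact: Oc_smooth (Oc_lsub (Csmooth_euler_lim hu')).
have bcu u' : euler_ok u' -> bound Rad k (fun y => u' y - euler_lim u' (lsubmx y) * tco y `^ lam).
  move=> hu' r rR; have [K K0 HK] := euler_limP hu' rR.
  exists K => y yr; have t0 := Gcyl_tco_gt0 yr.
  have tl : 0 < tco y `^ lam by rewrite powR_gt0.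
  have -> : u' y - euler_lim u' (lsubmx y) * tco y `^ lam =
      (tco y `^ (- lam) * u' y - euler_lim u' (lsubmx y)) * tco y `^ lam.
    by rewrite mulrBl powRN mulrAC mulVf ?gt_eqF// mul1r.
  rewrite normrM [`|_ `^ _|]ger0_norm ?powR_ge0//.
  apply: le_trans (ler_wpM2r (ltW tl) (HK _ yr)) _.
  by rewrite -mulrA -powR_add// /dl subrK.
move=> j; split=> [|n]; first exact: scu.
have hu0 : euler_ok u by [].
elim: n j u {su hu} hu0 => [|n IH] j u hu; split=> //; try exact: bcu.
move=> i ij; case: (tix_or_yix i) => [->|[i' ->]]; last first.
  apply: (con_congr (f := fun y => Z (yix i') u y - euler_lim (Z (yix i') u) (lsubmx y) * tco y `^ lam)).
    move=> y Gy; rewrite [RHS]Z_yE Z_yE; apply/esym/pd_eq.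
    apply: isD_sub; first exact: (Csmooth_derive _ oG hu.1 Gy).
    have dt : is_derive y (delta_mx 0 (yix i')) (fun y => tco y `^ lam) 0.
      have := Csmooth_derive (yix i') oG (Csmooth_powR Rad lam) Gy.
      by rewrite (pd_y_of_t (fun t => t `^ lam)).
    have dc := is_derive_lsub_y (is_derive_euler_lim i' hu Gy.1).
    by have := isD_mul dc dt; rewrite mulr0 addr0.
  by apply: IH; exact: euler_ok_Z.
(* A normal letter applied to [w = u - c t^lam] gives [euler u + lam * w], since [t^lam] is in the
   kernel; this reduces to shorter words. *)
apply: (con_congr (f := fun y => euler u y + lam * (u y - euler_lim u (lsubmx y) * tco y `^ lam))).
  move=> y Gy; have t0 := Gcyl_tco_gt0 Gy.
  have sp := Csmooth_powR (d := d) Rad lam.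
  have dp : is_derive y (delta_mx 0 tix) (fun y => tco y `^ lam) (lam * tco y `^ (lam - 1)).
    have := isD_comp1 (is_derive1_powR lam t0) (Csmooth_derive tix oG (Csmooth_tco oG) Gy).
    by rewrite pd_tco mulr1.
  have dc := is_derive_lsub_t (euler_lim u) y.
  have := isD_sub (Csmooth_derive tix oG hu.1 Gy) (isD_mul dc dp).
  rewrite mul0r add0r [RHS]Z_tE => /pd_eq ->; rewrite /euler Z_tE.
  by rewrite -(powR_succ lam t0); ring.
have jj : (j - (tix == tix :> 'I_(d + 1)) <= j)%N by exact: leq_subr.
apply: con_add.
- exact: Csmooth_euler hu.1.
- by apply: Csmooth_scal => //; exact: scu.
- by case: (hu.2 (j - (tix == tix :> 'I_(d + 1)))%N) => _; apply.
- rewrite -(add0r k); apply: con_mul.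
  + exact: Csmooth_cst.
  + exact: scu.
  + by case: (Oc_cst (d := d) Rad lam (j - (tix == tix :> 'I_(d + 1)))%N) => _; apply.
  + exact: IH.
Qed.

End Limit.

(** A function known to decay faster than [t^lam] has no kernel part. This is how the root [mlow]
    drops out. *)
Lemma Oc_euler_gt0 u k l : lam < k -> lam < l -> Oc Rad l u -> Oc Rad k (euler u) -> Oc Rad k u.
Proof.
move=> lk ll hu he; have [c sc hc] := Oc_euler_gt lk (Oc_smooth hu) he.
suff c0 x : Bball Rad x -> c x = 0.
  apply: Oc_congr hc => y [xR _]; rewrite c0//; ring.
move=> xR; have [r rR xr] := Bball_exists Rad0 xR.
have r0 : 0 < r by case/andP: rR.
have [K K0 HK] := bound_ge0 (Oc_bound hu) rR.
have [K' K'0 HK'] := bound_ge0 (Oc_bound hc) rR.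
(* Both [u] and [u - c t^lam] are [O(t^(lam + e))], hence so is [c t^lam]. *)
pose e := Num.min (l - lam) (k - lam).
have e0 : 0 < e by rewrite lt_min !subr_gt0 lk ll.
apply/eqP; rewrite -normr_le0.
apply: (le0_of_powR (C := K * r `^ (l - lam - e) + K' * r `^ (k - lam - e)) e0 r0) => t tr.
have t0 : 0 < t by case/andP: tr.
have tl : 0 < t `^ lam by rewrite powR_gt0.
have Gx : Gcyl r (pt x t) by apply/Gcyl_pt.
have := HK _ Gx; have := HK' _ Gx; rewrite lsub_pt tco_pt => h1 h2.
rewrite -(ler_pM2r tl) -[X in `|c x| * X](ger0_norm (ltW tl)) -normrM.
have -> : c x * t `^ lam = u (pt x t) - (u (pt x t) - c x * t `^ lam) by ring.
apply: le_trans (ler_normB _ _) _.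
rewrite [leRHS]mulrAC; apply: le_trans (lerD h2 h1) _.
rewrite -mulrA -powR_add// mulrDl; rewrite lerD//.
  rewrite -mulrA ler_wpM2l// (_ : l - lam - e = l - (e + lam)); last by ring.
  by rewrite (addrC lam e); apply: powR_le_pos => //; rewrite -lerBrDr ge_min lexx.
rewrite -mulrA ler_wpM2l// (_ : k - lam - e = k - (e + lam)); last by ring.
by rewrite (addrC lam e); apply: powR_le_pos => //; rewrite -lerBrDr ge_min lexx orbT.
Qed.

End EulerOperator.

(** * Expansions in powers and logarithms *)

Section Expansions.
Context {R : realType} {d : nat}.
Variable (Rad : R).
Hypothesis Rad0 : 0 < Rad.
Implicit Types (y : 'rV[R]_(d + 1)) (f g p : 'rV[R]_(d + 1) -> R) (r k l a : R)
  (P Q S : nat -> nat -> Prop) (i j : nat) (c : 'rV[R]_d -> R).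

Notation G := (@Gcyl R d Rad).
Notation B := (@Bball R d Rad).
Let oG : open G := @open_Gcyl R d Rad.
Let oB : open B := @open_Bball R d Rad.

Definition mon i j y : R := tco y ^+ i * ln (tco y) ^+ j.

(** An inductive family avoids index bookkeeping: closure properties are proved term by term. The
    set [P] of exponents is a parameter because each operation moves it. *)
Inductive span P : ('rV[R]_(d + 1) -> R) -> Prop :=
| span0 : span P (fun=> 0)
| spanD i j c f : P i j -> Csmooth B c -> span P f ->
    span P (fun y => c (lsubmx y) * mon i j y + f y).

Lemma span_ext P f g : (forall y, f y = g y) -> span P f -> span P g.
Proof. by move=> /funext ->. Qed.

Lemma span_sub P Q f : (forall i j, P i j -> Q i j) -> span P f -> span Q f.
Proof. by move=> PQ; elim=> [|i j c g Pij sc _]; [exact: span0|apply: spanD => //; exact: PQ]. Qed.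

Lemma span_mon P i j c : P i j -> Csmooth B c -> span P (fun y => c (lsubmx y) * mon i j y).
Proof.
move=> Pij sc; apply: (span_ext (f := fun y => c (lsubmx y) * mon i j y + 0)).
  by move=> y; rewrite addr0.
by apply: spanD => //; exact: span0.
Qed.

Lemma span_add P f g : span P f -> span P g -> span P (fun y => f y + g y).
Proof.
move=> hf hg; elim: hf => [|i j c f' Pij sc _ IH].
  by apply: span_ext hg => y; rewrite add0r.
by apply: span_ext (spanD Pij sc IH) => y; rewrite addrA.
Qed.

Lemma span_mulc P c f : Csmooth B c -> span P f -> span P (fun y => c (lsubmx y) * f y).
Proof.
move=> sc; elim=> [|i j c' f' Pij sc' _ IH].
  by apply: span_ext (span0 P) => y; rewrite mulr0.
apply: span_ext (spanD Pij (Csmooth_mul oB sc sc') IH) => y.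
by rewrite mulrDr mulrA.
Qed.

Lemma span_scal P a f : span P f -> span P (fun y => a * f y).
Proof. exact: (span_mulc (Csmooth_cst a oB)). Qed.

Lemma span_opp P f : span P f -> span P (fun y => - f y).
Proof. by move=> /(span_scal (-1)); apply: span_ext => y; rewrite mulN1r. Qed.

Lemma monM i j i' j' y : mon i j y * mon i' j' y = mon (i + i') (j + j') y.
Proof. by rewrite /mon !exprD; ring. Qed.

Lemma span_mul P Q S f g : (forall i j i' j', P i j -> Q i' j' -> S (i + i')%N (j + j')%N) ->
  span P f -> span Q g -> span S (fun y => f y * g y).
Proof.
move=> PQS hf hg; elim: hf => [|i j c f' Pij sc _ IH].
  by apply: span_ext (span0 S) => y; rewrite mul0r.
apply: (span_ext (f := fun y => (c (lsubmx y) * mon i j y) * g y + f' y * g y)).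
  by move=> y; rewrite mulrDl.
apply: span_add => //; elim: hg => [|i' j' c' g' Qij sc' _ IH'].
  by apply: span_ext (span0 S) => y; rewrite mulr0.
apply: span_ext (spanD (PQS _ _ _ _ Pij Qij) (Csmooth_mul oB sc sc') IH') => y.
by rewrite -monM; ring.
Qed.

Lemma span_div P Q f : (forall i j, P i j -> exists2 i', i = i'.+1 & Q i' j) -> span P f ->
  exists2 g, span Q g & forall y, G y -> f y / tco y = g y.
Proof.
move=> PQ; elim=> [|i j c f' Pij sc _ [g' sg' Hg']].
  by exists (fun=> 0) => [|y _]; [exact: span0|rewrite mul0r].
have [i' ii' Qij] := PQ _ _ Pij.
exists (fun y => c (lsubmx y) * mon i' j y + g' y); first exact: spanD.
move=> y Gy; rewrite mulrDl Hg'// ii' /mon exprS; congr (_ + _).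
by field; rewrite gt_eqF// (Gcyl_tco_gt0 Gy).
Qed.

Lemma Oc_mon a i j : (j = 0%N /\ a <= i%:R) \/ a < i%:R -> Oc Rad a (mon i j).
Proof.
case=> [[-> ai]|ai].
  apply: Oc_le ai _; apply: Oc_congr (Oc_tpow Rad i) => y _.
  by rewrite /mon expr0 mulr1.
have e0 : 0 < i%:R - a by rewrite subr_gt0.
have := Oc_mul (Oc_tpow (d := d) Rad i) (Oc_lnX (d := d) Rad j e0).
by rewrite opprB addrC subrK.
Qed.

Lemma span_Oc P a f : (forall i j, P i j -> (j = 0%N /\ a <= i%:R) \/ a < i%:R) ->
  span P f -> Oc Rad a f.
Proof.
move=> Pa; elim=> [|i j c f' Pij sc _ IH]; first exact: Oc_zero.
apply: Oc_add IH; rewrite -(add0r a); apply: Oc_mul; first exact: Oc_lsub.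
by apply: Oc_mon; exact: Pa.
Qed.

Lemma span_smooth P f : span P f -> Csmooth G f.
Proof.
move=> hf; apply: (@Oc_smooth _ _ _ (-1)); apply: span_Oc hf => i j _; right.
by rewrite (lt_le_trans (ltrN10 _))// ler0n.
Qed.

Lemma Csmooth_mon i j : Csmooth G (mon i j).
Proof.
apply: (@Oc_smooth _ _ _ (-1)); apply: Oc_mon; right.
by rewrite (lt_le_trans (ltrN10 _))// ler0n.
Qed.

Lemma Csmooth_clsub c : Csmooth B c -> Csmooth G (fun y => c (lsubmx y)).
Proof. by move=> sc; exact: Oc_smooth (Oc_lsub sc). Qed.

Lemma Z_clsub c y : Z tix (fun y => c (lsubmx y)) y = 0.
Proof. by rewrite /Z (pd_eq (is_derive_lsub_t c y)) mulr0. Qed.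

Lemma Z_mon i j y : G y -> Z tix (mon i j) y = i%:R * mon i j y + j%:R * mon i j.-1 y.
Proof.
move=> Gy; have t0 := Gcyl_tco_gt0 Gy.
have dX (u : R -> R) (t du : R) n : is_derive t 1 u du ->
    is_derive t 1 (fun s => u s ^+ n) (n%:R * u t ^+ n.-1 * du).
  move=> h; have := is_deriveX n h; rewrite (_ : u ^+ n = fun s => u s ^+ n) //.
  by apply/funext => s; rewrite exprfctE.
have h1 := dX _ _ _ i (is_derive_id (tco y) 1); have h2 := dX _ _ _ j (is_derive1_ln t0).
rewrite (Z_t_of_t (isD_mul h1 h2)) /mon.
have -> : tco y * (i%:R * tco y ^+ i.-1 * 1 * ln (tco y) ^+ j +
     tco y ^+ i * (j%:R * ln (tco y) ^+ j.-1 * (tco y)^-1)) =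
  i%:R * (tco y * tco y ^+ i.-1) * ln (tco y) ^+ j +
     j%:R * (tco y ^+ i * ln (tco y) ^+ j.-1) by field; rewrite gt_eqF.
by case: i h1 => [|i] _ /=; rewrite ?mulr0n ?mul0r// -exprS !mulrA.
Qed.

Lemma Z_cmon c i j y : Csmooth B c -> G y -> Z tix (fun y => c (lsubmx y) * mon i j y) y =
  c (lsubmx y) * (i%:R * mon i j y + j%:R * mon i j.-1 y).
Proof.
move=> sc Gy; rewrite (Z_mul tix (Csmooth_clsub sc) (Csmooth_mon i j) Gy).
by rewrite Z_clsub mul0r add0r Z_mon.
Qed.

Lemma span_Zy P f (i : 'I_d) : span P f ->
  exists2 g, span P g & forall y, G y -> Z (yix i) f y = g y.
Proof.
elim=> [|i' j c f' Pij sc sf' [g' sg' Hg']].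
  exists (fun=> 0); first exact: span0.
  by move=> y _; rewrite /Z (pd_eq (isD_cst _ _ _)) mulr0.
exists (fun y => pd i c (lsubmx y) * mon i' j y + g' y).
  by apply: spanD => //; exact: Csmooth_pd.
move=> y Gy; have s1 := Csmooth_clsub sc; have s2 := Csmooth_mon i' j.
rewrite (Z_add _ (Csmooth_mul oG s1 s2) (span_smooth sf') Gy) Hg'//; congr (_ + _).
rewrite (Z_mul _ s1 s2 Gy) !Z_yE (pd_y_of_t (fun t => t ^+ i' * ln t ^+ j)) mulr0 addr0.
congr (_ * _); apply: pd_eq; apply: is_derive_lsub_y.
by apply: (Csmooth_derive i oB sc); case: Gy.
Qed.

Lemma span_Zt P Q f :
  (forall i j, P i j -> ((0 < i)%N -> Q i j) /\ ((0 < j)%N -> Q i j.-1)) -> span P f ->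
  exists2 g, span Q g & forall y, G y -> Z tix f y = g y.
Proof.
move=> PQ; elim=> [|i j c f' Pij sc sf' [g' sg' Hg']].
  exists (fun=> 0); first exact: span0.
  by move=> y _; rewrite /Z (pd_eq (isD_cst _ _ _)) mulr0.
have [Q1 Q2] := PQ _ _ Pij.
have H (a b n : nat) : ((0 < n)%N -> Q a b) -> span Q (fun y => n%:R * (c (lsubmx y) * mon a b y)).
  case: n => [|n] Hn; first by apply: span_ext (span0 Q) => y; rewrite mul0r.
  by apply: span_scal; apply: span_mon => //; exact: Hn.
exists (fun y => (i%:R * (c (lsubmx y) * mon i j y) + j%:R * (c (lsubmx y) * mon i j.-1 y)) + g' y).
  by apply: span_add => //; apply: span_add; apply: H.
move=> y Gy; have s1 := Csmooth_clsub sc; have s2 := Csmooth_mon i j.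
rewrite (Z_add _ (Csmooth_mul oG s1 s2) (span_smooth sf') Gy) Hg'// Z_cmon//; ring.
Qed.

Lemma euler_add lam f g y : Csmooth G f -> Csmooth G g -> G y ->
  euler lam (fun y => f y + g y) y = euler lam f y + euler lam g y.
Proof. by move=> sf sg Gy; rewrite /euler (Z_add _ sf sg Gy); ring. Qed.

Lemma euler_scal lam b f y : Csmooth G f -> G y ->
  euler lam (fun y => b * f y) y = b * euler lam f y.
Proof.
move=> sf Gy; rewrite /euler (Z_mul _ (Csmooth_cst b oG) sf Gy).
by rewrite [Z tix (fun=> b) y]/Z (pd_eq (isD_cst _ _ _)); ring.
Qed.

Lemma euler_sub lam f g y : Csmooth G f -> Csmooth G g -> G y ->
  euler lam (fun y => f y - g y) y = euler lam f y - euler lam g y.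
Proof.
move=> sf sg Gy; have so : Csmooth G (fun y => -1 * g y) by exact: Csmooth_scal.
have := euler_add lam sf so Gy; rewrite euler_scal// mulN1r => <-.
rewrite /euler; congr (_ - _ * _); last by rewrite mulN1r.
by apply: (@Z_congr _ _ Rad) => // z _; rewrite mulN1r.
Qed.

(* Since [euler lam (t^i ln^j) = (i - lam) t^i ln^j + j t^i ln^(j-1)], solving
   creates lower powers of [ln t], or one more if [i = lam] (resonance). *)
Lemma span_euler_inv lam P Q f :
  (forall i j, P i j -> (i%:R != lam /\ forall j', (j' <= j)%N -> Q i j') \/
                        (i%:R = lam /\ Q i j.+1)) -> span P f ->
  exists2 g, span Q g & forall y, G y -> euler lam g y = f y.
Proof.
move=> PQ; elim=> [|i j c f' Pij sc sf' [g' sg' Hg']].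
  exists (fun=> 0); first exact: span0.
  by move=> y _; rewrite /euler /Z (pd_eq (isD_cst _ _ _)) !mulr0 subr0.
suff [g sg Hg] : exists2 g, span Q g & forall y, G y -> euler lam g y = c (lsubmx y) * mon i j y.
  exists (fun y => g y + g' y); first exact: span_add.
  by move=> y Gy; rewrite (euler_add _ (span_smooth sg) (span_smooth sg') Gy) Hg// Hg'.
have sm (a b : nat) : Csmooth G (fun y => c (lsubmx y) * mon a b y).
  by apply: Csmooth_mul => //; [exact: Csmooth_clsub|exact: Csmooth_mon].
have [[il Qj]|[il Qj]] := PQ _ _ Pij; last first.
  exists (fun y => j.+1%:R^-1 * (c (lsubmx y) * mon i j.+1 y)).
    by apply: span_scal; exact: span_mon.
  move=> y Gy; rewrite euler_scal// /euler Z_cmon// -il /=.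
  have := pnatr_eq0 R j.+1; move: (j.+1%:R) => n /= /negbT n0.
  by field.
have il0 : i%:R - lam != 0 by rewrite subr_eq0.
elim: j Qj {Pij} => [|j IH] Qj.
  exists (fun y => (i%:R - lam)^-1 * (c (lsubmx y) * mon i 0 y)).
    by apply: span_scal; apply: span_mon => //; exact: Qj.
  move=> y Gy; rewrite euler_scal// /euler Z_cmon// /=.
  by field.
have [g sg Hg] := IH (fun j' h => Qj j' (leqW h)).
exists (fun y => (i%:R - lam)^-1 * (c (lsubmx y) * mon i j.+1 y - j.+1%:R * g y)).
  apply: span_scal; apply: span_add; first by apply: span_mon => //; exact: Qj.
  by apply: span_opp; exact: span_scal.
move=> y Gy; have sg1 := Csmooth_scal j.+1%:R oG (span_smooth sg).
rewrite euler_scal//; last exact: Csmooth_sub'.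
rewrite euler_sub// [euler _ (fun y => _ * g y) y]euler_scal//; last exact: span_smooth sg.
rewrite Hg// /euler Z_cmon//=.
by field.
Qed.

(** The part [p] may also contain terms of order above [k], so products and integrations need no
    truncation. *)
Definition Ex k P f := exists2 p, span P p & Oc Rad k (fun y => f y - p y).

Lemma Ex_congr k P f g : (forall y, G y -> f y = g y) -> Ex k P f -> Ex k P g.
Proof.
by move=> fg [p sp hp]; exists p => //; apply: Oc_congr hp => y Gy; rewrite fg.
Qed.

Lemma Ex_sub k l P Q f : l <= k -> (forall i j, P i j -> Q i j) -> Ex k P f -> Ex l Q f.
Proof. by move=> lk PQ [p sp hp]; exists p; [exact: span_sub sp|exact: Oc_le hp]. Qed.

Lemma Ex_span k P f : span P f -> Ex k P f.
Proof.
move=> sf; exists f => //; apply: (Oc_congr (f := fun=> 0)); last exact: Oc_zero.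
by move=> y _; rewrite subrr.
Qed.

Lemma Ex_Oc k P f : Oc Rad k f -> Ex k P f.
Proof.
move=> hf; exists (fun=> 0); first exact: span0.
by apply: Oc_congr hf => y _; rewrite subr0.
Qed.

Lemma Ex_smooth k P f : Ex k P f -> Csmooth G f.
Proof.
move=> [p sp hp]; apply: (Csmooth_congr (f := fun y => p y + (f y - p y))).
  by move=> y _; rewrite addrC subrK.
by apply: Csmooth_add => //; [exact: span_smooth sp|exact: Oc_smooth hp].
Qed.

Lemma Ex_add k P f g : Ex k P f -> Ex k P g -> Ex k P (fun y => f y + g y).
Proof.
move=> [p sp hp] [q sq hq]; exists (fun y => p y + q y); first exact: span_add.
by apply: Oc_congr (Oc_add hp hq) => y _; rewrite addrACA opprD.
Qed.

Lemma Ex_scal k P a f : Ex k P f -> Ex k P (fun y => a * f y).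
Proof.
move=> [p sp hp]; exists (fun y => a * p y); first exact: span_scal.
by apply: Oc_congr (Oc_scal a hp) => y _; rewrite mulrBr.
Qed.

Lemma Ex_sum k P m (f : 'I_m -> 'rV[R]_(d + 1) -> R) : (forall b, Ex k P (f b)) ->
  Ex k P (fun y => \sum_b f b y).
Proof.
move=> H; have {}H (s : seq 'I_m) : Ex k P (fun y => \sum_(b <- s) f b y).
  elim: s => [|b s IH].
    by apply: (Ex_congr (f := fun=> 0)) => [y _|]; [rewrite big_nil|exact/Ex_span/span0].
  apply: (Ex_congr (f := fun y => f b y + \sum_(c <- s) f c y)); last exact: Ex_add.
  by move=> y _; rewrite big_cons.
exact: H.
Qed.

(** Write [f g - p q = (f - p) q + f (g - q)]; the decay of [q] and of [f] improves the two
    remainders. *)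
Lemma Ex_mul k k1 k2 a b P Q S f g :
  (forall i j i' j', P i j -> Q i' j' -> S (i + i')%N (j + j')%N) ->
  (forall i j, Q i j -> (j = 0%N /\ b <= i%:R) \/ b < i%:R) -> k <= k1 + b -> k <= a + k2 ->
  Oc Rad a f -> Ex k1 P f -> Ex k2 Q g -> Ex k S (fun y => f y * g y).
Proof.
move=> PQS Qb kb ka hf [p sp hp] [q sq hq].
exists (fun y => p y * q y); first exact: span_mul PQS sp sq.
have h1 := Oc_le kb (Oc_mul hp (span_Oc Qb sq)); have h2 := Oc_le ka (Oc_mul hf hq).
by apply: Oc_congr (Oc_add h1 h2) => y _; ring.
Qed.

Lemma Ex_div k P Q f : (forall i j, P i j -> exists2 i', i = i'.+1 & Q i' j) -> Ex k P f ->
  Ex (k - 1) Q (fun y => f y / tco y).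
Proof.
move=> PQ [p sp hp]; have [q sq Hq] := span_div PQ sp; exists q => //.
by apply: Oc_congr (Oc_div hp) => y Gy; rewrite -Hq// mulrBl.
Qed.

Lemma Ex_Zy k P f (i : 'I_d) : Ex k P f -> Ex k P (Z (yix i) f).
Proof.
move=> hf; have sf := Ex_smooth hf; case: hf => p sp hp.
have [q sq Hq] := span_Zy i sp; exists q => //.
apply: Oc_congr (Oc_Z (yix i) hp) => y Gy; rewrite -Hq//.
rewrite /Z (pd_eq (isD_sub (Csmooth_derive _ oG sf Gy) (Csmooth_derive _ oG (span_smooth sp) Gy))).
exact: mulrBr.
Qed.

Lemma Ex_Zt k P Q f :
  (forall i j, P i j -> ((0 < i)%N -> Q i j) /\ ((0 < j)%N -> Q i j.-1)) ->
  Ex k P f -> Ex k Q (Z tix f).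
Proof.
move=> PQ hf; have sf := Ex_smooth hf; case: hf => p sp hp.
have [q sq Hq] := span_Zt PQ sp; exists q => //.
apply: Oc_congr (Oc_Z tix hp) => y Gy; rewrite -Hq//.
rewrite /Z (pd_eq (isD_sub (Csmooth_derive _ oG sf Gy) (Csmooth_derive _ oG (span_smooth sp) Gy))).
exact: mulrBr.
Qed.

Variables (M : nat) (lg : bool).
Hypothesis M2 : (2 <= M)%N.

(* The exponents of [t^a (t^M ln t)^j], without logarithms if [lg = false]. *)
Definition P0 i j := (M * j <= i)%N /\ (lg || (j == 0%N)).
(** The exponents on which [t d/dt] itself is invertible without resonance. *)
Definition P0p i j := P0 i j /\ (0 < i)%N.

Lemma P0_add i j i' j' : P0 i j -> P0 i' j' -> P0 (i + i')%N (j + j')%N.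
Proof.
move=> [h1 h2] [h3 h4]; split; first by rewrite mulnDr leq_add.
by case: lg h2 h4 => //= /eqP -> /eqP ->.
Qed.

Lemma P0_le i j j' : (j' <= j)%N -> P0 i j -> P0 i j'.
Proof.
move=> jj [h1 h2]; split; first by apply: leq_trans h1; rewrite leq_mul2l jj orbT.
by case: lg h2 => //= /eqP j0; move: jj; rewrite j0 leqn0.
Qed.

Lemma P0p_O i j : P0p i j -> (j = 0%N /\ 1 <= i%:R :> R) \/ 1 < i%:R :> R.
Proof.
move=> [[h1 _] h2]; case: j h1 => [|j] h1; first by left; rewrite ler1n.
by right; rewrite ltr1n; nia.
Qed.

Lemma Oc_comp N (O' : set 'rV[R]_N) (F : 'rV[R]_N -> R) (X : 'rV[R]_(d + 1) -> 'rV[R]_N) :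
  open O' -> (forall y, G y -> O' (X y)) -> Csmooth O' F ->
  (forall s, bound Rad 0 (fun y => pds s F (X y))) ->
  (forall b, Oc Rad 0 (fun y => X y 0 b)) -> Oc Rad 0 (fun y => F (X y)).
Proof. by move=> oO XO sF bF hX j; apply: cn_comp sF bF _ => // b; exact: hX. Qed.

Lemma Zt_comp N (O' : set 'rV[R]_N) (F : 'rV[R]_N -> R) (X : 'rV[R]_(d + 1) -> 'rV[R]_N) y :
  open O' -> (forall y, G y -> O' (X y)) -> Csmooth O' F ->
  (forall b, Csmooth G (fun y => X y 0 b)) -> G y ->
  Z tix (fun y => F (X y)) y = \sum_b pd b F (X y) * Z tix (fun y => X y 0 b) y.
Proof.
move=> oO XO sF sX Gy; rewrite {1}/Z (pd_comp tix oG oO XO sF sX Gy) mulr_sumr.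
by apply: eq_bigr => b _; rewrite /Z; ring.
Qed.

Lemma Oc_euler0 k f : Oc Rad k (Z tix f) -> Oc Rad k (euler 0 f).
Proof. by apply: Oc_congr => y _; rewrite /euler mul0r subr0. Qed.

(** No Taylor expansion of [F] is used: [t d/dt] of the composition is a sum of products of
    [pd b F (X y)], expanded to the previous order, with [Z tix X_b = O(t)], which gains one power.
    Integrating back adds a smooth function of [y']. *)
Lemma Ex_comp N (O' : set 'rV[R]_N) (F : 'rV[R]_N -> R) (X : 'rV[R]_(d + 1) -> 'rV[R]_N) n :
  open O' -> (forall y, G y -> O' (X y)) -> Csmooth O' F ->
  (forall s, bound Rad 0 (fun y => pds s F (X y))) ->
  (forall b, Oc Rad 0 (fun y => X y 0 b)) ->
  (forall b, Oc Rad 1 (Z tix (fun y => X y 0 b))) ->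
  (forall b, Ex (n%:R + 2^-1) P0 (fun y => X y 0 b)) ->
  Ex (n%:R + 2^-1) P0 (fun y => F (X y)).
Proof.
move=> oO XO sF bF hX hZ.
have sX b : Csmooth G (fun y => X y 0 b) by exact: Oc_smooth (hX b).
have hF s : Oc Rad 0 (fun y => pds s F (X y)).
  apply: Oc_comp (Csmooth_pds s oO sF) _ hX => // s'.
  have -> : pds s' (pds s F) = pds (s' ++ s) F by rewrite /pds foldr_cat.
  exact: bF.
suff H s : (forall b, Ex (n%:R + 2^-1) P0 (fun y => X y 0 b)) ->
    Ex (n%:R + 2^-1) P0 (fun y => pds s F (X y)) by exact: (H [::]).
have c00 c : Csmooth B c -> span P0 (fun y => c (lsubmx y) * tco y `^ 0).
  move=> sc; apply: span_ext (@span_mon P0 0 0 c _ sc); last by rewrite /P0 muln0 orbT.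
  by move=> y; rewrite /mon !expr0 powRr0 mulr1.
have sFs t := Csmooth_pds t oO sF.
elim: n s => [|n IH] s eX.
  have h1 : Oc Rad 1 (euler 0 (fun y => pds s F (X y))).
    apply: Oc_euler0; apply: (Oc_congr (f := fun y => \sum_b pds (b :: s) F (X y) * Z tix (fun y => X y 0 b) y)).
      by move=> y Gy; rewrite (Zt_comp oO XO (sFs s) sX Gy).
    by apply: Oc_sum => b _; rewrite -(add0r 1); exact: Oc_mul.
  have [c sc hc] := Oc_euler_gt Rad0 ltr01 (Oc_smooth (hF s)) h1.
  exists (fun y => c (lsubmx y) * tco y `^ 0); first exact: c00.
  by apply: Oc_le hc; rewrite add0r invf_le1// ler1n.
have n0 : (0 : R) < n.+1%:R + 2^-1 by rewrite addr_gt0.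
have [q sq hq] : Ex (n.+1%:R + 2^-1) P0p (Z tix (fun y => pds s F (X y))).
  apply: (Ex_congr (f := fun y => \sum_b pds (b :: s) F (X y) * Z tix (fun y => X y 0 b) y)).
    by move=> y Gy; rewrite (Zt_comp oO XO (sFs s) sX Gy).
  apply: Ex_sum => b.
  apply: (@Ex_mul _ (n%:R + 2^-1) (n.+1%:R + 2^-1) 0 1 P0 P0p).
  - by move=> i j i' j' h1 [h2 h3]; split; [exact: P0_add|rewrite addn_gt0 h3 orbT].
  - exact: P0p_O.
  - by rewrite -natr1; lra.
  - by rewrite add0r.
  - exact: hF.
  - apply: IH => b'; apply: Ex_sub (eX b') => //; by rewrite -natr1; lra.
  - apply: Ex_Zt (eX b) => i j h; split=> // j0; split.
      by apply: P0_le h; exact: leq_pred.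
    by case: h => h _; nia.
(* All exponents are positive here, so inverting [t d/dt] creates no logarithm. *)
have [g sg Hg] : exists2 g, span P0p g & forall y, G y -> euler 0 g y = q y.
  apply: span_euler_inv sq => i j [h1 h2]; left; split.
    by rewrite pnatr_eq0 -lt0n.
  by move=> j' jj; split=> //; exact: P0_le h1.
have sFX := Oc_smooth (hF s).
have hu : Oc Rad (n.+1%:R + 2^-1) (euler 0 (fun y => pds s F (X y) - g y)).
  apply: Oc_congr hq => y Gy; rewrite (euler_sub _ sFX (span_smooth sg) Gy) Hg//.
  by rewrite /euler mul0r subr0.
have [c sc hc] := Oc_euler_gt Rad0 n0 (Csmooth_sub' oG sFX (span_smooth sg)) hu.
exists (fun y => g y + c (lsubmx y) * tco y `^ 0).
  by apply: span_add; [apply: span_sub sg => i j []|exact: c00].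
by apply: Oc_congr hc => y _; rewrite opprD addrA.
Qed.

End Expansions.

(** * Conormality of the solution *)

Section Arguments.
Context {R : realType} {d : nat}.
Variable (Rad : R).
Hypothesis Rad0 : 0 < Rad.
Implicit Types (y : 'rV[R]_(d + 1)) (f g v : 'rV[R]_(d + 1) -> R) (r k l a : R).

Notation G := (@Gcyl R d Rad).
Let oG : open G := @open_Gcyl R d Rad.

(** Bounded arguments in a closed subset of [D] fill a compact set, on which the continuous [g] is
    bounded. *)
Lemma bound_comp N (D : set 'rV[R]_N) (g : 'rV[R]_N -> R) (X : 'rV[R]_(d + 1) -> 'rV[R]_N) :
  {within D, continuous g} -> (forall b, bound Rad 0 (fun y => X y 0 b)) ->
  (forall r, 0 < r < Rad -> exists A : set 'rV[R]_N,
     [/\ closed A, A `<=` D & forall y, Gcyl r y -> A (X y)]) ->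
  bound Rad 0 (fun y => g (X y)).
Proof.
move=> cg bX HA r rR; have [A [cA AD XA]] := HA r rR.
have [C HC] : exists C, forall y, Gcyl r y -> `|X y| <= C.
  have /choice[C HC] : forall b : 'I_N, exists C, 0 <= C /\ forall y, Gcyl r y -> `|X y 0 b| <= C.
    move=> b; have [C C0 HC] := bound_ge0 (bX b) rR; exists C; split=> // y /HC.
    by rewrite powRr0 mulr1.
  exists (\sum_b C b) => y yr.
  apply: (norm_rowP _ _).2 => [|b]; first by apply: sumr_ge0 => b _; case: (HC b).
  apply: le_trans ((HC b).2 _ yr) _; rewrite (bigD1 b)//= lerDl.
  by apply: sumr_ge0 => b' _; case: (HC b').
pose K := A `&` [set z : 'rV[R]_N | `|z| <= C].
have cK : compact K.
  apply: bounded_closed_compact.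
    exists C; split; first exact: num_real.
    by move=> c Cc z [_ /= zC]; apply: le_trans zC (ltW Cc).
  apply: closedI => //.
  rewrite (_ : [set _ | _] = (@Num.norm R _) @^-1` [set x | x <= C])//.
  by apply: preimage_closed; [move=> x _; exact: norm_continuous|exact: closed_le].
have [K0|/set0P/negP/negPn/eqP K0] := pselect (K !=set0); last first.
  exists 0 => y yr; have : K (X y) by split; [exact: XA|exact: HC].
  by rewrite K0.
have ck : {within K, continuous (fun z => `|g z|)}.
  have cgK : {within K, continuous g} by apply: continuous_subspaceW cg => z [/AD].
  move=> z; apply: (@continuous_comp _ _ _ (g : subspace K -> R) Num.norm); first exact: cgK.
  exact: norm_continuous.
have [z _ Hz] := EVT_max_rV K0 cK ck.
exists `|g z| => y yr; rewrite powRr0 mulr1; apply: Hz.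
by rewrite inE; split; [exact: XA|exact: HC].
Qed.

(** The iterated [pds] are meaningful in the interior only; bounds down to [t = 0] come from their
    continuous extensions. The induction peels the last index because [Cspace] differentiates
    innermost first. *)
Lemma pds_extension (k : nat) (D : set 'rV[R]_k) (s : seq 'I_k) (f : 'rV[R]_k -> R) :
  Cspace (size s) D f -> exists2 g, {within D, continuous g} & forall x, D° x -> g x = pds s f x.
Proof.
elim/last_ind: s f => [|s i IH] f; first by case=> cf _; exists f.
rewrite size_rcons => -[cf H]; have [h [[h1 h2] h3]] := H i.
have [g cg Hg] := IH h h3; exists g => // x Dx; rewrite Hg//.
have -> : pds (rcons s i) f = pds s (pd i f) by rewrite /pds foldr_rcons.
elim: {IH Hg h3 H} s x Dx => [|j s IH] x Dx /=.
  by case: (h1 x Dx).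
exact: (pd_congr j (open_interior D) IH Dx).
Qed.

Lemma mxcomp_row (k1 k2 : nat) (A : ('rV[R]_(d + 1) -> R) -> Prop)
    (X1 : 'rV[R]_(d + 1) -> 'rV[R]_k1) (X2 : 'rV[R]_(d + 1) -> 'rV[R]_k2) :
  (forall b, A (fun y => X1 y 0 b)) -> (forall b, A (fun y => X2 y 0 b)) ->
  forall b, A (fun y => row_mx (X1 y) (X2 y) 0 b).
Proof.
move=> H1 H2 b; case: (split_ordP b) => j ->.
  by rewrite (_ : (fun y => _) = fun y => X1 y 0 j)//; apply/funext => y; rewrite row_mxEl.
by rewrite (_ : (fun y => _) = fun y => X2 y 0 j)//; apply/funext => y; rewrite row_mxEr.
Qed.

Lemma mxcomp_scalar (A : ('rV[R]_(d + 1) -> R) -> Prop) (f : 'rV[R]_(d + 1) -> R) :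
  A f -> forall b : 'I_1, A (fun y => (f y)%:M 0 b).
Proof.
move=> Af b; rewrite (_ : (fun y => _) = f)//; apply/funext => y.
by rewrite !mxE (ord1 b).
Qed.

(** The property [A] is abstract because the same list of arguments is inspected once for
    conormality and once for expansions. *)
Lemma xi_args_ind (A : ('rV[R]_(d + 1) -> R) -> Prop) v :
  A (fun y => v y / tco y) -> A (pd tix v) ->
  (forall i, A (fun y => pd (yix i) v y / tco y)) ->
  (forall i, A (pd (yix i) (pd tix v))) ->
  (forall i j, A (pd (yix i) (pd (yix j) v))) -> forall b, A (fun y => xi_args v y 0 b).
Proof.
move=> A1 A2 A3 A4 A5; do ![apply: mxcomp_row].
- exact: (mxcomp_scalar A1).
- exact: (mxcomp_scalar A2).
- by move=> b; rewrite (_ : (fun y => _) = fun y => pd (yix b) v y / tco y)//; apply/funext => y; rewrite mxE.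
- by move=> b; rewrite (_ : (fun y => _) = pd (yix b) (pd tix v))//; apply/funext => y; rewrite mxE.
- move=> b; case/mxvec_indexP: b => i j.
  by rewrite (_ : (fun y => _) = pd (yix i) (pd (yix j) v))//; apply/funext => y; rewrite mxvecE mxE.
Qed.

Lemma quad_args_ind (A : ('rV[R]_(d + 1) -> R) -> Prop) v :
  A (fun y => v y ^+ 2 / tco y ^+ 3) -> A (fun y => v y * pd tix v y / tco y ^+ 2) ->
  A (fun y => pd tix v y ^+ 2 / tco y) -> forall b, A (fun y => quad_args v y 0 b).
Proof.
move=> A1 A2 A3; do ![apply: mxcomp_row].
- exact: (mxcomp_scalar A1).
- exact: (mxcomp_scalar A2).
- exact: (mxcomp_scalar A3).
Qed.

Lemma base_args_ind (A : ('rV[R]_(d + 1) -> R) -> Prop) :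
  A (@tco R d) -> (forall c, Csmooth (@Bball R d Rad) c -> A (fun y => c (lsubmx y))) ->
  forall b, A (fun y => y 0 b).
Proof.
move=> A1 A2 b; case: (tix_or_yix b) => [->//|[j ->]].
rewrite (_ : (fun y => _) = fun y : 'rV[R]_(d + 1) => lsubmx y 0 j); last first.
  by apply/funext => y; rewrite mxE.
by apply: (A2 (fun x => x 0 j)); apply: Csmooth_coord; exact: open_Bball.
Qed.

Lemma cn_lsub j (c : 'rV[R]_d -> R) : Csmooth (Bball Rad) c -> cn Rad j 0 (fun y => c (lsubmx y)).
Proof. by move=> sc; exact: Oc_lsub. Qed.

Lemma cn_div j k f : cn Rad j k f -> cn Rad j (k - 1) (fun y => f y / tco y).
Proof. by move=> hf; apply: cn_mul => //; exact: Oc_tinv. Qed.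

Lemma pd_tE f y : G y -> Z tix f y / tco y = pd tix f y.
Proof. by move=> Gy; rewrite Z_tE mulrC mulKf// gt_eqF// (Gcyl_tco_gt0 Gy). Qed.

Lemma pd_ytE f i y : Csmooth G f -> G y -> Z tix (Z (yix i) f) y / tco y = pd (yix i) (pd tix f) y.
Proof.
move=> sf Gy; rewrite pd_tE// (pdC _ _ oG sf Gy); apply: (pd_congr _ oG) => // z _.
exact: Z_yE.
Qed.

Lemma pd_yyE f i j y : Csmooth G f -> G y -> Z (yix i) (Z (yix j) f) y = pd (yix i) (pd (yix j) f) y.
Proof.
move=> sf Gy; rewrite Z_yE; apply: (pd_congr _ oG) => // z _; exact: Z_yE.
Qed.

Section FixV.
Variable v : 'rV[R]_(d + 1) -> R.

(** One normal letter is spent on [v_t] and [D_y' v_t], and one power of [t] on the divisions. *)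
Lemma xi_args_cn j : cn Rad j.+1 2 v -> forall b, cn Rad j 1 (fun y => xi_args v y 0 b).
Proof.
move=> hv; have sv : Csmooth G v by case: hv.
have hv' : cn Rad j 2 v by apply: cn_weak hv.
have e1 : (1 : R) = 2 - 1 by ring.
apply: xi_args_ind.
- by rewrite e1; exact: cn_div.
- by rewrite e1; apply: cn_congr (cn_div (cn_Zt hv)) => y Gy; exact: pd_tE.
- move=> i; rewrite e1; apply: cn_congr (cn_div (cn_Zy i hv')) => y Gy.
  by rewrite Z_yE.
- move=> i; rewrite e1; apply: cn_congr (cn_div (cn_Zt (cn_Zy i hv))) => y Gy.
  exact: pd_ytE.
- move=> i i'; apply: (@cn_weak _ _ _ j 2) => //; first by rewrite ler1n.
  by apply: cn_congr (cn_Zy i (cn_Zy i' hv')) => y Gy; exact: pd_yyE.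
Qed.

Lemma quad_args_cn j : cn Rad j.+1 2 v -> forall b, cn Rad j 1 (fun y => quad_args v y 0 b).
Proof.
move=> hv; have hv' : cn Rad j 2 v by apply: cn_weak hv.
have hZ := cn_Zt hv.
have e1 : (1 : R) = 2 + 2 - 1 - 1 - 1 by ring.
apply: quad_args_ind; rewrite e1.
- apply: cn_congr (cn_div (cn_div (cn_div (cn_mul hv' hv')))) => y Gy.
  by field; rewrite gt_eqF// (Gcyl_tco_gt0 Gy).
- apply: cn_congr (cn_div (cn_div (cn_div (cn_mul hv' hZ)))) => y Gy.
  by rewrite -(pd_tE v Gy); field; rewrite gt_eqF// (Gcyl_tco_gt0 Gy).
- apply: cn_congr (cn_div (cn_div (cn_div (cn_mul hZ hZ)))) => y Gy.
  by rewrite -(pd_tE v Gy); field; rewrite gt_eqF// (Gcyl_tco_gt0 Gy).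
Qed.

Lemma base_args_cn j b : cn Rad j 0 (fun y => y 0 b).
Proof.
move: b; apply: base_args_ind; last exact: cn_lsub.
by apply: (@Oc_le _ _ _ 1); [exact: ler01|exact: Oc_tco].
Qed.

End FixV.

Section Nonlinearity.
Variable F : 'rV[R]_(d + 1 + nargs d) -> R.
Hypothesis hF : Csmooth (Fdom Rad) F.

(** The chain rule is applied on this open set [t > 0], whereas bounds are read off on [Fdom], which
    contains [t = 0]. *)
Definition Fint : set 'rV[R]_(d + 1 + nargs d) := [set z | G (lsubmx z)].

Lemma continuous_lsub' (k1 k2 : nat) : continuous (@lsubmx R 1 k1 k2).
Proof.
move=> y B /nbhs_ballP [e /= e0 eB]; apply/nbhs_ballP; exists e => //= z [_ yz].
by apply: eB; split=> // i j; rewrite !mxE; exact: yz.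
Qed.

Lemma open_Fint : open Fint.
Proof. by apply: open_comp => // x _; exact: continuous_lsub'. Qed.

Lemma Fint_sub : Fint `<=` Fdom Rad.
Proof. by move=> z [z1 /andP[z2 z3]]; split=> //; rewrite ltW. Qed.

Lemma Csmooth_Fint : Csmooth Fint F.
Proof. exact: Csmooth_sub Fint_sub hF. Qed.

Lemma F_args_bound (X : 'rV[R]_(d + 1) -> 'rV[R]_(nargs d)) s :
  (forall b, bound Rad 0 (fun y => X y 0 b)) ->
  bound Rad 0 (fun y => pds s F (row_mx y (X y))).
Proof.
move=> bX; have [g cg Hg] := pds_extension (hF (size s)).
apply: (bound_congr (f := fun y => g (row_mx y (X y)))).
  move=> y Gy; apply: Hg; move: open_Fint; rewrite openE => /(_ (row_mx y (X y))).
  rewrite /Fint /= row_mxKl => /(_ Gy); exact: interiorS Fint_sub _.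
apply: (bound_comp cg).
  apply: mxcomp_row bX => b.
  by have [_ /(_ 0%N)] := base_args_cn 0 b => -[].
move=> r rR.
(* This closed set reaches [t = 0], where smoothness of [F] up to the boundary is used, but stays
   away from the lateral side and the top. *)
exists [set z | enorm (lsubmx (lsubmx z)) <= r /\ 0 <= tco (lsubmx z) <= r]; split.
- rewrite (_ : [set _ | _] =
    ((fun z : 'rV[R]_(d + 1 + nargs d) => enorm (lsubmx (lsubmx z))) @^-1` [set x | x <= r]) `&`
   (((fun z : 'rV[R]_(d + 1 + nargs d) => tco (lsubmx z)) @^-1` [set x | 0 <= x]) `&`
    ((fun z : 'rV[R]_(d + 1 + nargs d) => tco (lsubmx z)) @^-1` [set x | x <= r]))); last first.
    by apply/seteqP; split => [z [h1 /andP[]]|z [h1 [h2 h3]]]; split=> //; apply/andP.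
  have ct : continuous (fun z : 'rV[R]_(d + 1 + nargs d) => tco (lsubmx z)).
    by move=> z; apply: continuous_comp; [exact: continuous_lsub'|exact: continuous_tco].
  apply: closedI.
    apply: preimage_closed; last exact: closed_le.
    move=> z _; apply: continuous_comp; last exact: continuous_enorm.
    by apply: continuous_comp; exact: continuous_lsub'.
  by apply: closedI; apply: preimage_closed; try (by move=> z _; exact: ct); [exact: closed_ge|exact: closed_le].
- move=> z [/= h1 /andP[h2 h3]]; case/andP: rR => r0 rR; split.
    exact: le_lt_trans rR.
  by rewrite h2 (le_lt_trans h3).
- move=> y [h1 /andP[h2 h3]]; rewrite /= row_mxKl; split; first exact: ltW.
  by rewrite !ltW.
Qed.

Lemma cn_F_args j (X : 'rV[R]_(d + 1) -> 'rV[R]_(nargs d)) :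
  (forall b, cn Rad j 0 (fun y => X y 0 b)) -> cn Rad j 0 (fun y => F (row_mx y (X y))).
Proof.
move=> cX; apply: (cn_comp open_Fint _ Csmooth_Fint).
- by move=> y; rewrite /Fint /= row_mxKl.
- move=> s; apply: F_args_bound => b.
  by have [_ /(_ 0%N)] := cX b => -[].
- by apply: mxcomp_row cX => b; exact: base_args_cn.
Qed.

End Nonlinearity.

End Arguments.

(** * Bootstrap in the number of normal derivatives *)

Section Conormality.
Context {R : realType} {d : nat}.
Variables (Rad alpha : R).
Hypotheses (Rad0 : 0 < Rad) (alpha0 : 0 < alpha).
Implicit Types (y : 'rV[R]_(d + 1)) (f g v : 'rV[R]_(d + 1) -> R) (r k l a : R).

Notation G := (@Gcyl R d Rad).
Let oG : open G := @open_Gcyl R d Rad.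

Lemma coord_le_enorm (n : nat) (x : 'rV[R]_n) j : `|x 0 j| <= enorm x.
Proof.
rewrite -sqrtr_sqr /enorm ler_sqrt ?sumr_ge0// => [|i _]; last exact: sqr_ge0.
by rewrite (bigD1 j)//= lerDl sumr_ge0// => i _; exact: sqr_ge0.
Qed.

Lemma enorm_le_bound (n : nat) (x : 'rV[R]_n) (c : R) : 0 <= c ->
  (forall j, `|x 0 j| <= c) -> enorm x <= Num.sqrt (n%:R * c ^+ 2).
Proof.
move=> c0 H; rewrite ler_sqrt; last by rewrite mulr_ge0// sqr_ge0.
rewrite mulr_natl -[X in _ *+ X]card_ord -sumr_const; apply: ler_sum => i _.
by rewrite -real_normK ?num_real// lerXn2r// nnegrE.
Qed.

(** The cylinder is bounded, so a Hoelder function differs from its value at a reference point by a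
    bounded amount. *)
Lemma holder_bar_bounded r f : 0 < r -> holder_bar alpha (Gcyl r) f ->
  exists C, forall y, Gcyl r y -> `|f y| <= C.
Proof.
move=> r0 [g [[C HC] fg]].
pose y0 : 'rV[R]_(d + 1) := pt 0 (r / 2).
have rr : r / 2 < r by rewrite ltr_pdivrMr// ltr_pMr// ltr1n.
have Gy0 : Gcyl r y0.
  apply/Gcyl_pt; split; last by rewrite rr divr_gt0.
  rewrite /enorm (eq_bigr (fun=> 0)) ?big1 ?sqrtr0// => i _.
  by rewrite mxE expr0n.
pose E := Num.sqrt ((d + 1)%:R * (r + r) ^+ 2).
have cr y b : Gcyl r y -> `|y 0 b| <= r.
  move=> [yr /andP[t0 tr]]; case: (tix_or_yix b) => [->|[j ->]].
    by rewrite ger0_norm ltW.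
  by have := coord_le_enorm (lsubmx y) j; rewrite mxE => /le_trans; apply; exact: ltW.
exists (`|g y0| + `|C| * E `^ alpha) => y yr; rewrite -fg// -(subrK (g y0) (g y)) addrC.
apply: le_trans (ler_normD _ _) _; rewrite lerD2l.
apply: le_trans (HC _ _ (subset_closure yr) (subset_closure Gy0)) _.
apply: (@le_trans _ _ (`|C| * enorm (y - y0) `^ alpha)).
  by rewrite ler_wpM2r ?powR_ge0// ler_norm.
rewrite ler_wpM2l// ge0_ler_powR ?nnegrE ?enorm_ge0 ?sqrtr_ge0 ?(ltW alpha0)//.
apply: enorm_le_bound; first by rewrite addr_ge0 ?(ltW r0).
move=> j; rewrite mxE [X in _ + X]mxE; apply: le_trans (ler_normB _ _) _.
by rewrite lerD// cr.
Qed.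

Section Solution.
Variable v : 'rV[R]_(d + 1) -> R.
Hypothesis sv : Csmooth G v.
Hypothesis hreg : forall (r : R) (tau : nat) (s : tau.-tuple 'I_d), 0 < r < Rad ->
  let w := pds (map yix s) v in
  [/\ holder_bar alpha (Gcyl r) (fun y => tco y ^- 2 * w y),
      forall i, holder_bar alpha (Gcyl r) (fun y => (tco y)^-1 * pd i w y) &
      forall i j, holder_bar alpha (Gcyl r) (pd i (pd j w))].

Lemma bound_tangential s : bound Rad 2 (pds (map yix s) v).
Proof.
move=> r rR; have [h1 _ _] := hreg (in_tuple s) rR; have r0 : 0 < r by case/andP: rR.
have [C HC] := holder_bar_bounded r0 h1.
exists C => y yr; have t0 := Gcyl_tco_gt0 yr; have := HC y yr.
rewrite normrM ger0_norm ?invr_ge0 ?exprn_ge0 ?(ltW t0)// mulrC ler_pdivrMr ?exprn_gt0//.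
by rewrite -(powR_mulrn 2 (ltW t0)).
Qed.

Lemma bound_tangential_t s : bound Rad 2 (Z tix (pds (map yix s) v)).
Proof.
move=> r rR; have [_ h1 _] := hreg (in_tuple s) rR; have r0 : 0 < r by case/andP: rR.
have [C HC] := holder_bar_bounded r0 (h1 tix).
exists C => y yr; have t0 := Gcyl_tco_gt0 yr; have := HC y yr.
rewrite normrM ger0_norm ?invr_ge0 ?(ltW t0)// mulrC ler_pdivrMr// => H.
rewrite Z_tE normrM ger0_norm ?(ltW t0)// (powR_mulrn 2 (ltW t0)).
by rewrite expr2 mulrA mulrC ler_wpM2r// ltW.
Qed.

Lemma cn0_v : cn Rad 0 2 v.
Proof.
split=> // n; suff H s : con Rad n 0 2 (pds (map yix s) v) by exact: (H [::]).
elim: n s => [|n IH] s; first by split=> //; exact: bound_tangential.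
split; first exact: bound_tangential.
move=> i; case: (tix_or_yix i) => [->|[j ->]]; rewrite ?eqxx// yix_neq => _.
apply: (con_congr (f := pds (map yix (j :: s)) v)) => [y _|]; last exact: IH.
by rewrite Z_yE.
Qed.

Lemma cn0_Zv : cn Rad 0 2 (Z tix v).
Proof.
split=> [|n]; first exact: Csmooth_Z.
suff H s : con Rad n 0 2 (Z tix (pds (map yix s) v)) by exact: (H [::]).
elim: n s => [|n IH] s; first by split=> //; exact: bound_tangential_t.
split; first exact: bound_tangential_t.
move=> i; case: (tix_or_yix i) => [->|[j ->]]; rewrite ?eqxx// yix_neq => _.
apply: (con_congr (f := Z tix (pds (map yix (j :: s)) v))) => [y Gy|]; last exact: IH.
rewrite (ZC (yix j) tix (Csmooth_pds _ oG sv) Gy).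
by apply: (@Z_congr _ _ Rad) => // z _; rewrite Z_yE.
Qed.

Variable F : 'rV[R]_(d + 1 + nargs d) -> R.
Hypothesis hF : Csmooth (Fdom Rad) F.
Variables (p q : R).
Hypothesis hsol : solves p q Rad F v.

Definition Fv y := F (row_mx y (row_mx (xi_args v y) (quad_args v y))).

(** This is the equation multiplied by [t^2], using [(t d/dt)^2 v = t^2 v_tt + t v_t]. *)
Lemma equation_theta y : G y ->
  Z tix (Z tix v) y = (1 - p) * Z tix v y - q * v y - tco y ^+ 2 * Fv y.
Proof.
move=> Gy; have t0 := Gcyl_tco_gt0 Gy.
have -> : Z tix (Z tix v) y = tco y ^+ 2 * pd tix (pd tix v) y + Z tix v y.
  rewrite {1}(Z_tE (Z tix v)).
  have st := Csmooth_wt (d := d) tix oG.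
  have sp := Csmooth_pd tix oG sv.
  have := pd_eq (isD_mul (Csmooth_derive tix oG st Gy) (Csmooth_derive tix oG sp Gy)).
  rewrite -[X in pd tix X y]/(Z tix v) => ->.
  rewrite (_ : wt tix = @tco R d); last by apply/funext => z; rewrite /wt eqxx.
  by rewrite pd_tco Z_tE; ring.
have := hsol Gy; rewrite -/(Fv y) => /eqP.
rewrite -!addrA addr_eq0 => /eqP ->; rewrite Z_tE.
by field; rewrite gt_eqF.
Qed.

(** If [v] admits [j + 1] normal letters, the arguments of [F] admit [j]. The equation then gives
    [j] letters for [(t d/dt)^2 v], that is [j + 2] for [v]. *)
Lemma Oc_v : Oc Rad 2 v.
Proof.
suff H j : cn Rad j.+1 2 v by move=> j; apply: cn_weak (H j).
elim: j => [|j IH]; first by apply: cn_gain; [exact: cn0_v|exact: cn0_Zv].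
apply: cn_gain => //; apply: cn_gain; first exact: cn_Zt.
have IH' : cn Rad j 2 v by apply: cn_weak IH.
have cF : cn Rad j 0 Fv.
  by apply: (cn_F_args hF) => b; move: b; apply: mxcomp_row => b; apply: (@cn_weak _ _ _ j 1);
    rewrite ?ler01//; [exact: xi_args_cn|exact: quad_args_cn].
have c1 := cn_mul (Oc_cst (d := d) Rad (1 - p) j) (cn_Zt IH).
have c2 := cn_mul (Oc_cst (d := d) Rad (- q) j) IH'.
have c3 := cn_mul (Oc_cst (d := d) Rad (-1) j) (cn_mul (Oc_tpow (d := d) Rad 2 j) cF).
rewrite addr0 add0r in c3; rewrite !add0r in c1 c2.
apply: cn_congr (cn_add (cn_add c1 c2) c3) => y Gy.
by rewrite equation_theta//; ring.
Qed.

End Solution.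

End Conormality.

(** * Gain of one power of [t] *)

Section ExpansionStep.
Context {R : realType} {d : nat}.
Variables (Rad : R).
Hypotheses (Rad0 : 0 < Rad).
Implicit Types (y : 'rV[R]_(d + 1)) (f g : 'rV[R]_(d + 1) -> R) (i j n : nat).

Notation G := (@Gcyl R d Rad).
Let oG : open G := @open_Gcyl R d Rad.
Let oB : open (@Bball R d Rad) := @open_Bball R d Rad.

Variables (M : nat) (lg : bool).
Hypothesis M2 : (2 <= M)%N.

(* Exponents [t^i ln^j t] for [v], for the right-hand side [-t^2 F], for the
   quadratic arguments multiplied by [t^2], and for products such as [v^2].
   The resonant exponent [(M + 1, 1)] is excluded from [expK]. *)
Definition expQ i j := (M * j + 1 <= i)%N /\ (2 <= i)%N /\ (lg || (j == 0%N)).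
Definition expK i j := expQ i j /\ ~ (i = M.+1 /\ j = 1%N).
Definition expT i j := (M * j + 1 <= i)%N /\ (3 <= i)%N /\ (j = 1%N -> M + 2 <= i)%N /\ (lg || (j == 0%N)).
Definition expQQ i j := (M * j + 2 <= i)%N /\ (4 <= i)%N /\ (j = 1%N -> M + 3 <= i)%N /\ (lg || (j == 0%N)).
Definition expQ1 i j := expQ i j \/ (i = M.+1 /\ j = 1%N).

Lemma lgD j j' : lg || (j == 0%N) -> lg || (j' == 0%N) -> lg || ((j + j')%N == 0%N).
Proof. by case: lg => //= /eqP -> /eqP ->. Qed.

Lemma lg_le j j' : (j' <= j)%N -> lg || (j == 0%N) -> lg || (j' == 0%N).
Proof. by case: lg => //= + /eqP j0; rewrite j0 leqn0. Qed.

Lemma expQ_Zt i j : expQ i j -> ((0 < i)%N -> expQ i j) /\ ((0 < j)%N -> expQ i j.-1).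
Proof.
move=> h; split=> // _; case: h => [h1 [h2 h3]]; split; last split=> //.
  by apply: leq_trans h1; rewrite leq_add2r leq_mul2l leq_pred orbT.
exact: lg_le (leq_pred j) h3.
Qed.

Lemma expQ_div i j : expQ i j -> exists2 i', i = i'.+1 & P0 M lg i' j.
Proof.
by case: i => [|i] [h1 [h2 h3]] //; exists i => //; split=> //; move: h1; rewrite addn1.
Qed.

Lemma expQ_P0 i j : expQ i j -> P0 M lg i j.
Proof. by move=> [h1 [h2 h3]]; split=> //; lia. Qed.

Lemma exp_bound (b : nat) (P : nat -> nat -> Prop) :
  (forall i j, P i j -> (b <= i)%N /\ (j != 0%N -> (b < i)%N)) ->
  forall i j, P i j -> (j = 0%N /\ b%:R <= i%:R :> R) \/ b%:R < i%:R :> R.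
Proof.
move=> H i j /H [h1 h2]; case: (eqVneq j 0%N) => [->|/h2 h].
  by left; rewrite ler_nat.
by right; rewrite ltr_nat.
Qed.

Lemma expQ_bound i j : expQ i j -> (j = 0%N /\ 2 <= i%:R :> R) \/ 2 < i%:R :> R.
Proof.
apply: (@exp_bound 2) => {}i {}j [h1 [h2 h3]]; split=> // j0; nia.
Qed.

Lemma expT_bound i j : expT i j -> (j = 0%N /\ 2 <= i%:R :> R) \/ 2 < i%:R :> R.
Proof. by move=> [h1 [h2 h3]]; right; rewrite ltr_nat; lia. Qed.

(** When a product carries a single logarithm, its other factor is free of logarithms and starts at
    [t^2]. This extra power keeps [t^(M+1) ln t] out of the right-hand side. *)
Lemma expQ_mul i j i' j' : expQ i j -> expQ i' j' -> expQQ (i + i')%N (j + j')%N.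
Proof.
move=> [h1 [h2 h3]] [h4 [h5 h6]]; split; first by rewrite mulnDr; lia.
split; first lia.
split; last exact: lgD.
case: j h1 {h3} => [|j] h1; case: j' h4 {h6} => [|j'] h4 E; nia.
Qed.

Lemma expQQ_div i j : expQQ i j -> exists2 i', i = i'.+1 & expT i' j.
Proof.
case: i => [|i] [h1 [h2 [h3 h4]]] //; exists i => //; split; first lia.
by split; [lia|split=> // /h3; lia].
Qed.

(** A single logarithm comes either from the coefficient, with total exponent at least [M + 3], or
    from the quadratic argument, with at least [M + 2]; the resonant pair is missed in both
    cases. *)
Lemma expT_mul i j i' j' : P0 M lg i j -> expT i' j' -> expK (i + i')%N (j + j')%N.
Proof.
move=> [h1 h2] [h3 [h4 [h5 h6]]]; split.
  by split; [rewrite mulnDr; lia|split; [lia|exact: lgD]].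
move=> [E1 E2]; case: j h1 E2 {h2} => [|j] h1 E2; case: j' h3 h5 E2 {h6} => [|j'] h3 h5 E2; nia.
Qed.

Lemma expt2_mul i j i' j' : P0 M lg i j -> (i' = 2%N /\ j' = 0%N) -> expK (i + i')%N (j + j')%N.
Proof.
move=> [h1 h2] [-> ->]; rewrite addn0; split; last by move=> [E1 E2]; subst j; lia.
by split; [lia|split=> //; lia].
Qed.

Lemma expK_le i j j' : (j' <= j)%N -> expK i j -> expK i j'.
Proof.
move=> jj [[h1 [h2 h3]] h4]; split; first split.
- by apply: leq_trans h1; rewrite leq_add2r leq_mul2l jj orbT.
- by split=> //; exact: lg_le h3.
- by move=> [E1 E2]; apply: h4; split=> //; subst; nia.
Qed.

Section Step.
Variables (F : 'rV[R]_(d + 1 + nargs d) -> R) (v : 'rV[R]_(d + 1) -> R).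
Hypotheses (hF : Csmooth (Fdom Rad) F) (hFlin : linear_in_quad Rad F).
Hypothesis hv : Oc Rad 2 v.

Let sv : Csmooth G v := Oc_smooth hv.

Definition Fe (e : 'rV[R]_(1 + 1 + 1)) y := F (row_mx y (row_mx (xi_args v y) e)).

(** The coefficients in [linear_in_quad] come without any regularity. They are recovered as
    differences of values of [F] at [0] and at the basis vectors, and so inherit smoothness from
    [F]. *)
Lemma Fv_linear y : G y -> Fv v F y =
  Fe 0 y + \sum_l (Fe (delta_mx 0 l) y - Fe 0 y) * quad_args v y 0 l.
Proof.
move=> Gy; have [a0 [a Ha]] := hFlin.
have D z : Fdom Rad (row_mx y z).
  by case: Gy => G1 /andP[G2 G3]; rewrite /Fdom /= row_mxKl; split=> //; rewrite ltW.
have E0 : Fe 0 y = a0 y (xi_args v y).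
  by rewrite /Fe Ha ?D// big1 ?addr0// => l _; rewrite mxE mulr0.
have E1 l : Fe (delta_mx 0 l) y = a0 y (xi_args v y) + a y (xi_args v y) 0 l.
  rewrite /Fe Ha ?D//; congr (_ + _); rewrite (bigD1 l)//= big1 ?addr0.
    by rewrite mxE !eqxx mulr1.
  by move=> l' ll; rewrite mxE (negPf ll) andbF mulr0.
rewrite /Fv Ha ?D// E0; congr (_ + _); apply: eq_bigr => l _; rewrite E1; ring.
Qed.

Section FixN.
Variable n : nat.
Hypothesis ev : Ex Rad (n.+1%:R + 2^-1) expQ v.

Let eZv : Ex Rad (n.+1%:R + 2^-1) expQ (Z tix v).
Proof. exact: Ex_Zt expQ_Zt ev. Qed.

Lemma Ex_divQ f : Ex Rad (n.+1%:R + 2^-1) expQ f -> Ex Rad (n%:R + 2^-1) (P0 M lg) (fun y => f y / tco y).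
Proof.
move=> /(Ex_div expQ_div); rewrite (_ : n.+1%:R + 2^-1 - 1 = n%:R + 2^-1)//.
by rewrite -natr1; ring.
Qed.

Lemma xi_args_Ex b : Ex Rad (n%:R + 2^-1) (P0 M lg) (fun y => xi_args v y 0 b).
Proof.
move: b; apply: xi_args_ind.
- exact: Ex_divQ.
- by apply: Ex_congr (Ex_divQ eZv) => y Gy; exact: (@pd_tE _ _ Rad).
- move=> i; apply: Ex_congr (Ex_divQ (Ex_Zy i ev)) => y Gy.
  by rewrite Z_yE.
- move=> i; apply: Ex_congr (Ex_divQ (Ex_Zt expQ_Zt (Ex_Zy i ev))) => y Gy.
  exact: (@pd_ytE _ _ Rad).
- move=> i j; apply: (@Ex_sub _ _ _ (n.+1%:R + 2^-1) _ expQ).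
  + by rewrite lerD2r ler_nat.
  + exact: expQ_P0.
  + by apply: Ex_congr (Ex_Zy i (Ex_Zy j ev)) => y Gy; exact: (@pd_yyE _ _ Rad).
Qed.

Lemma Oc_xi b : Oc Rad 1 (fun y => xi_args v y 0 b).
Proof. by move=> j; exact: xi_args_cn (hv j.+1) _. Qed.

Lemma Oc_Fe e : Oc Rad 0 (Fe e).
Proof.
move=> j; apply: (cn_F_args hF) => b; move: b; apply: mxcomp_row => b.
  by apply: (@cn_weak _ _ _ j 1); rewrite ?ler01//; exact: Oc_xi.
exact: Oc_cst.
Qed.

Lemma Ex_clsub k c : Csmooth (Bball Rad) c -> Ex Rad k (P0 M lg) (fun y => c (lsubmx y)).
Proof.
move=> sc; apply: Ex_span.
apply: (span_ext (f := fun y => c (lsubmx y) * mon 0 0 y)).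
  by move=> y; rewrite /mon !expr0 !mulr1.
by apply: span_mon => //; split; rewrite ?muln0// orbT.
Qed.

Lemma Ex_Fe e : Ex Rad (n%:R + 2^-1) (P0 M lg) (Fe e).
Proof.
pose X y := row_mx y (row_mx (xi_args v y) e).
have H (A : ('rV[R]_(d + 1) -> R) -> Prop) : A (@tco R d) ->
    (forall c, Csmooth (@Bball R d Rad) c -> A (fun y => c (lsubmx y))) ->
    (forall b, A (fun y => xi_args v y 0 b)) -> forall b, A (fun y => X y 0 b).
  move=> A1 A2 A3; apply: mxcomp_row; first exact: base_args_ind A1 A2.
  apply: mxcomp_row => // b.
  exact: (A2 (fun=> e 0 b) (Csmooth_cst _ oB)).
have := Ex_comp (lg := lg) Rad0 M2 (F := F) (X := X) (n := n) (@open_Fint R d Rad).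
apply.
- by move=> y; rewrite /Fint /X /= row_mxKl.
- exact: Csmooth_Fint.
- move=> s; apply: (F_args_bound hF) => b.
  move: b; apply: mxcomp_row => b; apply: Oc_bound; last exact: Oc_cst.
  by apply: Oc_le (Oc_xi b); exact: ler01.
- apply: H; first by apply: Oc_le (Oc_tco Rad); exact: ler01.
    by move=> c; exact: Oc_lsub.
  by move=> b; apply: Oc_le (Oc_xi b); exact: ler01.
- apply: (H (fun f => Oc Rad 1 (Z tix f))); first by apply: Oc_Z; exact: Oc_tco.
    move=> c sc; apply: (Oc_congr (f := fun=> 0)); last exact: Oc_zero.
    by move=> y _; rewrite Z_clsub.
  by move=> b; apply: Oc_Z; exact: Oc_xi.
- apply: H; last exact: xi_args_Ex.
    apply: Ex_span; apply: (span_ext (f := fun y => 1 * mon 1 0 y)).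
      by move=> y; rewrite /mon expr0 expr1 mul1r mulr1.
    apply: (@span_mon _ _ _ _ _ _ (fun=> 1)); last exact: Csmooth_cst.
    by split; rewrite ?muln0// orbT.
  exact: Ex_clsub.
Qed.

Let kap : R := n.+2%:R + 2^-1.

(** A remainder of order [n + 3/2] meets a factor [O(t^2)] and one division by [t]: a net gain of
    one power, up to [kap]. *)
Lemma Ex_quad f g : Oc Rad 2 f -> Ex Rad (n.+1%:R + 2^-1) expQ f ->
  Ex Rad (n.+1%:R + 2^-1) expQ g -> Ex Rad kap expT (fun y => f y * g y / tco y).
Proof.
move=> hf ef eg.
have : Ex Rad (n.+1%:R + 2^-1 + 2) expQQ (fun y => f y * g y).
  apply: (Ex_mul expQ_mul expQ_bound _ _ hf ef eg) => //.
  by rewrite addrC.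
move=> /(Ex_div expQQ_div); apply: Ex_sub => //.
by rewrite /kap -[n.+2%:R]natr1; lra.
Qed.

Lemma Ex_tquad l : Ex Rad kap expT (fun y => tco y ^+ 2 * quad_args v y 0 l).
Proof.
have hZv : Oc Rad 2 (Z tix v) by exact: Oc_Z.
move: l; apply: (quad_args_ind (A := fun f => Ex Rad kap expT (fun y => tco y ^+ 2 * f y))).
- apply: Ex_congr (Ex_quad hv ev ev) => y Gy.
  by field; rewrite gt_eqF// (Gcyl_tco_gt0 Gy).
- apply: Ex_congr (Ex_quad hv ev eZv) => y Gy.
  by rewrite Z_tE; field; rewrite gt_eqF// (Gcyl_tco_gt0 Gy).
- apply: Ex_congr (Ex_quad hZv eZv eZv) => y Gy.
  by rewrite Z_tE; field; rewrite gt_eqF// (Gcyl_tco_gt0 Gy).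
Qed.

Lemma Ex_rhs : Ex Rad kap expK (fun y => - (tco y ^+ 2 * Fv v F y)).
Proof.
apply: (Ex_congr (f := fun y => (-1) * (Fe 0 y * tco y ^+ 2 +
  \sum_l (Fe (delta_mx 0 l) y + (-1) * Fe 0 y) * (tco y ^+ 2 * quad_args v y 0 l)))).
  move=> y Gy; rewrite Fv_linear// mulN1r; congr (- _); rewrite mulrDr; congr (_ + _).
    by rewrite mulrC.
  by rewrite mulr_sumr; apply: eq_bigr => l _; ring.
have k3 (a : R) : a <= 0 + a by rewrite add0r.
(* The coefficients [Fe] are known with remainder of order [n + 1/2] only, but their partners are
   [O(t^2)]. *)
have k2 : kap <= n%:R + 2^-1 + 2 by rewrite /kap -!natr1; lra.
apply: Ex_scal; apply: Ex_add.
  apply: (Ex_mul expt2_mul _ k2 _ (Oc_Fe 0) (Ex_Fe 0) (k2 := kap)).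
  - by move=> i j [-> ->]; left.
  - exact: k3.
  - apply: Ex_span; apply: (span_ext (f := fun y => 1 * mon 2 0 y)).
      by move=> y; rewrite /mon expr0 mul1r mulr1.
    by apply: (@span_mon _ _ _ _ _ _ (fun=> 1)) => //; exact: Csmooth_cst.
apply: Ex_sum => l.
apply: (Ex_mul expT_mul expT_bound k2 _ _ _ (Ex_tquad l)).
- exact: k3.
- by apply: Oc_add; [exact: Oc_Fe|apply: Oc_scal; exact: Oc_Fe].
- by apply: Ex_add; [exact: Ex_Fe|apply: Ex_scal; exact: Ex_Fe].
Qed.

Variables (mlow p q : R).
Hypotheses (hmlow : mlow <= 0) (hp : p = 1 - (mlow + M.+1%:R)) (hq : q = mlow * M.+1%:R).
Hypothesis hsol : solves p q Rad F v.

Lemma euler_euler y : G y -> euler mlow (euler M.+1%:R v) y = - (tco y ^+ 2 * Fv v F y).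
Proof.
move=> Gy; have Eq := equation_theta sv hsol Gy.
rewrite {1}/euler (@Z_euler _ _ Rad)//.
by rewrite /euler Eq hp hq; ring.
Qed.

(** The right-hand side is known one order better than [v], and inverting the two Euler operators
    keeps this gain. The exponents are [expQ1] because the resonance may produce [t^(M+1) ln t] even
    when [lg = false]. *)
Lemma expansion_step : Ex Rad kap expQ1 v.
Proof.
have mk : mlow < kap by apply: le_lt_trans hmlow _; rewrite addr_gt0.
have ml1 : mlow < 1 by exact: le_lt_trans hmlow ltr01.
have hu : Oc Rad 2 (euler M.+1%:R v) by exact: Oc_euler.
have [g1 sg1 hg1] := Ex_rhs.
have [P1 sP1 HP1] : exists2 P1, span Rad expK P1 & forall y, G y -> euler mlow P1 y = g1 y.
  apply: span_euler_inv sg1 => i j Kij; left; split; last by move=> j' /expK_le; exact.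
  case: Kij => [[_ [h2 _]] _]; rewrite gt_eqF// (le_lt_trans hmlow)// ltr0n; lia.
have K1 i j : expK i j -> (j = 0%N /\ 1 <= i%:R :> R) \/ 1 < i%:R :> R.
  by move=> [[_ [h2 _]] _]; right; rewrite ltr1n; lia.
(* This function decays faster than [t^mlow], so inverting [t d/dt - mlow] leaves no kernel term. *)
have hu1 : Oc Rad kap (fun y => euler M.+1%:R v y - P1 y).
  apply: (@Oc_euler_gt0 _ _ _ Rad0 mlow _ kap 1) => //.
    apply: Oc_sub; last exact: span_Oc sP1.
    by apply: Oc_le hu; rewrite ler1n.
  apply: Oc_congr hg1 => y Gy.
  by rewrite (euler_sub _ (Oc_smooth hu) (span_smooth sP1) Gy) HP1// euler_euler.
have [P2 sP2 HP2] : exists2 P2, span Rad expQ1 P2 & forall y, G y -> euler M.+1%:R P2 y = P1 y.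
  apply: span_euler_inv sP1 => i j Kij.
  case: (eqVneq i M.+1) => [iM|iM].
    right; split; first by rewrite iM.
    (* At [i = M + 1] the case [j = 1] is excluded by [expK] and [j >= 2] violates [M * j + 1 <= i];
       the resonance therefore creates exactly one logarithm. *)
    have -> : j = 0%N by case: Kij => [[h1 [h2 h3]] h4]; subst i; case: j h1 h3 h4 => [|[|j]] // h1 h3 h4; [case: h4|nia].
    by right.
  left; split; first by rewrite eqr_nat.
  by move=> j' /expK_le/(_ Kij) []; left.
have hw : Oc Rad kap (euler M.+1%:R (fun y => v y - P2 y)).
  apply: Oc_congr hu1 => y Gy.
  by rewrite (euler_sub _ sv (span_smooth sP2) Gy) HP2.
(* Past the root, integration from [t = 0] leaves a term [c t^(M+1)]; before it, integration from a
   positive height leaves none. The half in [kap] rules out equality. *)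
have [kM|kM] := leqP M.+1 n.+2.
  have Mk : M.+1%:R < kap by rewrite /kap (@le_lt_trans _ _ n.+2%:R)// ?ler_nat// ltrDl.
  have [c sc hc] := Oc_euler_gt Rad0 Mk (Csmooth_sub' oG sv (span_smooth sP2)) hw.
  exists (fun y => P2 y + c (lsubmx y) * mon M.+1 0 y).
    apply: span_add => //; apply: span_mon => //; left.
    by split; [rewrite muln0|split; [lia|rewrite orbT]].
  apply: Oc_congr hc => y Gy; rewrite /mon expr0 mulr1 powR_mulrn ?opprD ?addrA//.
  by rewrite ltW// (Gcyl_tco_gt0 Gy).
have Mk : kap < M.+1%:R.
  rewrite (@lt_le_trans _ _ (n.+2%:R + 1))//; last by rewrite natr1 ler_nat.
  by rewrite /kap ltrD2l invf_lt1// ltr1n.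
exists P2 => //; apply: (@Oc_euler_lt _ _ _ M.+1%:R _ kap 1) => //.
apply: Oc_sub; first by apply: Oc_le hv; rewrite ler1n.
apply: span_Oc sP2 => i j [[_ [h2 _]]|[-> ->]]; right; rewrite ltr1n; lia.
Qed.

End FixN.
End Step.
End ExpansionStep.

(** * Uniqueness of expansions *)

Section Uniqueness.
Context {R : realType}.

Lemma poly_ln_le (q : {poly R}) (e : R) : 0 < e ->
  exists2 C, 0 <= C & forall t, 0 < t < 1 -> `|q.[ln t]| <= C * t `^ (- e).
Proof.
elim/poly_ind: q e => [|p c IH] e e0.
  by exists 0 => // t _; rewrite horner0 normr0 mul0r.
have e20 : 0 < e / 2 by rewrite divr_gt0.
have [C C0 HC] := IH _ e20.
have K0 : 0 <= (e / 2)^-1 + 1 `^ (1 + e / 2) by rewrite addr_ge0 ?powR_ge0// invr_ge0 ltW.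
exists (C * ((e / 2)^-1 + 1 `^ (1 + e / 2)) + `|c|) => [|t t01].
  by rewrite addr_ge0// mulr_ge0.
have t0 : 0 < t by case/andP: t01.
rewrite hornerMXaddC mulrDl; apply: le_trans (ler_normD _ _) _; apply: lerD.
  have -> : - e = - (e / 2) + - (e / 2) by field.
  rewrite normrM (powR_add _ _ t0) mulrACA; apply: ler_pM => //; first exact: HC.
  exact: abs_ln_le.
rewrite ler_peMr// -(powRr0 t); apply: ger_powR; last by rewrite oppr_le0 ltW.
by case/andP: t01 => -> /ltW.
Qed.

(** As [t] tends to [0], [- ln t] tends to infinity, where a polynomial with positive leading
    coefficient stays above that coefficient; no such polynomial in [- ln t] is [O(t^e)]. *)
Lemma poly_ln_vanish (q : {poly R}) (C e p : R) : 0 < e -> 0 < p ->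
  (forall t, 0 < t < p -> `|q.[ln t]| <= C * t `^ e) -> q = 0.
Proof.
move=> e0 p0 H; apply/eqP; apply: contraT => q0.
wlog lq : q q0 H / 0 < lead_coef (q \Po (- 'X)).
  move=> W; case: (ltrgt0P (lead_coef (q \Po (- 'X)))) => l0; first exact: (W q).
    apply: (W (- q)); first by rewrite oppr_eq0.
      by move=> t tp; rewrite hornerN normrN; exact: H.
    by rewrite raddfN /= lead_coefN oppr_gt0.
  have E : q \Po (- 'X) = 0 by apply/eqP; rewrite -lead_coef_eq0 l0.
  have : (q \Po (- 'X)) \Po (- 'X) = q.
    by rewrite -comp_polyA raddfN /= comp_polyX opprK comp_polyXr.
  by rewrite E comp_poly0 => /eqP; rewrite eq_sym (negPf q0).
have [n Hn] := polyrcf.poly_pinfty_gt_lc lq.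
have : lead_coef (q \Po (- 'X)) <= 0; last by rewrite leNgt lq.
pose p1 := Num.min p (expR (- n)).
have p10 : 0 < p1 by rewrite lt_min p0 expR_gt0.
apply: (le0_of_powR (C := C) e0 p10) => t; rewrite lt_min => /and3P[t0 tp tn].
apply: le_trans (H t _); last by rewrite t0.
apply: le_trans (Hn (- ln t) _) _.
  rewrite lerNr -[leRHS]expRK ler_ln ?posrE ?expR_gt0//; exact: ltW.
by rewrite horner_comp hornerN hornerX opprK ler_norm.
Qed.

(** Once the rows below [N] vanish, dividing by [t^N] leaves the row [N] plus [O(t^(1/2))], because
    the polynomials in [ln t] of later rows cost at most [t^(-1/2)]. *)
Lemma log_expansion_uniq (K N : nat) (q : nat -> {poly R}) (C p : R) : 0 < p ->
  (forall t, 0 < t < p -> `|\sum_(i < K) t ^+ i * (q i).[ln t]| <= C * t `^ (N%:R - 2^-1)) ->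
  forall i, (i < K)%N -> (i < N)%N -> q i = 0.
Proof.
(* For [t < 1] powers of [t] decrease in the exponent. *)
move=> p0; wlog p1 : p p0 / p < 1.
  move=> W H; have q0 : 0 < Num.min p 2^-1 by rewrite lt_min p0 invr_gt0 ltr0n.
  have q1 : Num.min p 2^-1 < 1 by rewrite gt_min invf_lt1// ltr1n orbT.
  apply: (W _ q0 q1) => t.
  by rewrite lt_min => /and3P[t0 tp _]; apply: H; rewrite t0.
elim: N C => [//|N IH] C H.
have tN t : 0 < t < p -> 0 < t < 1 by move=> /andP[-> tp]; exact: lt_trans tp p1.
have H0 : forall i, (i < K)%N -> (i < N)%N -> q i = 0.
  apply: (IH `|C|) => t tp; apply: le_trans (H t tp) _.
  apply: (@le_trans _ _ (`|C| * t `^ (N.+1%:R - 2^-1))); first by rewrite ler_wpM2r ?powR_ge0// ler_norm.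
  rewrite ler_wpM2l// ger_powR ?lerD2r ?ler_nat//.
  by have /andP[-> /ltW] := tN t tp.
move=> i iK; rewrite ltnS leq_eqVlt => /predU1P[iN|]; last exact: H0.
have e20 : 0 < 2^-1 :> R by rewrite invr_gt0.
have /choice[D HD] : forall j, exists C, 0 <= C /\ forall t, 0 < t < 1 -> `|(q j).[ln t]| <= C * t `^ (- 2^-1).
  by move=> j; have [D D0 HD] := poly_ln_le (q j) e20; exists D.
apply: (@poly_ln_vanish _ (`|C| + \sum_(j < K) D j) 2^-1 p) => // t tp.
have t01 := tN t tp; have t0 : 0 < t by case/andP: t01.
have tN0 : 0 < t `^ N%:R by rewrite powR_gt0.
rewrite -(ler_pM2l tN0) -[X in X * `|_|](ger0_norm (ltW tN0)) -normrM powR_mulrn ?(ltW t0)//.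
have -> : t ^+ N * (q i).[ln t] = \sum_(j < K) t ^+ j * (q j).[ln t] -
    \sum_(j < K | j != Ordinal iK) t ^+ j * (q j).[ln t].
  by rewrite (bigD1 (Ordinal iK))//= addrK iN.
have EN : N.+1%:R - 2^-1 = N%:R + 2^-1 :> R by rewrite -natr1; field.
rewrite mulrCA -(powR_mulrn _ (ltW t0)) -powR_add// mulrDl.
apply: le_trans (ler_normB _ _) _; apply: lerD.
  apply: le_trans (H t tp) _; rewrite EN ler_wpM2r ?powR_ge0// ler_norm.
  by [].
apply: le_trans (ler_norm_sum _ _ _) _; rewrite mulr_suml [leRHS](bigD1 (Ordinal iK))//=.
rewrite -[leLHS]add0r lerD ?mulr_ge0 ?powR_ge0//; first by case: (HD i).
apply: ler_sum => j ji; have [D0 HDj] := HD j.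
have [jN|Nj] := ltnP j N; first by rewrite H0// horner0 mulr0 normr0 mulr_ge0 ?powR_ge0.
have {}Nj : (N < j)%N.
  rewrite ltn_neqAle Nj andbT; apply: contra ji => /eqP E.
  by apply/eqP/val_inj; rewrite /= -E iN.
rewrite normrM ger0_norm ?exprn_ge0 ?(ltW t0)//.
apply: (@le_trans _ _ (t ^+ j * (D j * t `^ (- 2^-1)))).
  by rewrite ler_wpM2l ?exprn_ge0 ?(ltW t0)// HDj.
rewrite mulrCA -(powR_mulrn _ (ltW t0)) -powR_add// ler_wpM2l//.
rewrite ger_powR//; first by rewrite t0 ltW//; case/andP: t01.
by rewrite -EN lerD2r ler_nat.
Qed.

Context {d : nat}.
Variables (Rad : R).
Hypotheses (Rad0 : 0 < Rad).
Implicit Types (y : 'rV[R]_(d + 1)) (f g : 'rV[R]_(d + 1) -> R) (i j n : nat).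

Notation G := (@Gcyl R d Rad).
Notation B := (@Bball R d Rad).
Let oG : open G := @open_Gcyl R d Rad.
Let oB : open (@Bball R d Rad) := @open_Bball R d Rad.

Definition msum (K : nat) (c : nat -> nat -> 'rV[R]_d -> R) y : R :=
  \sum_(i < K) \sum_(j < K) c i j (lsubmx y) * mon i j y.

Lemma msum_pt K c x t :
  msum K c (pt x t) = \sum_(i < K) t ^+ i * (\poly_(j < K) c i j x).[ln t].
Proof.
rewrite /msum; apply: eq_bigr => i _; rewrite horner_poly mulr_sumr; apply: eq_bigr => j _.
by rewrite /mon lsub_pt tco_pt; ring.
Qed.

Lemma msum_uniq K c (N : nat) : bound Rad (N%:R - 2^-1) (msum K c) ->
  forall i j x, (i < K)%N -> (j < K)%N -> (i < N)%N -> B x -> c i j x = 0.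
Proof.
move=> bm i j x iK jK iN xB; have [r rR xr] := Bball_exists Rad0 xB.
have [C HC] := bm r rR; have r0 : 0 < r by case/andP: rR.
have := @log_expansion_uniq K N (fun i => \poly_(j < K) c i j x) C r r0 _ i iK iN.
move=> /(_ _)/polyP/(_ j); rewrite coef_poly jK coef0; apply.
move=> t tr; have Gx : Gcyl r (pt x t) by apply/Gcyl_pt.
by have := HC _ Gx; rewrite msum_pt tco_pt.
Qed.

Lemma msum_widen K K' c y : (K <= K')%N ->
  (forall i j, (K <= i)%N \/ (K <= j)%N -> c i j = fun=> 0) -> msum K' c y = msum K c y.
Proof.
move=> KK c0; rewrite /msum.
have E i : \sum_(j < K') c i j (lsubmx y) * mon i j y = \sum_(j < K) c i j (lsubmx y) * mon i j y.
  rewrite [RHS](big_ord_widen K' (fun j => c i j (lsubmx y) * mon i j y))//.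
  rewrite [RHS]big_mkcond /=; apply: eq_bigr => j _; case: ltnP => // Kj.
  by rewrite c0 ?mul0r//; right.
rewrite [RHS](big_ord_widen K' (fun i => \sum_(j < K) c i j (lsubmx y) * mon i j y))//.
rewrite [RHS]big_mkcond /=; apply: eq_bigr => i _; rewrite E; case: ltnP => // Ki.
by rewrite big1// => j _; rewrite c0 ?mul0r//; left.
Qed.

Lemma span_coef (P : nat -> nat -> Prop) f : span Rad P f ->
  exists (c : nat -> nat -> 'rV[R]_d -> R) (K : nat),
  [/\ forall i j, Csmooth B (c i j), forall i j, ~ P i j -> c i j = fun=> 0,
      forall i j, (K <= i)%N \/ (K <= j)%N -> c i j = fun=> 0 & forall y, f y = msum K c y].
Proof.
elim=> [|i0 j0 c0 f' P0 sc0 _ [c [K [sc cP cK Hc]]]].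
  exists (fun _ _ _ => 0), 0%N; split=> // [i j|y]; first exact: Csmooth_cst.
  by rewrite /msum big_ord0.
pose c' i j := if (i == i0) && (j == j0) then fun x => c0 x + c i j x else c i j.
pose K' := maxn K (maxn i0.+1 j0.+1).
have KK : (K <= K')%N by rewrite leq_maxl.
have iK : (i0 < K')%N by rewrite !leq_max leqnn orbT.
have jK : (j0 < K')%N by rewrite !leq_max leqnn !orbT.
exists c', K'; split.
- move=> i j; rewrite /c'; case: ifP => _ //; exact: Csmooth_add.
- move=> i j nP; rewrite /c'; case: ifP => [/andP[/eqP ii /eqP jj]|_]; last exact: cP.
  by subst.
- move=> i j h; rewrite /c'; case: ifP => [/andP[/eqP ii /eqP jj]|_].
    by subst; case: h; rewrite leqNgt ?iK ?jK.
  by apply: cK; case: h => h; [left|right]; exact: leq_trans h.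
- move=> y; rewrite Hc -(msum_widen y KK cK) /msum.
  rewrite (bigD1 (Ordinal iK))//= [RHS](bigD1 (Ordinal iK))//= addrA; congr (_ + _).
    rewrite (bigD1 (Ordinal jK))//= [RHS](bigD1 (Ordinal jK))//= addrA; congr (_ + _).
      by rewrite /c' !eqxx /= mulrDl.
    apply: eq_bigr => j ji; rewrite /c' eqxx /=; case: eqP => // E.
    by case/eqP: ji; apply: val_inj.
  apply: eq_bigr => i ii; apply: eq_bigr => j _; rewrite /c'; case: eqP => //= E.
  by case/eqP: ii; apply: val_inj.
Qed.

Lemma msum_tail_Oc K c (N : nat) : (forall i j, Csmooth B (c i j)) ->
  Oc Rad (N%:R - 2^-1) (msum K (fun i j => if (i < N)%N then fun=> 0 else c i j)).
Proof.
move=> sc; apply: Oc_sum => i _; apply: Oc_sum => j _; case: ltnP => Ni.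
  by apply: (Oc_congr (f := fun=> 0)); [move=> y _; rewrite mul0r|exact: Oc_zero].
rewrite -(add0r (N%:R - 2^-1)); apply: Oc_mul; first exact: Oc_lsub.
apply: Oc_mon; right; rewrite (@lt_le_trans _ _ N%:R) ?ler_nat//.
by rewrite gtrBl invr_gt0.
Qed.

(** By uniqueness, expansions of different orders share their low rows, so they assemble into one
    infinite array. *)
Lemma Ex_all_coef (P : nat -> nat -> Prop) v : (forall i j, P i j -> (j < i)%N) ->
  (forall n, Ex Rad (n.+1%:R + 2^-1) P v) ->
  exists c : nat -> nat -> 'rV[R]_d -> R,
  [/\ forall i j, Csmooth B (c i j), forall i j, ~ P i j -> c i j = fun=> 0 &
      forall N, Oc Rad (N%:R - 2^-1) (fun y => v y - msum N c y)].
Proof.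
move=> Pij ev.
have /choice[c Hc] : forall n, exists c : nat -> nat -> 'rV[R]_d -> R,
    [/\ forall i j, Csmooth B (c i j), forall i j, ~ P i j -> c i j = fun=> 0 &
     exists K, (forall i j, (K <= i)%N \/ (K <= j)%N -> c i j = fun=> 0) /\
       Oc Rad (n.+1%:R + 2^-1) (fun y => v y - msum K c y)].
  move=> n; have [p sp hp] := ev n; have [c [K [sc cP cK Hc]]] := span_coef sp.
  exists c; split=> //; exists K; split=> //.
  by apply: Oc_congr hp => y _; rewrite Hc.
have half (n : nat) : n.+1%:R + 2^-1 = n.+2%:R - 2^-1 :> R by rewrite -[n.+2%:R]natr1; field.
have cE n n' i j x : (n <= n')%N -> (i < n.+2)%N -> B x -> c n i j x = c n' i j x.
  move=> nn iN xB; have [sc cP [K [cK hK]]] := Hc n; have [sc' cP' [K' [cK' hK']]] := Hc n'.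
  have hK'' := @Oc_le _ _ _ (n'.+1%:R + 2^-1) (n.+1%:R + 2^-1) _ _ hK'.
  have {}hK'' := hK'' _; have {hK''} : Oc Rad (n.+1%:R + 2^-1) (fun y => v y - msum K' (c n') y).
    by apply: hK''; rewrite lerD2r ler_nat.
  move=> hK2; pose K2 := (maxn K K' + i + j).+1.
  have le1 : (K <= K2)%N by rewrite /K2; lia.
  have le2 : (K' <= K2)%N by rewrite /K2; lia.
  apply/eqP; rewrite -subr_eq0; apply/eqP.
  apply: (@msum_uniq K2 (fun i j x => c n i j x - c n' i j x) n.+2) => //; try by rewrite /K2; lia.
  rewrite -half; apply: Oc_bound; apply: Oc_congr (Oc_sub hK2 hK) => y _.
  rewrite -(msum_widen y le1 cK) -(msum_widen y le2 cK') /msum.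
  have -> : v y - \sum_(i0 < K2) \sum_(j0 < K2) c n' i0 j0 (lsubmx y) * mon i0 j0 y -
     (v y - \sum_(i0 < K2) \sum_(j0 < K2) c n i0 j0 (lsubmx y) * mon i0 j0 y) =
     \sum_(i0 < K2) \sum_(j0 < K2) c n i0 j0 (lsubmx y) * mon i0 j0 y -
     \sum_(i0 < K2) \sum_(j0 < K2) c n' i0 j0 (lsubmx y) * mon i0 j0 y by ring.
  rewrite -sumrB; apply: eq_bigr => i' _; rewrite -sumrB; apply: eq_bigr => j' _.
  by rewrite mulrBl.
(* Row [i] is already final in the expansion number [i], which fixes all rows below [i + 2]. *)
exists (fun i j => c i i j); split.
- by move=> i j; case: (Hc i).
- by move=> i j nP; case: (Hc i) => _ -> .
move=> N; have [sc cP [K [cK hK]]] := Hc N.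
pose K2 := maxn K N.
have le1 : (K <= K2)%N by rewrite leq_maxl.
have h1 : Oc Rad (N%:R - 2^-1) (fun y => v y - msum K (c N) y).
  apply: Oc_le hK; rewrite -[N.+1%:R]natr1; have : 0 < 2^-1 :> R by rewrite invr_gt0.
  by move: (2^-1) => h h0; lra.
apply: Oc_congr (Oc_add h1 (msum_tail_Oc K2 N sc)) => y Gy.
rewrite -(msum_widen y le1 cK) -addrA; congr (_ + _).
rewrite [LHS]addrC -[LHS]opprB; congr (- _); rewrite /msum -sumrB.
rewrite [RHS](big_ord_widen K2 (fun i => \sum_(j < N) c i i j (lsubmx y) * mon i j y)) ?leq_maxr//.
rewrite [RHS]big_mkcond /=; apply: eq_bigr => i _; rewrite -sumrB; case: ltnP => iN; last first.
  by rewrite big1// => j _; rewrite subrr.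
rewrite (big_ord_widen K2 (fun j => c i i j (lsubmx y) * mon i j y)) ?leq_maxr//.
rewrite [RHS]big_mkcond /=; apply: eq_bigr => j _; rewrite mul0r subr0.
have [jN|Nj] := ltnP j N.
  by rewrite -(@cE i N)//; [exact: ltnW|case: Gy].
rewrite cP ?mul0r// => /Pij ji; lia.
Qed.

End Uniqueness.

(** * Borel summation *)

Section Bump.
Context {R : realType}.

Lemma is_derive_flat (V : normedModType R) (f : V -> R) x v (C p : R) : 0 < p -> f x = 0 ->
  (forall h, `|h| < p -> `|f (h *: v + x)| <= C * h ^+ 2) -> is_derive x v f 0.
Proof.
move=> p0 fx H; apply/is_derive_cvgP/cvgrPdist_le => e e0.
have C0 : 0 < `|C| + 1 by rewrite ltr_wpDl.
near=> h.
have h0 : h != 0 by near: h; exact: nbhs_dnbhs_neq.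
have hp : `|h| < p.
  near: h; exact: dnbhs0_lt.
have he : `|h| <= e / (`|C| + 1).
  by near: h; apply: dnbhs0_le; rewrite divr_gt0.
rewrite fx subr0 sub0r normrN /GRing.scale /= normrM normfV mulrC ler_pdivrMr ?normr_gt0//.
apply: le_trans (H h hp) _.
rewrite -real_normK ?num_real// expr2 mulrA ler_wpM2r//.
apply: (@le_trans _ _ ((`|C| + 1) * `|h|)).
  by rewrite ler_wpM2r// (le_trans (ler_norm C))// lerDl.
by rewrite mulrC -ler_pdivlMr.
Unshelve. all: by end_near. Qed.

(** The recursion is [d/dx (P(1/x) exp(-1/x)) = x^-2 (P - P')(1/x) exp(-1/x)]. *)
Fixpoint bump_poly (n : nat) : {poly R} :=
  if n is n'.+1 then 'X^2 * (bump_poly n' - (bump_poly n')^`()) else 1.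

(* The [n]-th derivative of the function [exp (- 1 / x)], extended by [0]. *)
Definition flat_exp (n : nat) (x : R) : R :=
  if 0 < x then (bump_poly n).[x^-1] * expR (- x^-1) else 0.

Lemma poly_expR_le (q : {poly R}) : exists2 C, 0 <= C & forall y, 0 < y -> `|q.[y]| <= C * expR y.
Proof.
have [C C0 HC] := poly_ln_le (q \Po (- 'X)) ltr01.
exists C => // y y0; have t01 : 0 < expR (- y) < 1 by rewrite expR_gt0 expR_lt1 oppr_lt0 y0.
have := HC _ t01; rewrite expRK horner_comp hornerN hornerX opprK => /le_trans; apply.
by rewrite powRN powRr1 ?expR_ge0// expRN invrK.
Qed.

(** The quadratic bound yields a zero derivative at [0], where the two branches meet. *)
Lemma flat_exp_le n : exists C, forall x, `|flat_exp n x| <= C * x ^+ 2.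
Proof.
have [C C0 HC] := poly_expR_le (bump_poly n * 'X^2).
exists C => x; rewrite /flat_exp; case: ifP => x0; last by rewrite normr0 mulr_ge0// sqr_ge0.
have xi : 0 < x^-1 by rewrite invr_gt0.
have := HC _ xi; rewrite hornerM hornerXn normrM [`|_ ^+ 2|]ger0_norm ?sqr_ge0//.
rewrite exprVn ler_pdivrMr ?exprn_gt0// => H.
rewrite normrM [`|expR _|]ger0_norm ?expR_ge0// expRN ler_pdivrMr ?expR_gt0//.
by rewrite mulrAC.
Qed.

Lemma is_derive_flat_exp n (x : R) : is_derive x 1 (flat_exp n) (flat_exp n.+1 x).
Proof.
have [x0|x0|->] := ltrgt0P x.
- have o0 : open [set z : R | 0 < z] by exact: open_gt.
  have E : \near x, (fun z => (bump_poly n).[z^-1] * expR (- z^-1)) x = flat_exp n x.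
    by apply: filterS (open_nbhs_nbhs (conj o0 x0)) => z z0; rewrite /flat_exp z0.
  apply: near_eq_is_derive E _; rewrite /flat_exp x0.
  have di : is_derive x 1 (fun z : R => z^-1) (- x^-1 ^+ 2).
    have h := @is_deriveV R id x 1 1 (lt0r_neq0 x0) (is_derive_id x 1).
    by apply: is_derive_eq h _; rewrite exprVn /GRing.scale /= mulr1.
  have dp := isD_comp1 (@is_derive_poly R (bump_poly n) x^-1) di.
  have de := isD_comp1 (u := fun y : R => - y^-1) (@is_derive_expR R (- x^-1)) (isD_opp di).
  apply: is_derive_eq (isD_mul dp de) _.
  by rewrite /= !(hornerM, hornerD, hornerN, hornerX); ring.
- have o0 : open [set z : R | z < 0] by exact: open_lt.
  have E : \near x, (fun z : R => 0) x = flat_exp n x.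
    apply: filterS (open_nbhs_nbhs (conj o0 x0)) => z /= z0; rewrite /flat_exp.
    by rewrite ltNge (ltW z0).
  apply: near_eq_is_derive E _; rewrite /flat_exp ltNge (ltW x0) /=.
  exact: isD_cst.
- have [C HC] := flat_exp_le n; rewrite {2}/flat_exp ltxx.
  apply: (@is_derive_flat _ _ _ _ C 1) => //; first by rewrite /flat_exp ltxx.
  by move=> h _; rewrite addr0 [h%:A]mulr1.
Qed.

Lemma flat_exp_gt0 x : 0 < x -> 0 < flat_exp 0 x.
Proof. by move=> x0; rewrite /flat_exp x0 /= hornerC mul1r expR_gt0. Qed.

Lemma flat_exp_le0 x : x <= 0 -> flat_exp 0 x = 0.
Proof. by rewrite /flat_exp leNgt => /negPf ->. Qed.

Lemma flat_exp_homo x z : 0 < x -> x <= z -> flat_exp 0 x <= flat_exp 0 z.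
Proof.
move=> x0 xz; have z0 := lt_le_trans x0 xz.
by rewrite /flat_exp x0 z0 /= !hornerC !mul1r ler_expR lerN2 lef_pV2.
Qed.

(** The inner [flat_exp] vanishes for [|x| <= 1] and is at least [flat_exp 0 3] for [|x| >= 2],
    where [x^2 - 1 >= 3]. The only divisor is a constant, so smoothness follows from
    compositions. *)
Definition bump (x : R) : R :=
  flat_exp 0 (flat_exp 0 3 - flat_exp 0 (x ^+ 2 - 1)) / flat_exp 0 (flat_exp 0 3).

Lemma bump1 x : `|x| <= 1 -> bump x = 1.
Proof.
move=> x1; rewrite /bump (flat_exp_le0 (x := x ^+ 2 - 1)).
  by rewrite subr0 divff// gt_eqF// !flat_exp_gt0.
by rewrite subr_le0 -real_normK ?num_real// expr_le1.
Qed.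

Lemma bump0 x : 2 <= `|x| -> bump x = 0.
Proof.
move=> x2; rewrite /bump (flat_exp_le0 (x := _ - _)) ?mul0r//.
rewrite subr_le0; apply: flat_exp_homo; first by rewrite ltr0n.
have : 2 ^+ 2 <= `|x| ^+ 2 by rewrite lerXn2r ?nnegrE.
rewrite real_normK ?num_real// => H; lra.
Qed.

Lemma Csmooth_bump k (O : set 'rV[R]_k) u : open O -> Csmooth O u ->
  Csmooth O (fun z => bump (u z)).
Proof.
move=> oO su; have comp w : Csmooth O w -> Csmooth O (fun z => flat_exp 0 (w z)).
  move=> sw; apply: (@Csmooth_comp1 _ _ _ setT flat_exp w oO) => // n x _.
  exact: is_derive_flat_exp.
have s1 := Csmooth_sub' oO (Csmooth_exp 2 oO su) (Csmooth_cst 1 oO).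
have s2 := Csmooth_sub' oO (Csmooth_cst (flat_exp 0 3) oO) (comp _ s1).
exact: (Csmooth_mul oO (comp _ s2) (Csmooth_cst _ oO)).
Qed.

End Bump.

(** * Termwise differentiation of rapidly convergent series *)

Section SmoothSeries.
Context {R : realType} {k : nat}.
Implicit Types (O : set 'rV[R]_k) (s : seq 'I_k).

Lemma cauchy_limit (a e : nat -> R) (n0 : nat) :
  (forall n m, (n0 <= n)%N -> (n0 <= m)%N -> a n - e n <= a m + e m) ->
  exists l, forall n, (n0 <= n)%N -> `|a n - l| <= e n.
Proof.
move=> H; pose S := [set a n - e n | n in [set n | (n0 <= n)%N]].
have S0 : S !=set0 by exists (a n0 - e n0), n0 => /=.
have Sub m : (n0 <= m)%N -> ubound S (a m + e m) by move=> h _ [n /= nn <-]; exact: H.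
have hS : has_sup S by split=> //; exists (a n0 + e n0); exact: Sub.
exists (sup S) => n nn.
have h1 : a n - e n <= sup S by apply: sup_upper_bound => //; exists n.
have h2 : sup S <= a n + e n by apply: ge_sup => //; exact: Sub.
by rewrite ler_norml; lra.
Qed.

Lemma half_pow_small (e : R) (n0 : nat) : 0 < e -> exists2 n, (n0 <= n)%N & 2 * 2^-1 ^+ n <= e.
Proof.
move=> e0; have [m _ Hm] : exists2 m : nat, true & 2 / e < m%:R.
  exists (Num.truncn (2 / e)).+1 => //; exact: truncnS_gt.
exists (n0 + m)%N; first exact: leq_addr.
have m2 : (m%:R : R) <= 2 ^+ m by rewrite -natrX ler_nat ltnW// ltn_expl.
rewrite exprD; apply: (@le_trans _ _ (2 * 2^-1 ^+ m)).
  by rewrite ler_wpM2l// ler_piMl ?exprn_ge0// exprn_ile1// invf_le1// ler1n.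
rewrite exprVn ler_pdivrMr ?exprn_gt0// mulrC -ler_pdivrMr//.
by apply: le_trans m2; exact: ltW.
Qed.

(** The geometric bounds need hold only from an index [q s] that depends on the derivative; Borel's
    construction offers no more than that. *)
Lemma smooth_series O (u : nat -> 'rV[R]_k -> R) (q : seq 'I_k -> nat) : open O ->
  (forall n, Csmooth O (u n)) ->
  (forall s n z, O z -> (q s <= n)%N -> `|pds s (u n) z| <= 2^-1 ^+ n) ->
  exists2 V, Csmooth O V & forall s z n, O z -> (q s <= n)%N ->
    `|\sum_(m < n) pds s (u m) z - pds s V z| <= 2 * 2^-1 ^+ n.
Proof.
move=> oO su bu.
have tail s z n m : O z -> (q s <= n)%N -> `|\sum_(i < n + m) pds s (u i) z - \sum_(i < n) pds s (u i) z|
    <= 2 * 2^-1 ^+ n * (1 - 2^-1 ^+ m).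
  move=> Oz qn; elim: m => [|m IH]; first by rewrite addn0 subrr normr0 expr0 subrr mulr0.
  rewrite addnS big_ord_recr /= addrAC; apply: le_trans (ler_normD _ _) _.
  apply: le_trans (lerD IH (bu s (n + m)%N z Oz (leq_trans qn (leq_addr _ _)))) _.
  rewrite le_eqVlt; apply/orP; left; apply/eqP; rewrite exprD exprS.
  by move: (2^-1 ^+ n) (2^-1 ^+ m) => a b; field.
have p0 (n : nat) : 0 <= 2^-1 ^+ n :> R by rewrite exprn_ge0// invr_ge0.
have tail' s z n m : O z -> (q s <= n)%N -> (n <= m)%N ->
    `|\sum_(i < m) pds s (u i) z - \sum_(i < n) pds s (u i) z| <= 2 * 2^-1 ^+ n.
  move=> Oz qn nm; rewrite -(subnKC nm); apply: le_trans (tail _ _ _ _ Oz qn) _.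
  by rewrite ler_piMr ?mulr_ge0// gerBl.
(* All differentiated series are summed at once, so that [W (i :: s)] is available as the derivative
   of [W s]. *)
have [W HW] : exists W : seq 'I_k -> 'rV[R]_k -> R, forall s z, O z -> forall n, (q s <= n)%N ->
    `|\sum_(m < n) pds s (u m) z - W s z| <= 2 * 2^-1 ^+ n.
  have H s z : exists l, O z -> forall n, (q s <= n)%N ->
      `|\sum_(m < n) pds s (u m) z - l| <= 2 * 2^-1 ^+ n.
    have [Oz|nO] := pselect (O z); last by exists 0.
    have cau n m : (q s <= n)%N -> (q s <= m)%N ->
        \sum_(i < n) pds s (u i) z - 2 * 2^-1 ^+ n <= \sum_(i < m) pds s (u i) z + 2 * 2^-1 ^+ m.
      move=> qn qm; have := p0 n; have := p0 m.
      have [nm|/ltnW mn] := leqP n m.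
        by have := tail' s z n m Oz qn nm; rewrite ler_norml => /andP[h1 h2]; lra.
      by have := tail' s z m n Oz qm mn; rewrite ler_norml => /andP[h1 h2]; lra.
    have [l Hl] := cauchy_limit (a := fun n => \sum_(m < n) pds s (u m) z)
      (e := fun n => 2 * 2^-1 ^+ n) cau.
    by exists l.
  have /choice[W HW] : forall sz : seq 'I_k * 'rV[R]_k, exists l, O sz.2 -> forall n, (q sz.1 <= n)%N ->
      `|\sum_(m < n) pds sz.1 (u m) sz.2 - l| <= 2 * 2^-1 ^+ n by move=> [s z]; exact: H.
  by exists (fun s z => W (s, z)) => s z; exact: (HW (s, z)).
have sp s n : Csmooth O (fun z => \sum_(m < n) pds s (u m) z).
  by apply: Csmooth_sum => // m; exact: Csmooth_pds.
have cW s z : O z -> {for z, continuous (W s)}.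
  move=> Oz; have /nbhs_ballP [r /= r0 Hr] := open_nbhs_nbhs (conj oO Oz).
  apply: (continuous_uniform_limit r0) => e e0.
  have [n qn ne] := half_pow_small (q s) e0.
  exists (fun z => \sum_(m < n) pds s (u m) z); first exact: (Csmooth_cont oO (sp s n) Oz).
  by move=> y /Hr Oy; apply: le_trans (HW s y Oy n qn) ne.
have dW s i z : O z -> is_derive z (delta_mx 0 i) (W s) (W (i :: s) z).
  move=> Oz; have /nbhs_ballP [r /= r0 Hr] := open_nbhs_nbhs (conj oO Oz).
  apply: (is_derive_uniform_limit r0) (cW _ _ Oz) => e e0.
  have [n qn ne] := half_pow_small (maxn (q s) (q (i :: s))) e0.
  move: qn; rewrite geq_max => /andP[qn1 qn2].
  exists (fun z => \sum_(m < n) pds s (u m) z), (fun z => \sum_(m < n) pds (i :: s) (u m) z).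
  move=> y /Hr Oy; split.
  - apply: isD_sum => m; exact: (Csmooth_derive i oO (Csmooth_pds s oO (su m)) Oy).
  - exact: le_trans (HW s y Oy n qn1) ne.
  - exact: le_trans (HW _ y Oy n qn2) ne.
have sW m s : Cspace m O (W s).
  elim: m s => [|m IH] s; first by apply: Cspace0 => // z; exact: cW.
  apply: CspaceS => // [z|i]; first exact: cW.
  by exists (W (i :: s)); split=> // z; exact: dW.
have WE s z : O z -> pds s (W [::]) z = W s z.
  elim: s z => [//|i s IH] z Oz /=.
  by rewrite (pd_congr i oO IH Oz); apply: pd_eq; exact: dW.
exists (W [::]) => [m|s z n Oz qn]; first exact: sW.
by rewrite WE//; exact: HW.
Qed.

End SmoothSeries.

(** * Iterated partial derivatives and weighted dilations *)

Section IteratedPartials.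
Context {R : realType} {k : nat}.
Implicit Types (f g : 'rV[R]_k -> R) (O : set 'rV[R]_k) (s : seq 'I_k).

Lemma pds_congr O f g s x : open O -> (forall y, O y -> f y = g y) -> O x ->
  pds s f x = pds s g x.
Proof.
move=> oO fg; elim: s x => [|i s IH] x Ox /=; first exact: fg.
exact: (pd_congr i oO IH Ox).
Qed.

Lemma pds_cst0 s x : pds s (fun _ : 'rV[R]_k => 0 : R) x = 0.
Proof.
elim: s x => [//|i s IH] x /=; rewrite (_ : pds s _ = fun=> 0); last exact/funext.
exact: (pd_eq (isD_cst _ _ _)).
Qed.

Lemma pds_add O f g s x : open O -> Csmooth O f -> Csmooth O g -> O x ->
  pds s (fun y => f y + g y) x = pds s f x + pds s g x.
Proof.
move=> oO sf sg; elim: s x => [//|i s IH] x Ox /=; rewrite (pd_congr i oO IH Ox).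
by apply: pd_eq; apply: isD_add; apply: (Csmooth_derive i oO _ Ox); exact: Csmooth_pds.
Qed.

Lemma pds_scal O (a : R) f s x : open O -> Csmooth O f -> O x ->
  pds s (fun y => a * f y) x = a * pds s f x.
Proof.
move=> oO sf; elim: s x => [//|i s IH] x Ox /=; rewrite (pd_congr i oO IH Ox).
by apply: pd_eq; apply: isD_scal; apply: (Csmooth_derive i oO _ Ox); exact: Csmooth_pds.
Qed.

Lemma pds_sub O f g s x : open O -> Csmooth O f -> Csmooth O g -> O x ->
  pds s (fun y => f y - g y) x = pds s f x - pds s g x.
Proof.
move=> oO sf sg Ox; have so := Csmooth_scal (-1) oO sg.
rewrite -mulN1r -(pds_scal (-1) s oO sg Ox) -(pds_add s oO sf so Ox).
by apply: (pds_congr s oO) => // y _; rewrite mulN1r.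
Qed.

Lemma pds_sum O n (f : 'I_n -> 'rV[R]_k -> R) s x : open O -> (forall a, Csmooth O (f a)) -> O x ->
  pds s (fun y => \sum_a f a y) x = \sum_a pds s (f a) x.
Proof.
move=> oO sf; elim: s x => [//|i s IH] x Ox /=; rewrite (pd_congr i oO IH Ox).
by apply: pd_eq; apply: isD_sum => a; apply: (Csmooth_derive i oO _ Ox); exact: Csmooth_pds.
Qed.

Variable wgt : 'I_k -> nat.

Definition dilation (lam : R) (z : 'rV[R]_k) : 'rV[R]_k := \row_i (lam ^+ wgt i * z 0 i).

Definition weight s : nat := (\sum_(i <- s) wgt i)%N.

Lemma pds_dilation O lam f s x : open O -> (forall z, O z -> O (dilation lam z)) -> Csmooth O f ->
  O x -> pds s (fun z => f (dilation lam z)) x = lam ^+ weight s * pds s f (dilation lam x).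
Proof.
move=> oO AO sf; elim: s x => [|i s IH] x Ox /=; first by rewrite /weight big_nil expr0 mul1r.
rewrite (pd_congr i oO IH Ox) /weight big_cons exprD; apply: pd_eq.
rewrite -mulrA mulrCA; apply: isD_scal.
apply: (@is_derive_affine R _ _ R (dilation lam) (pds s f) x _ (lam ^+ wgt i *: delta_mx 0 i)).
  move=> h; apply/rowP => j; rewrite !mxE eqxx /=.
  by case: eqP => [->|_]; rewrite ?mulr0 ?mulr1 mulrDr; ring.
apply: is_derive_scale; apply: (Csmooth_derive i oO) (AO _ Ox); exact: Csmooth_pds.
Qed.

Lemma weight_le s b : (forall i, (wgt i <= b)%N) -> (weight s <= b * size s)%N.
Proof.
move=> H; rewrite /weight; elim: s => [|i s IH]; first by rewrite big_nil.
by rewrite big_cons /= mulnS leq_add.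
Qed.

End IteratedPartials.

Lemma Tix_neq (d : nat) : (Tix == Six :> 'I_(d + 1 + 1)) = false.
Proof.
by apply/eqP => /(congr1 val) /=; lia.
Qed.

Lemma yyix_neqS (d : nat) (j : 'I_d) : (lshift 1 (yix j) == Six :> 'I_(d + 1 + 1)) = false.
Proof. by apply/eqP => /(congr1 val) /=; have := ltn_ord j; lia. Qed.

Lemma yyix_neqT (d : nat) (j : 'I_d) : (lshift 1 (yix j) == Tix :> 'I_(d + 1 + 1)) = false.
Proof. by apply/eqP => /(congr1 val) /=; have := ltn_ord j; lia. Qed.

(** * Summation of the weighted homogeneous components *)

Section Borel.
Context {R : realType} {d : nat}.
Variables (Rad r' : R) (M : nat).
Hypotheses (r'0 : 0 < r') (r'R : r' < Rad) (M2 : (2 <= M)%N).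
Notation rV3 := 'rV[R]_(d + 1 + 1).
Implicit Types (z : rV3) (s : seq 'I_(d + 1 + 1)).

Definition Yco z : 'rV[R]_d := lsubmx (lsubmx z).
Definition Tco z : R := z 0 Tix.
Definition Sco z : R := z 0 Six.

Definition cyl3 (r : R) : set rV3 := [set z | Bball r (Yco z)].

Lemma continuous_Yco : continuous Yco.
Proof. by move=> z; apply: continuous_comp; exact: continuous_lsub'. Qed.

Lemma open_cyl3 r : open (cyl3 r).
Proof. by apply: open_comp; [move=> z _; exact: continuous_Yco|exact: open_Bball]. Qed.

(** [S] has weight [M] because it stands for [t^M ln t]; [y'] is a parameter of weight zero. *)
Definition w3 (i : 'I_(d + 1 + 1)) : nat :=
  if i == Six then M else if i == Tix then 1%N else 0%N.

Notation A := (dilation w3).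

Lemma Yco_A lam z : Yco (A lam z) = Yco z.
Proof.
apply/rowP => j; rewrite /Yco !mxE /w3 (_ : lshift 1 (lshift 1 j) = lshift 1 (yix j))//.
by rewrite yyix_neqS yyix_neqT expr0 mul1r.
Qed.

Lemma Tco_A lam z : Tco (A lam z) = lam * Tco z.
Proof. by rewrite /Tco mxE /w3 Tix_neq eqxx expr1. Qed.

Lemma Sco_A lam z : Sco (A lam z) = lam ^+ M * Sco z.
Proof. by rewrite /Sco mxE /w3 eqxx. Qed.

Lemma cyl3_A r lam z : cyl3 r z -> cyl3 r (A lam z).
Proof. by rewrite /cyl3 /= Yco_A. Qed.

Lemma A_origin lam z : Tco z = 0 -> Sco z = 0 -> A lam z = z.
Proof.
move=> T0 S0; apply/rowP => i; rewrite mxE /w3.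
case: eqP => [->|_]; first by rewrite [z 0 Six]S0 mulr0.
by case: eqP => [->|_]; [rewrite [z 0 Tix]T0 mulr0|rewrite expr0 mul1r].
Qed.

Lemma w3_le i : (w3 i <= M)%N.
Proof. by rewrite /w3; case: ifP => // _; case: ifP => _ //; exact: ltnW. Qed.

Variable C : nat -> nat -> 'rV[R]_d -> R.
Hypothesis sC : forall i j, Csmooth (Bball Rad) (C i j).
Hypothesis CM : forall i j, (i < M * j)%N -> C i j = fun=> 0.

(** The component of weight [i]: on [S = t^M ln t] its terms become [c t^i ln^j t]. Truncation in
    [i - M * j] is harmless, as [CM] makes the coefficient vanish there. *)
Definition Upoly i z : R := \sum_(j < i) C i j (Yco z) * (Tco z ^+ (i - M * j) * Sco z ^+ j).

Lemma Csmooth_Yco r (c : 'rV[R]_d -> R) : Csmooth (Bball r) c -> Csmooth (cyl3 r) (fun z => c (Yco z)).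
Proof.
move=> sc; apply: (Csmooth_comp (@open_cyl3 r) (@open_Bball R d r) (F := c) (X := Yco)) => // j.
apply: Csmooth_congr (Csmooth_coord (lshift 1 (lshift 1 j)) (@open_cyl3 r)) => z _.
by rewrite /Yco !mxE.
Qed.

Lemma Csmooth_Upoly i : Csmooth (cyl3 Rad) (Upoly i).
Proof.
have oC := @open_cyl3 Rad; apply: Csmooth_sum => // j.
apply: Csmooth_mul => //; first exact: Csmooth_Yco.
by apply: Csmooth_mul => //; apply: Csmooth_exp => //; exact: Csmooth_coord.
Qed.

Lemma Upoly_A i lam z : Upoly i (A lam z) = lam ^+ i * Upoly i z.
Proof.
rewrite /Upoly mulr_sumr; apply: eq_bigr => j _; rewrite Yco_A Tco_A Sco_A.
have [Mji|/CM ->] := leqP (M * j) i; last by rewrite !mul0r mulr0.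
have -> : lam ^+ i = lam ^+ (i - M * j) * lam ^+ (M * j) by rewrite -exprD subnK.
rewrite !exprMn -exprM; ring.
Qed.

(** The dilation by [2] fixes [z], so homogeneity multiplies the derivative by [2^i] and the chain
    rule by [2^(weight s)]; the two factors differ. *)
Lemma Upoly_vanish i s z : cyl3 Rad z -> Tco z = 0 -> Sco z = 0 -> (weight w3 s < i)%N ->
  pds s (Upoly i) z = 0.
Proof.
move=> Oz T0 S0 si; have oC := @open_cyl3 Rad.
have := pds_dilation (wgt := w3) (lam := 2) s oC (@cyl3_A Rad 2) (Csmooth_Upoly i) Oz.
rewrite A_origin//.
have -> : pds s (fun z => Upoly i (A 2 z)) z = 2 ^+ i * pds s (Upoly i) z.
  rewrite -(pds_scal _ s oC (Csmooth_Upoly i) Oz).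
  by apply: (pds_congr s oC) => // y _; exact: Upoly_A.
move=> /eqP; rewrite -subr_eq0 -mulrBl mulf_eq0 => /orP[|/eqP//].
rewrite subr_eq0 -!natrX eqr_nat eqn_exp2l// => /eqP E.
by move: si; rewrite E ltnn.
Qed.

Definition Wcut i z : R := Upoly i z * (bump (Tco z) * bump (Sco z)).

Lemma Csmooth_Wcut i : Csmooth (cyl3 Rad) (Wcut i).
Proof.
have oC := @open_cyl3 Rad; apply: Csmooth_mul => //; first exact: Csmooth_Upoly.
by apply: Csmooth_mul => //; apply: Csmooth_bump => //; exact: Csmooth_coord.
Qed.

(** The cutoffs confine [T] and [S] to a compact box, outside of which the function is locally zero;
    [r' < Rad] gives compactness in [y']. *)
Lemma Wcut_bounded i s : exists2 K, 0 <= K & forall z, cyl3 r' z -> `|pds s (Wcut i) z| <= K.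
Proof.
have oC := @open_cyl3 Rad.
pose D := [set z : rV3 | enorm (Yco z) <= r' /\ (`|Tco z| <= 2 /\ `|Sco z| <= 2)].
have cN (i0 : 'I_(d + 1 + 1)) : closed [set z : rV3 | `|z 0 i0| <= 2].
  rewrite (_ : [set _ | _] = (fun z : rV3 => `|z 0 i0|) @^-1` [set x | x <= 2])//.
  apply: preimage_closed; last exact: closed_le.
  move=> z _; apply: (@continuous_comp _ _ _ (fun z : rV3 => z 0 i0) Num.norm).
    exact: coord_continuous.
  exact: norm_continuous.
have cD : compact D.
  apply: bounded_closed_compact.
    exists (r' + 2); split; first exact: num_real.
    move=> c rc z [h1 [h2 h3]].
    have rc2 : r' + 2 <= c := ltW rc.
    apply: (norm_rowP _ _).2 => [|b]; first by apply: le_trans rc2; rewrite addr_ge0// ltW.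
    apply: le_trans rc2; case: (split_ordP b) => b' ->; last first.
      rewrite (ord1 b') -/(Six) -[z 0 _]/(Sco z).
      by apply: le_trans h3 _; rewrite lerDr ltW.
    case: (tix_or_yix b') => [->|[j ->]].
      by rewrite -[z 0 _]/(Tco z); apply: le_trans h2 _; rewrite lerDr ltW.
    have := coord_le_enorm (Yco z) j; rewrite /Yco !mxE => /le_trans; apply.
    by apply: le_trans h1 _; rewrite lerDl.
  rewrite (_ : D = (fun z => enorm (Yco z)) @^-1` [set x | x <= r'] `&`
    ([set z : rV3 | `|z 0 Tix| <= 2] `&` [set z : rV3 | `|z 0 Six| <= 2]))//.
  apply: closedI; last by apply: closedI; exact: cN.
  apply: preimage_closed; last exact: closed_le.
  by move=> z _; apply: continuous_comp; [exact: continuous_Yco|exact: continuous_enorm].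
have DO z : D z -> cyl3 Rad z by case=> h1 _; exact: le_lt_trans h1 r'R.
have D0 : D !=set0.
  exists 0; rewrite /D /= /Tco /Sco !mxE normr0; split; last by split.
  rewrite /enorm (eq_bigr (fun=> 0)) ?big1 ?sqrtr0 ?ltW// => i0 _.
  by rewrite !mxE expr0n.
have sw := Csmooth_pds s oC (Csmooth_Wcut i).
have cc : {within D, continuous (fun z => `|pds s (Wcut i) z|)}.
  apply: continuous_in_subspaceT => z; rewrite inE => /DO Oz.
  apply: (@continuous_comp _ _ _ (pds s (Wcut i)) Num.norm); last exact: norm_continuous.
  exact: (Csmooth_cont oC sw Oz).
have [z _ Hz] := EVT_max_rV D0 cD cc.
exists `|pds s (Wcut i) z| => // y yr.
have [yD|yD] := pselect (D y); first by apply: Hz; rewrite inE.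
suff -> : pds s (Wcut i) y = 0 by rewrite normr0.
have Wz (E : set rV3) : open E -> E y -> (forall x, E x -> Wcut i x = 0) -> pds s (Wcut i) y = 0.
  by move=> oE Ey H; rewrite (pds_congr s oE H Ey) pds_cst0.
have oN (i0 : 'I_(d + 1 + 1)) : open [set z : rV3 | 2 < `|z 0 i0|].
  rewrite (_ : [set _ | _] = ~` [set z : rV3 | `|z 0 i0| <= 2]).
    by apply: closed_openC; exact: cN.
  by apply/seteqP; split => x /=; rewrite ltNge => /negP.
have [T2|T2] := leP `|Tco y| 2; last first.
  apply: (Wz _ (oN Tix)) => // x /= xT.
  by rewrite /Wcut (bump0 (x := Tco x)) ?mul0r ?mulr0// ltW.
have [S2|S2] := leP `|Sco y| 2; last first.
  apply: (Wz _ (oN Six)) => // x /= xT.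
  by rewrite /Wcut (bump0 (x := Sco x)) ?mulr0// ltW.
by case: yD; split=> //; exact: ltW.
Qed.

Lemma Wcut_bounded_size i (n : nat) : exists2 K, 0 <= K &
  forall s z, (size s < n)%N -> cyl3 r' z -> `|pds s (Wcut i) z| <= K.
Proof.
have /choice[K HK] : forall s, exists K, 0 <= K /\ forall z, cyl3 r' z -> `|pds s (Wcut i) z| <= K.
  by move=> s; have [K K0 HK] := Wcut_bounded i s; exists K.
have K0 s : 0 <= K s by case: (HK s).
have K1 (m : nat) : 0 <= \sum_(t : m.-tuple 'I_(d + 1 + 1)) K t by apply: sumr_ge0.
exists (\sum_(m < n) \sum_(t : m.-tuple 'I_(d + 1 + 1)) K t); first exact: sumr_ge0.
move=> s z sn /((HK s).2 z) /le_trans; apply.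
rewrite (bigD1 (Ordinal sn))//= -[leLHS]addr0; apply: lerD; last first.
  by apply: sumr_ge0 => m _; exact: K1.
by rewrite (bigD1 (in_tuple s))//= lerDl; apply: sumr_ge0.
Qed.

(** The term [lam^-i * Wcut i (A lam z)] agrees with [Upoly i] near [T = S = 0] whatever [lam] is. A
    derivative of weight [w < i] scales like [lam^(w-i)], so large [lam] makes the series converge
    with all derivatives. *)
Lemma borel : exists2 V : rV3 -> R, Csmooth (cyl3 r') V & forall N s z, cyl3 r' z ->
  Tco z = 0 -> Sco z = 0 -> (M * size s < N)%N ->
  pds s (fun z => V z - \sum_(i < N) Upoly i z) z = 0.
Proof.
have oC := @open_cyl3 Rad; have oC' := @open_cyl3 r'.
have CC : cyl3 r' `<=` cyl3 Rad by move=> z /lt_trans; apply.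
have /choice[lam Hlam] : forall i, exists lam : R, 1 <= lam /\
    forall s z, (size s < i)%N -> cyl3 r' z -> lam^-1 * `|pds s (Wcut i) z| <= 2^-1 ^+ i.
  move=> i; have [K K0 HK] := Wcut_bounded_size i i.
  have KK : 0 <= 2 ^+ i * K by rewrite mulr_ge0// exprn_ge0.
  (* With [K] bounding the derivatives of length below [i], this yields [K / lam <= 2^-i] and also
     [lam >= 1]. *)
  exists (1 + 2 ^+ i * K); split; first by rewrite lerDl.
  move=> s z si zr; rewrite mulrC ler_pdivrMr ?ltr_pwDl// exprVn mulrDr mulr1.
  rewrite mulKf ?expf_neq0 ?pnatr_eq0//.
  by apply: le_trans (HK s z si zr) _; rewrite lerDr invr_ge0 exprn_ge0.
have l1 i : 1 <= lam i by case: (Hlam i).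
have l0 i : 0 < lam i by exact: lt_le_trans ltr01 (l1 i).
pose u i z := lam i ^- i * Wcut i (A (lam i) z).
have sWA i : Csmooth (cyl3 Rad) (fun z => Wcut i (A (lam i) z)).
  apply: (Csmooth_comp oC oC (F := Wcut i) (X := A (lam i))) => //.
  - by move=> z; exact: cyl3_A.
  - exact: Csmooth_Wcut.
  - move=> j; apply: Csmooth_congr (Csmooth_scal (lam i ^+ w3 j) oC (Csmooth_coord j oC)) => z _.
    by rewrite mxE.
have su i : Csmooth (cyl3 Rad) (u i) by exact: Csmooth_scal.
have puE i s z : cyl3 Rad z -> pds s (u i) z =
    lam i ^- i * (lam i ^+ weight w3 s * pds s (Wcut i) (A (lam i) z)).
  move=> Oz; rewrite (pds_scal _ s oC (sWA i) Oz).
  by rewrite (pds_dilation s oC (@cyl3_A Rad (lam i)) (Csmooth_Wcut i) Oz).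
have bu s n z : cyl3 r' z -> ((M * size s).+1 <= n)%N -> `|pds s (u n) z| <= 2^-1 ^+ n.
  move=> zr sn; rewrite puE; last exact: CC.
  have sn' : (size s < n)%N by apply: leq_trans sn; rewrite ltnS leq_pmull// ltnW.
  apply: le_trans ((Hlam n).2 s _ sn' (cyl3_A (lam n) zr)).
  rewrite mulrA normrM ler_wpM2r//.
  have wn : (weight w3 s < n)%N by apply: leq_ltn_trans (weight_le s w3_le) sn.
  rewrite ger0_norm; last by rewrite mulr_ge0 ?invr_ge0 ?exprn_ge0// ltW.
  rewrite mulrC ler_pdivrMr ?exprn_gt0// -(prednK (leq_ltn_trans (leq0n _) wn)) exprS mulKf ?gt_eqF//.
  by apply: ler_weXn2l => //; rewrite -ltnS prednK// (leq_ltn_trans _ wn).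
have su' i : Csmooth (cyl3 r') (u i) by exact: Csmooth_sub CC _.
have [V sV HV] := smooth_series (q := fun s => (M * size s).+1) oC' su' bu.
exists V => // N s z zr T0 S0 sN.
have sU i : Csmooth (cyl3 r') (Upoly i) by apply: Csmooth_sub CC _; exact: Csmooth_Upoly.
have zR := CC _ zr.
(* Both cutoffs equal [1] in a neighbourhood of [z], and homogeneity cancels [lam]. *)
have uU i : pds s (u i) z = pds s (Upoly i) z.
  pose E := [set x : rV3 | `|lam i * Tco x| < 1 /\ `|lam i ^+ M * Sco x| < 1].
  have oE : open E.
    have oN (a : R) (i0 : 'I_(d + 1 + 1)) : open [set z : rV3 | `|a * z 0 i0| < 1].
      rewrite (_ : [set _ | _] = (fun z : rV3 => `|a * z 0 i0|) @^-1` [set x | x < 1])//.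
      apply: open_comp; last exact: open_lt.
      move=> x _; have sx := Csmooth_scal a openT (Csmooth_coord i0 openT).
      apply: (@continuous_comp _ _ _ (fun z : rV3 => a * z 0 i0) Num.norm).
        exact: (Csmooth_cont openT sx).
      exact: norm_continuous.
    by apply: openI; exact: oN.
  apply: (pds_congr s oE); last by rewrite /E /= T0 S0 !mulr0 normr0.
  move=> x [h1 h2]; rewrite /u /Wcut Upoly_A Tco_A Sco_A !bump1 ?(ltW h1) ?(ltW h2)//.
  by rewrite !mulr1 mulKf// expf_neq0// gt_eqF.
have pS : pds s (fun z => V z - \sum_(i < N) Upoly i z) z = pds s V z - \sum_(i < N) pds s (u i) z.
  have sS : Csmooth (cyl3 r') (fun z => \sum_(i < N) Upoly i z) by exact: Csmooth_sum.
  rewrite (pds_sub s oC' sV sS zr).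
  rewrite (pds_sum s oC' (fun i : 'I_N => sU i) zr); congr (_ - _).
  by apply: eq_bigr => i _; rewrite uU.
rewrite pS; apply/eqP; rewrite -normr_le0.
apply/ler_addgt0Pr => e e0; rewrite add0r.
(* Terms with index at least [N] contribute nothing at [z] by homogeneity, so the partial sum up to
   [n] is the one up to [N]. *)
have [n Nn ne] := half_pow_small N e0.
apply: le_trans ne; apply: le_trans (HV s z n zr (leq_trans sN Nn)).
rewrite distrC le_eqVlt; apply/orP; left; apply/eqP; congr `|_ - _|.
rewrite (big_ord_widen n (fun i => pds s (u i) z))// big_mkcond /=; apply: eq_bigr => i _.
case: ltnP => // Ni; rewrite uU Upoly_vanish//.
by apply: leq_ltn_trans (weight_le s w3_le) _; exact: leq_trans sN Ni.
Qed.

End Borel.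

Lemma pt_tixE (R : realType) d (x : 'rV[R]_d) t : pt x t 0 tix = t.
Proof. exact: tco_pt. Qed.

Lemma pt_yixE (R : realType) d (x : 'rV[R]_d) t j : pt x t 0 (yix j) = x 0 j.
Proof. by rewrite /pt /yix row_mxEl. Qed.

Lemma continuous_leP (R : realType) (V : normedModType R) (f : V -> R) x :
  {for x, continuous f} <-> forall e, 0 < e -> \forall z \near x, `|f x - f z| <= e.
Proof. by split=> [/cvgrPdist_le|H]; [|apply/cvgrPdist_le]. Qed.

Lemma near_eq_continuous (R : realType) (V : normedModType R) (f g : V -> R) x :
  (\near x, f x = g x) -> {for x, continuous f} -> {for x, continuous g}.
Proof.
move=> fg cf; have gx : f x = g x by exact: (nbhs_singleton fg).
apply/cvgrPdist_le => e e0; have /cvgrPdist_le/(_ _ e0) H := cf.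
by apply: filterS (filterI fg H) => z [E h]; rewrite -gx -E.
Qed.

(** * Remainders along a curve, and flat extension across [t = 0] *)

Section TailsAndFlatFunctions.
Context {R : realType} {d : nat}.
Variables (r0 : R).
Hypothesis r00 : 0 < r0.
Implicit Types (y : 'rV[R]_(d + 1)) (f g phi : 'rV[R]_(d + 1) -> R).

Notation G := (@Gcyl R d r0).
Let oG : open G := @open_Gcyl R d r0.

Definition curve phi y : 'rV[R]_(d + 1 + 1) := row_mx y (phi y)%:M.

Lemma Yco_curve phi y : Yco (curve phi y) = lsubmx y.
Proof. by rewrite /Yco /curve row_mxKl. Qed.

Lemma Tco_curve phi y : Tco (curve phi y) = tco y.
Proof. by rewrite /Tco /Tix /curve row_mxEl. Qed.

Lemma Sco_curve phi y : Sco (curve phi y) = phi y.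
Proof. by rewrite /Sco /Six /curve row_mxEr mxE eqxx mulr1n. Qed.

Lemma curve_ind (A : ('rV[R]_(d + 1) -> R) -> Prop) phi : A (@tco R d) ->
  (forall c, Csmooth (@Bball R d r0) c -> A (fun y => c (lsubmx y))) -> A phi ->
  forall b, A (fun y => curve phi y 0 b).
Proof.
move=> A1 A2 A3; apply: mxcomp_row; first exact: base_args_ind A1 A2.
exact: mxcomp_scalar.
Qed.

Lemma bound_curve (H : 'rV[R]_(d + 1 + 1) -> R) phi : Csmooth (cyl3 r0) H -> Oc r0 1 phi ->
  bound r0 0 (fun y => H (curve phi y)).
Proof.
move=> sH hphi; have oC := @open_cyl3 R d r0.
apply: (bound_comp (D := cyl3 r0) (g := H)); first exact: Cspace_cont (sH 0%N).
  move=> b; apply: Oc_bound; move: b; apply: curve_ind.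
  - by apply: Oc_le (Oc_tco r0); exact: ler01.
  - by move=> c; exact: Oc_lsub.
  - by apply: Oc_le hphi; exact: ler01.
move=> r /andP[_ rr]; exists [set z | enorm (Yco z) <= r]; split.
- rewrite (_ : [set _ | _] = (fun z : 'rV[R]_(d + 1 + 1) => enorm (Yco z)) @^-1` [set x | x <= r])//.
  apply: preimage_closed; last exact: closed_le.
  by move=> z _; apply: continuous_comp; [exact: continuous_Yco|exact: continuous_enorm].
- by move=> z /= zr; exact: le_lt_trans rr.
- by move=> y [yr _]; rewrite /= Yco_curve ltW.
Qed.

(* A function of [(y', t, s)] vanishing to order [N] on [t = s = 0] is
   [O(t^N)] along [s = phi = O(t)]: its derivatives are [O(t^(N-1))] by
   induction, hence so is [t d/dt] of it up to a factor [O(t)]. *)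
Lemma Oc_tail (H : 'rV[R]_(d + 1 + 1) -> R) phi (N : nat) : Csmooth (cyl3 r0) H -> Oc r0 1 phi ->
  (forall s z, cyl3 r0 z -> Tco z = 0 -> Sco z = 0 -> (size s < N)%N -> pds s H z = 0) ->
  Oc r0 N%:R (fun y => H (curve phi y)).
Proof.
move=> sH hphi; have oC := @open_cyl3 R d r0.
have XO y : G y -> cyl3 r0 (curve phi y) by move=> [yr _]; rewrite /cyl3 /= Yco_curve.
have hX : forall b, Oc r0 0 (fun y => curve phi y 0 b).
  apply: curve_ind; first by apply: Oc_le (Oc_tco r0); exact: ler01.
    by move=> c; exact: Oc_lsub.
  by apply: Oc_le hphi; exact: ler01.
have hZ : forall b, Oc r0 1 (Z tix (fun y => curve phi y 0 b)).
  apply: (curve_ind (A := fun f => Oc r0 1 (Z tix f))); first by apply: Oc_Z; exact: Oc_tco.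
    move=> c sc; apply: (Oc_congr (f := fun=> 0)); last exact: Oc_zero.
    by move=> y _; rewrite Z_clsub.
  exact: Oc_Z.
have sX b : Csmooth G (fun y => curve phi y 0 b) by exact: Oc_smooth (hX b).
elim: N H sH => [|N IH] H sH H0.
  apply: (Oc_comp oC XO sH) => // s; apply: bound_curve => //.
  exact: Csmooth_pds.
have hZH : Oc r0 N.+1%:R (euler 0 (fun y => H (curve phi y))).
  apply: Oc_euler0; apply: (Oc_congr (f := fun y => \sum_b pd b H (curve phi y) *
      Z tix (fun y => curve phi y 0 b) y)).
    by move=> y Gy; rewrite (Zt_comp oC XO sH sX Gy).
  apply: Oc_sum => b _; rewrite -natr1; apply: Oc_mul => //.
  apply: IH; first exact: Csmooth_pd.
  move=> s z Oz T0 S0 sN; have := H0 (rcons s b) z Oz T0 S0.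
  by rewrite size_rcons ltnS /pds foldr_rcons; apply.
have N0 : (0 : R) < N.+1%:R by rewrite ltr0n.
have [c sc hc] := Oc_euler_gt r00 N0 (Csmooth_comp oG oC XO sH sX) hZH.
(* The integration constant is the limit of [H] along the curve, that is its value at [(x, 0, 0)],
   where [H] vanishes. *)
suff c0 x : Bball r0 x -> c x = 0.
  apply: Oc_congr hc => y [xR _]; rewrite c0//; ring.
move=> xR; have [r rR xr] := Bball_exists r00 xR.
have rp : 0 < r by case/andP: rR.
have [K K0 HK] := bound_ge0 (Oc_bound hc) rR.
have [K' K'0 HK'] := bound_ge0 (Oc_bound hphi) rR.
pose z0 := curve (fun=> 0) (pt x 0 : 'rV[R]_(d + 1)).
have Oz0 : cyl3 r0 z0 by rewrite /cyl3 /= Yco_curve lsub_pt.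
have Hz0 : H z0 = 0.
  by apply: (H0 [::]) => //; rewrite ?Tco_curve ?tco_pt ?Sco_curve.
apply/eqP; rewrite -normr_le0; apply/ler_addgt0Pr => e e0; rewrite add0r.
have := Csmooth_cont oC sH Oz0; move=> /cvgrPdist_le/(_ _ e0)/nbhs_ballP [dl /= dl0 Hdl].
rewrite -subr_le0.
have q0 : 0 < Num.min r (dl / (K' + 2)).
  by rewrite lt_min rp divr_gt0// ltr_pwDr.
apply: (le0_of_powR (C := K) N0 q0) => t; rewrite lt_min => /and3P[t0 tr td].
have Gx : Gcyl r (pt x t) by apply/Gcyl_pt; rewrite t0.
have := HK _ Gx; rewrite lsub_pt tco_pt powRr0 mulr1 => h1.
have h2 : `|H (curve phi (pt x t))| <= e.
  have := Hdl (curve phi (pt x t)); rewrite Hz0 sub0r normrN; apply.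
  have tK : t * (K' + 2) < dl by rewrite -ltr_pdivlMr// ltr_pwDr.
  have tK1 : t < dl by nra.
  have tK2 : K' * t < dl by nra.
  split=> // i b; rewrite (ord1 i) -ball_normE /=.
  rewrite distrC /z0 /curve; case: (split_ordP b) => b' ->; rewrite ?row_mxEl ?row_mxEr.
    case: (tix_or_yix b') => [->|[l ->]]; rewrite ?pt_tixE ?pt_yixE ?subrr ?normr0//.
    by rewrite subr0 ger0_norm// ltW.
  rewrite (ord1 b') !mxE eqxx !mulr1n subr0; apply: le_lt_trans (HK' _ Gx) _.
  by rewrite tco_pt powRr1// ltW.
rewrite lerBlDr; have -> : c x = H (curve phi (pt x t)) - (H (curve phi (pt x t)) - c x) by ring.
by apply: le_trans (ler_normB _ _) _; rewrite addrC lerD.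
Qed.

Definition ext0 f y : R := if 0 < tco y then f y else 0.

(** An open set containing the closed smaller cylinders: smoothness up to [t = 0] becomes ordinary
    smoothness here. *)
Definition half_cyl : set 'rV[R]_(d + 1) := [set y | Bball r0 (lsubmx y) /\ tco y < r0].

Lemma open_half_cyl : open half_cyl.
Proof.
rewrite (_ : half_cyl = (@lsubmx R 1 d 1 @^-1` Bball r0) `&` (@tco R d @^-1` [set x | x < r0]))//.
apply: openI; first by apply: open_comp; [move=> x _; exact: continuous_lsub|exact: open_Bball].
by apply: open_comp; [move=> x _; exact: continuous_tco|exact: open_lt].
Qed.

Lemma half_cyl_gt0 y : half_cyl y -> 0 < tco y -> G y.
Proof. by move=> [h1 h2] h3; split=> //; rewrite h3. Qed.

(** A division by [t] costs one order out of infinitely many, so every partial derivative is again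
    flat. At [t = 0] the bound by [t] gives continuity and the bound by [t^2] a zero derivative. *)
Lemma Csmooth_ext0 f : (forall n : nat, Oc r0 n%:R f) -> Csmooth half_cyl (ext0 f).
Proof.
move=> hf; have oH := open_half_cyl.
have hs s : forall n : nat, Oc r0 n%:R (pds s f).
  elim: s => [|i s IH] //= n; case: (tix_or_yix i) => [->|[j ->]].
    have := Oc_div (Oc_Z tix (IH n.+1)); rewrite -natr1 addrK.
    by apply: Oc_congr => y Gy; exact: (@pd_tE _ _ r0).
  by apply: Oc_congr (Oc_Z (yix j) (IH n)) => y _; rewrite Z_yE.
have op : open [set y : 'rV[R]_(d + 1) | 0 < tco y].
  rewrite (_ : [set _ | _] = @tco R d @^-1` [set x | 0 < x])//.
  by apply: open_comp; [move=> x _; exact: continuous_tco|exact: open_gt].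
have on : open [set y : 'rV[R]_(d + 1) | tco y < 0].
  rewrite (_ : [set _ | _] = @tco R d @^-1` [set x | x < 0])//.
  by apply: open_comp; [move=> x _; exact: continuous_tco|exact: open_lt].
have Ep s y : 0 < tco y -> \near y, pds s f y = ext0 (pds s f) y.
  move=> y0; apply: filterS (open_nbhs_nbhs (conj op y0)) => z /= z0.
  by rewrite /ext0 z0.
have En s y : tco y < 0 -> \near y, (fun _ : 'rV[R]_(d + 1) => 0 : R) y = ext0 (pds s f) y.
  move=> y0; apply: filterS (open_nbhs_nbhs (conj on y0)) => z /= z0.
  by rewrite /ext0 ltNge ltW.
have B0 s y : half_cyl y -> tco y = 0 -> forall n : nat, exists r C, [/\ 0 < r < r0, Bball r (lsubmx y), 0 <= C &
   forall z, Bball r (lsubmx z) -> `|tco z| < r -> `|ext0 (pds s f) z| <= C * `|tco z| ^+ n].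
  move=> [yr _] y0 n; have [r rR xr] := Bball_exists r00 yr.
  have [C C0 HC] := bound_ge0 (Oc_bound (hs s n)) rR.
  exists r, C; split=> // z zr tz; rewrite /ext0; case: ifP => [z0|_]; last first.
    by rewrite normr0 mulr_ge0// exprn_ge0.
  rewrite (ger0_norm (ltW z0)) in tz *; rewrite -(powR_mulrn _ (ltW z0)); apply: HC.
  by split=> //; rewrite z0.
have cW s y : half_cyl y -> {for y, continuous (ext0 (pds s f))}.
  move=> Hy; have [y0|y0|y0] := ltrgt0P (tco y).
  - have Gy := half_cyl_gt0 Hy y0.
    exact: near_eq_continuous (Ep s y y0) (Csmooth_cont oG (Oc_smooth (hs s 0%N)) Gy).
  - exact: near_eq_continuous (En s y y0) (@cst_continuous _ _ (0 : R) y).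
  - have [r [C [/andP[rp _] xr C0 HC]]] := B0 s y Hy y0 1%N.
    apply/continuous_leP => e e0.
    have E0 : ext0 (pds s f) y = 0 by rewrite /ext0 y0 ltxx.
    have n1 : \forall z \near y, Bball r (lsubmx z).
      have oB : open (@lsubmx R 1 d 1 @^-1` Bball r).
        by apply: open_comp; [move=> x _; exact: continuous_lsub|exact: open_Bball].
      exact: (open_nbhs_nbhs (conj oB xr)).
    have n2 (e' : R) : 0 < e' -> \forall z \near y, `|tco z| <= e'.
      move=> e'0; have := (continuous_leP _ _).1 (@continuous_tco R d y) _ e'0.
      by apply: filterS => z; rewrite y0 sub0r normrN.
    have C1 : 0 < C + 1 by rewrite ltr_wpDl.
    have rp2 : 0 < r / 2 by rewrite divr_gt0.
    have n3 := n2 _ rp2; have n4 := n2 _ (divr_gt0 e0 C1).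
    apply: filterS (filterI n1 (filterI n3 n4)) => z [h1 [h2 h3]].
    have {}h2 : `|tco z| < r by apply: le_lt_trans h2 _; rewrite ltr_pdivrMr// ltr_pMr// ltr1n.
    rewrite E0 sub0r normrN; apply: le_trans (HC z h1 h2) _; rewrite expr1.
    rewrite ler_pdivlMr// in h3; apply: le_trans h3.
    by rewrite mulrC ler_wpM2l// lerDl.
have dW s i y : half_cyl y -> is_derive y (delta_mx 0 i) (ext0 (pds s f)) (ext0 (pds (i :: s) f) y).
  move=> Hy; have [y0|y0|y0] := ltrgt0P (tco y).
  - have Gy := half_cyl_gt0 Hy y0; apply: near_eq_is_derive (Ep s y y0) _.
    rewrite /ext0 y0; exact: (Csmooth_derive i oG (Oc_smooth (hs s 0%N)) Gy).
  - apply: near_eq_is_derive (En s y y0) _; rewrite /ext0 ltNge (ltW y0) /=.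
    exact: isD_cst.
  - have [r [C [/andP[rp _] xr C0 HC]]] := B0 s y Hy y0 2%N.
    rewrite {2}/ext0 y0 ltxx; apply: (is_derive_flat (C := C) rp); first by rewrite /ext0 y0 ltxx.
    move=> h hr; case: (tix_or_yix i) => [->|[j ->]].
      have e1 : tco (h *: delta_mx 0 tix + y) = h by rewrite -(pt_eta y) pt_add_t tco_pt y0 add0r.
      have := HC (h *: delta_mx 0 tix + y); rewrite e1 lsub_add_t => /(_ xr hr).
      by rewrite real_normK ?num_real.
    have -> : ext0 (pds s f) (h *: delta_mx 0 (yix j) + y) = 0.
      by rewrite /ext0 -(pt_eta y) pt_add_y tco_pt y0 ltxx.
    by rewrite normr0 mulr_ge0// sqr_ge0.
have S m s : Cspace m half_cyl (ext0 (pds s f)).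
  elim: m s => [|m IH] s; first by apply: Cspace0 => // y; exact: cW.
  apply: CspaceS => // [y|i]; first exact: cW.
  by exists (ext0 (pds (i :: s) f)); split=> // y; exact: dW.
by move=> m; exact: (S m [::]).
Qed.

End TailsAndFlatFunctions.

(** * Regularity from expansions of every order *)

Section Assembly.
Context {R : realType} {d : nat}.
Variables (Rad r' : R) (M : nat).
Hypotheses (r'0 : 0 < r') (r'R : r' < Rad) (M2 : (2 <= M)%N).
Variable C : nat -> nat -> 'rV[R]_d -> R.
Hypothesis sC : forall i j, Csmooth (Bball Rad) (C i j).
Hypothesis CM : forall i j, ~ (M * j + 1 <= i)%N -> C i j = fun=> 0.
Variable v : 'rV[R]_(d + 1) -> R.
Hypothesis hvC : forall N, Oc Rad (N%:R - 2^-1) (fun y => v y - msum N C y).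

Let CM' i j : (i < M * j)%N -> C i j = fun=> 0.
Proof. by move=> h; apply: CM; lia. Qed.

(** The curve [phi] is left open so that the same [V0] serves for [t^M ln t] and, in the absence of
    logarithms, for [0]. *)
Lemma Csmooth_decomposition : exists V0 : 'rV[R]_(d + 1 + 1) -> R,
  [/\ Csmooth (cyl3 r') V0, forall z, cyl3 r' z -> Tco z = 0 -> Sco z = 0 -> V0 z = 0 &
   forall phi, Oc r' 1 phi ->
    (forall i y, Gcyl r' y -> Upoly M C i (curve phi y) = \sum_(j < i) C i j (lsubmx y) * mon i j y) ->
    Csmooth (half_cyl r') (ext0 (fun y => v y - V0 (curve phi y)))].
Proof.
have oC := @open_cyl3 R d r'.
have [V0 sV HV] := borel r'0 r'R M2 sC CM'.
exists V0; split=> // [z Oz T0 S0|phi hphi HU].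
  have := HV 1%N [::] z Oz T0 S0; rewrite muln0 => /(_ isT) /=.
  by rewrite big_ord1 /Upoly big_ord0 subr0.
apply: Csmooth_ext0 => // k.
(* Derivatives of length at most [k] have weight at most [M * k], so [V0] minus the first [N]
   components vanishes to order [k]; moreover [N - 1/2 >= k]. *)
pose N := (M * k).+1.
have sU i : Csmooth (cyl3 r') (Upoly M C i).
  by apply: Csmooth_sub (Csmooth_Upoly _ sC i) => z /lt_trans; apply.
have sS : Csmooth (cyl3 r') (fun z => \sum_(i < N) Upoly M C i z) by exact: Csmooth_sum.
have hT : Oc r' k%:R (fun y => V0 (curve phi y) - \sum_(i < N) Upoly M C i (curve phi y)).
  apply: (Oc_tail r'0 (H := fun z => V0 z - \sum_(i < N) Upoly M C i z)) hphi _.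
    exact: Csmooth_sub'.
  by move=> s z Oz T0 S0 sk; apply: HV => //; rewrite /N ltnS leq_mul2l ltnW ?orbT.
have hv' : Oc r' k%:R (fun y => v y - msum N C y).
  apply: Oc_restrict (ltW r'R) _; apply: Oc_le (hvC N).
  rewrite /N -natr1 natrM; have k0 : 0 <= k%:R :> R by rewrite ler0n.
  have M1 : 1 <= M%:R :> R by rewrite ler1n ltnW.
  have h2 : 2^-1 <= 1 :> R by rewrite invf_le1// ler1n.
  by move: (2^-1) h2 => h h2; nra.
apply: Oc_congr (Oc_sub hv' hT) => y Gy.
suff -> : \sum_(i < N) Upoly M C i (curve phi y) = msum N C y by ring.
rewrite /msum; apply: eq_bigr => i _; rewrite HU//.
rewrite (big_ord_widen N (fun j => C i j (lsubmx y) * mon i j y)); last exact: ltnW.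
rewrite big_mkcond /=; apply: eq_bigr => j _; case: ltnP => // ij.
by rewrite CM ?mul0r//; nia.
Qed.

Lemma closure_Gcyl r y : closure (@Gcyl R d r) y -> enorm (lsubmx y) <= r /\ 0 <= tco y <= r.
Proof.
pose D := [set y : 'rV[R]_(d + 1) | enorm (lsubmx y) <= r /\ 0 <= tco y <= r].
have cD : closed D.
  rewrite (_ : D = ((fun z : 'rV[R]_(d + 1) => enorm (lsubmx z)) @^-1` [set x | x <= r]) `&`
   ((@tco R d @^-1` [set x | 0 <= x]) `&` (@tco R d @^-1` [set x | x <= r]))); last first.
    by apply/seteqP; split => [z [h1 /andP[]]|z [h1 [h2 h3]]]; split=> //; apply/andP.
  apply: closedI.
    apply: preimage_closed; last exact: closed_le.
    by move=> z _; apply: continuous_comp; [exact: continuous_lsub|exact: continuous_enorm].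
  by apply: closedI; apply: preimage_closed; try (by move=> z _; exact: continuous_tco);
    [exact: closed_ge|exact: closed_le].
have GD : Gcyl r `<=` D by move=> z [h1 /andP[h2 h3]]; split; [exact: ltW|rewrite !ltW].
by move=> /(closureS GD); rewrite -(closure_id D).1.
Qed.

(** Conormal bounds say nothing at [t = 0] itself; continuity up to the boundary transfers
    [v = O(t^2)] to the face. *)
Lemma boundary_value r y : 0 < r < Rad -> {within closure (@Gcyl R d Rad), continuous v} ->
  Oc Rad 2 v -> closure (Gcyl r) y -> tco y = 0 -> v y = 0.
Proof.
move=> /andP[r0 rR] cv hv cy y0; have [xr _] := closure_Gcyl cy.
pose r1 := (r + Rad) / 2.
have rr1 : r < r1 by rewrite midf_lt.
have r1R : 0 < r1 < Rad by rewrite (lt_trans r0 rr1) midf_lt.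
have [K K0 HK] := bound_ge0 (Oc_bound hv) r1R.
have yE : y = pt (lsubmx y) 0 by rewrite -{1}(pt_eta y) y0.
have Gt t : 0 < t < r1 -> Gcyl r1 (pt (lsubmx y) t).
  by move=> t01; apply/Gcyl_pt; split=> //; exact: le_lt_trans rr1.
have cyR : closure (@Gcyl R d Rad) y by apply: closureS cy; apply: Gcyl_le; exact: ltW.
apply/eqP; rewrite -normr_le0; apply/ler_addgt0Pr => e e0; rewrite add0r.
have /subspace_continuousP/(_ _ cyR)/cvgrPdist_le/(_ _ e0) := cv.
rewrite /prop_near1 /within /= => /nbhs_ballP [dl /= dl0 Hdl].
rewrite -subr_le0; have q0 : 0 < Num.min r1 dl by rewrite lt_min dl0 andbT; case/andP: r1R.
apply: (le0_of_powR (C := K) (e := 2) _ q0) => // t; rewrite lt_min => /and3P[t0 tr td].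
have Gx := Gt t; rewrite t0 tr in Gx; move: (Gx isT) => {}Gx.
have h1 : `|v y - v (pt (lsubmx y) t)| <= e.
  apply: Hdl; last by apply: subset_closure; exact: (G_r r1R Gx).
  rewrite {1}yE; split=> // i b; rewrite (ord1 i) -ball_normE /=.
  case: (tix_or_yix b) => [->|[l ->]].
    by rewrite !pt_tixE sub0r normrN ger0_norm// ltW.
  by rewrite !pt_yixE subrr normr0.
have := HK _ Gx; rewrite tco_pt => h2.
rewrite lerBlDr -[v y](subrK (v (pt (lsubmx y) t))) addrC.
by apply: le_trans (ler_normD _ _) _; rewrite lerD.
Qed.

Lemma half_cyl_closure r y : 0 < r < r' -> closure (@Gcyl R d r) y -> half_cyl r' y.
Proof.
move=> /andP[_ rr'] /closure_Gcyl [h1 /andP[_ h2]]; split; exact: le_lt_trans rr'.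
Qed.

End Assembly.

(** * One-sided Taylor expansion of a representative at a boundary point *)

Section BoundaryTaylor.
Context {R : realType}.

(** [f n] stands for the [n]-th derivative, known for [t > 0] only. The coefficients are limits at
    [0], found by integrating the expansion of the derivative. *)
Lemma taylor_at_0 (N : nat) (f : nat -> R -> R) (K r : R) : 0 < r -> 0 <= K ->
  (forall n t, (n < N)%N -> 0 < t < r -> is_derive t 1 (f n) (f n.+1 t)) ->
  (forall t, 0 < t < r -> `|f N t| <= K) ->
  exists a : nat -> R, forall t, 0 < t < r -> `|f 0%N t - \sum_(i < N) a i * t ^+ i| <= K * t ^+ N.
Proof.
move=> r0 K0; elim: N f => [|N IH] f df bf.
  by exists (fun=> 0) => t tr; rewrite big_ord0 subr0 expr0 mulr1; exact: bf.
have [a Ha] := IH (fun n => f n.+1) (fun n t nN => df n.+1 t nN) bf.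
pose h t := f 0%N t - \sum_(i < N) a i / i.+1%:R * t ^+ i.+1.
have N0 : (N.+1%:R : R) != 0 by rewrite pnatr_eq0.
have dX (b s : R) (n : nat) : is_derive s 1 (fun t => b / n.+1%:R * t ^+ n.+1) (b * s ^+ n).
  have -> : b * s ^+ n = b / n.+1%:R * (n.+1%:R * s ^+ n * 1).
    by rewrite mulr1 -mulrA mulKf// pnatr_eq0.
  apply: isD_scal; have := is_deriveX n.+1 (is_derive_id s 1).
  by rewrite (_ : id ^+ n.+1 = fun t : R => t ^+ n.+1)//; apply/funext => t; rewrite exprfctE.
have [c Hc] : exists c, forall t, 0 < t < r -> `|h t - c| <= K / N.+1%:R * t ^+ N.+1.
  apply: limit_at_0 => // b e b0 be er.
  have := @increment_comparison _ h (fun t => f 1%N t - \sum_(i < N) a i * t ^+ i)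
    (fun t => K / N.+1%:R * t ^+ N.+1) (fun t => K * t ^+ N) b e be _.
  move=> /(_ _)/le_trans; apply.
    move=> s /andP[bs se].
    have s0 : 0 < s < r by rewrite (lt_le_trans b0 bs) (le_lt_trans se er).
    split; [|exact: dX|exact: Ha].
    by apply: isD_sub; [exact: df|apply: isD_sum => i; exact: dX].
  rewrite gerBl mulr_ge0 ?divr_ge0// exprn_ge0// ltW//.
exists (fun i => if i is j.+1 then a j / j.+1%:R else c) => t tr.
have t0 : 0 < t by case/andP: tr.
rewrite big_ord_recl /= expr0 mulr1 (addrC c) opprD addrA.
apply: le_trans (Hc t tr) _; rewrite ler_wpM2r ?exprn_ge0 ?(ltW t0)//.
by rewrite ler_pdivrMr ?ltr0n// ler_peMr// ler1n.
Qed.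

(** The vanishing of [g'] at the excluded endpoint is expressed by small values arbitrarily close to
    it. Integrating twice gives [g' = O(t)], then [g = A + O(t^2)]. *)
Lemma taylor_flat_at_0 (g g' g'' : R -> R) (K r : R) : 0 <= K ->
  (forall t, 0 < t < r -> is_derive t 1 g (g' t)) ->
  (forall t, 0 < t < r -> is_derive t 1 g' (g'' t)) ->
  (forall t, 0 < t < r -> `|g'' t| <= K) ->
  (forall t e, 0 < t < r -> 0 < e -> exists2 b, 0 < b <= t & `|g' b| <= e) ->
  0 < r -> exists A, forall t, 0 < t < r -> `|g t - A| <= K * t ^+ 2.
Proof.
move=> K0 dg dg' bg g'0 r0.
have dg'' (b e : R) : 0 < b -> b <= e -> e < r -> `|g' e - g' b| <= K * e.
  move=> b0 be edl.
  apply: (@le_trans _ _ (K * e - K * b)); last by rewrite gerBl mulr_ge0// ltW.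
  apply: (@increment_comparison _ g' g'' (fun t => K * t) (fun=> K) b e be) => s /andP[bs se].
  have sdl : 0 < s < r by rewrite (lt_le_trans b0 bs) (le_lt_trans se edl).
  split; [exact: dg'| |exact: bg].
  by have := isD_scal K (is_derive_id s 1); rewrite mulr1.
have g'le t : 0 < t < r -> `|g' t| <= K * t.
  move=> tr; apply/ler_addgt0Pr => e e0.
  have [b /andP[b0 bt] be] := g'0 t e tr e0.
  rewrite -(subrK (g' b) (g' t)); apply: le_trans (ler_normD _ _) _.
  by apply: lerD => //; apply: dg'' => //; case/andP: tr.
apply: limit_at_0 => // b e b0 be edl.
apply: (@le_trans _ _ (K / 2 * e ^+ 2 - K / 2 * b ^+ 2)); last first.
  have := sqr_ge0 b; have := sqr_ge0 e => h1 h2; nra.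
apply: (@increment_comparison _ g g' (fun t => K / 2 * t ^+ 2) (fun t => K * t) b e be) => s /andP[bs se].
have sdl : 0 < s < r by rewrite (lt_le_trans b0 bs) (le_lt_trans se edl).
split; [exact: dg| |exact: g'le].
have := isD_scal (K / 2) (isD_mul (is_derive_id s 1) (is_derive_id s 1)).
by rewrite mul1r mulr1 -mulr2n -[s *+ 2]mulr_natr mulrA mulrAC divfK.
Qed.

Lemma within_continuous_leP (k : nat) (D : set 'rV[R]_k) (g : 'rV[R]_k -> R) x : D x ->
  {within D, continuous g} -> forall e, 0 < e ->
  exists2 dl, 0 < dl & forall z, D z -> ball x dl z -> `|g x - g z| <= e.
Proof.
move=> Dx /subspace_continuousP/(_ _ Dx)/cvgrPdist_le H e /H.
rewrite /prop_near1 /within /= => /nbhs_ballP [dl /= dl0 Hdl].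
by exists dl => // z Dz xz; exact: Hdl.
Qed.

Context {d : nat}.
Variables (M : nat) (r : R) (V V_S V_TS : 'rV[R]_(d + 1 + 1) -> R) (x : 'rV[R]_d).
Hypotheses (M2 : (2 <= M)%N) (xr : enorm x < r).
Hypothesis sV : Csmooth (Vdom r) V.
Hypothesis hS : is_pd_on (Vdom r) Six V V_S.
Hypothesis hTS : is_pd_on (Vdom r) Tix V_S V_TS.

Let r_gt0 : 0 < r := le_lt_trans (enorm_ge0 x) xr.

Definition tpt (t s : R) : 'rV[R]_(d + 1 + 1) := curve (fun=> s) (pt x t).

Definition Vint : set 'rV[R]_(d + 1 + 1) := [set z | Gcyl r (lsubmx z)].

Lemma open_Vint : open Vint.
Proof.
by apply: open_comp; [move=> z _; exact: continuous_lsub'|exact: open_Gcyl].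
Qed.

Lemma Vint_interior : Vint `<=` (Vdom r)°.
Proof.
have VV : Vint `<=` Vdom r by move=> z Vz; apply: (@subset_closure _ (Gcyl r)).
by move: open_Vint; rewrite openE => oV z /oV; exact: interiorS.
Qed.

Lemma Vint_tpt t s : 0 < t < r -> Vint (tpt t s).
Proof. by move=> tr; rewrite /Vint /tpt /curve /= row_mxKl; apply/Gcyl_pt. Qed.

Lemma Vdom_tpt0 : Vdom r (tpt 0 0).
Proof.
rewrite /Vdom /tpt /curve /= row_mxKl => B /nbhs_ballP [e /= e0 eB].
pose t := Num.min (r / 2) (e / 2).
have t0 : 0 < t by rewrite lt_min !divr_gt0.
have tr : t < r by rewrite gt_min ltr_pdivrMr// ltr_pMr// ltr1n.
have te : t < e by rewrite gt_min [e / 2 < e]ltr_pdivrMr// ltr_pMr// ltr1n orbT.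
exists (pt x t); split; first by apply/Gcyl_pt; rewrite t0.
apply: eB; split=> // i b; rewrite (ord1 i) -ball_normE /=.
case: (tix_or_yix b) => [->|[l ->]].
  by rewrite !pt_tixE sub0r normrN ger0_norm// ltW.
by rewrite !pt_yixE subrr normr0.
Qed.

Lemma ball_tpt dl t s : `|t| < dl -> `|s| < dl -> ball (tpt 0 0) dl (tpt t s).
Proof.
move=> tdl sdl; split=> [|i b]; first exact: le_lt_trans tdl.
rewrite (ord1 i) -ball_normE /tpt /curve /=; case: (split_ordP b) => b' ->.
  rewrite !row_mxEl; case: (tix_or_yix b') => [->|[l ->]].
    by rewrite !pt_tixE sub0r normrN.
  by rewrite !pt_yixE subrr normr0; exact: le_lt_trans tdl.
by rewrite !row_mxEr (ord1 b') !mxE eqxx !mulr1n sub0r normrN.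
Qed.

Lemma pds_locally_bounded s : exists dl K, [/\ 0 < dl, 0 <= K & forall t a,
  0 < t < dl -> `|a| < dl -> 0 < t < r /\ `|pds s V (tpt t a)| <= K].
Proof.
have [g cg Hg] := pds_extension (sV (size s)).
have [dl dl0 Hdl] := within_continuous_leP Vdom_tpt0 cg ltr01.
exists (Num.min dl r), (`|g (tpt 0 0)| + 1); split; first by rewrite lt_min dl0.
  by rewrite addr_ge0.
move=> t a /andP[t0]; rewrite !lt_min => /andP[tdl tr] /andP[adl _].
have tr' : 0 < t < r by rewrite t0.
have Vt := Vint_tpt a tr'; split=> //; rewrite -(Hg _ (Vint_interior Vt)).
have := Hdl _ (interior_subset (Vint_interior Vt)).
have td : `|t| < dl by rewrite ger0_norm// ltW.
move=> /(_ (ball_tpt td adl)) h; rewrite -(subKr (g (tpt 0 0)) (g _)).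
by apply: le_trans (ler_normB _ _) _; rewrite lerD2l.
Qed.

Lemma tpt_add_S t s (h : R) : h *: delta_mx 0 Six + tpt t s = tpt t (s + h).
Proof.
apply/rowP => b; rewrite /tpt /curve mxE; case: (split_ordP b) => b' ->.
  rewrite !row_mxEl !mxE; have -> : (lshift 1 b' == Six) = false.
    by apply/eqP => /(congr1 val) /=; have := ltn_ord b'; lia.
  by rewrite andbF mulr0 add0r.
by rewrite (ord1 b') !row_mxEr !mxE !eqxx mulr1 !mulr1n addrC.
Qed.

Lemma tpt_add_T t s (h : R) : h *: delta_mx 0 Tix + tpt t s = tpt (t + h) s.
Proof.
apply/rowP => b; rewrite /tpt /curve mxE; case: (split_ordP b) => b' ->.
  by rewrite !row_mxEl -pt_add_t !mxE /Tix (inj_eq (@lshift_inj _ _)).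
rewrite !row_mxEr (ord1 b') !mxE; have -> : (Six == Tix :> 'I_(d + 1 + 1)) = false.
  by rewrite eq_sym Tix_neq.
by rewrite andbF mulr0 add0r.
Qed.

Lemma is_derive_tpt_T f t s : Csmooth Vint f -> 0 < t < r ->
  is_derive t 1 (fun t => f (tpt t s)) (pd Tix f (tpt t s)).
Proof.
move=> sf tr; apply: (@is_derive_affine R R^o _ R (fun t => tpt t s) f t 1 (delta_mx 0 Tix)).
  by move=> h; rewrite tpt_add_T [h%:A]mulr1 addrC.
exact: (Csmooth_derive Tix open_Vint sf (Vint_tpt s tr)).
Qed.

Let sVi : Csmooth Vint V.
Proof.
by apply: Csmooth_sub sV => z /Vint_interior; exact: interior_subset.
Qed.

(** Two mean values in [S] bound the error by the second derivative in [S], uniformly as [t] tends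
    to [0]. *)
Lemma taylor_S : exists dl K, [/\ 0 < dl, 0 <= K & forall t s, 0 < t < dl -> `|s| < dl ->
  `|V (tpt t s) - V (tpt t 0) - s * pd Six V (tpt t 0)| <= K * s ^+ 2].
Proof.
have [dl [K [dl0 K0 H]]] := pds_locally_bounded [:: Six; Six].
have key f t s : Csmooth Vint f -> 0 < t < dl ->
    exists2 u : R, 0 < u < 1 & f (tpt t s) - f (tpt t 0) = s * pd Six f (tpt t (u * s)).
  move=> sf tdl; have z0 : `|0 : R| < dl by rewrite normr0.
  have [tr _] := H t 0 tdl z0.
  have dl1 (u : R) : 0 <= u <= 1 -> is_derive (u *: (s *: delta_mx 0 Six) + tpt t 0)
      (s *: delta_mx 0 Six) f (s * pd Six f (u *: (s *: delta_mx 0 Six) + tpt t 0)).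
    move=> _; apply: is_derive_scale; rewrite scalerA tpt_add_S.
    exact: (Csmooth_derive Six open_Vint sf (Vint_tpt _ tr)).
  have [u u01] := MVT_line (g := fun z => s * pd Six f z) dl1.
  by rewrite scalerA !tpt_add_S !add0r => E; exists u.
exists dl, K; split=> // t s tdl sdl.
have [u /andP[u0 u1] ->] := key V t s sVi tdl.
have us : `|u * s| <= `|s| by rewrite normrM ger0_norm ?(ltW u0)// ler_piMl// ltW.
rewrite -mulrBr.
have [u' /andP[u'0 u'1] ->] := key (pd Six V) t (u * s) (Csmooth_pd Six open_Vint sVi) tdl.
have us' : `|u' * (u * s)| < dl.
  apply: le_lt_trans sdl; apply: le_trans us.
  by rewrite normrM ger0_norm ?(ltW u'0)// ler_piMl// ltW.
have [_ HK] := H t _ tdl us'.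
apply: (@le_trans _ _ (`|s| * (`|s| * K))); last first.
  by rewrite mulrA -expr2 (real_normK (num_real s)) mulrC.
by rewrite normrM ler_wpM2l// normrM ler_pM.
Qed.

Lemma taylor_T : exists dl K (a : nat -> R), [/\ 0 < dl, 0 <= K & forall t, 0 < t < dl ->
  `|V (tpt t 0) - \sum_(i < M.+2) a i * t ^+ i| <= K * t ^+ M.+2].
Proof.
have [dl [K [dl0 K0 H]]] := pds_locally_bounded (nseq M.+2 Tix).
have H' t : 0 < t < dl -> 0 < t < r /\ `|pds (nseq M.+2 Tix) V (tpt t 0)| <= K.
  by move=> tdl; apply: H; rewrite ?normr0.
have [a Ha] := @taylor_at_0 M.+2 (fun n t => pds (nseq n Tix) V (tpt t 0)) K dl dl0 K0
  (fun n t _ tdl => is_derive_tpt_T 0 (Csmooth_pds (nseq n Tix) open_Vint sVi) (H' t tdl).1)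
  (fun t tdl => (H' t tdl).2).
by exists dl, K, a.
Qed.

Hypothesis V_TS0 : V_TS (tpt 0 0) = 0.

(** Vanishing of the mixed derivative removes the linear term of [V_S] in [t], the one that would
    produce [t * t^M ln t]. *)
Lemma taylor_TS : exists dl K A, [/\ 0 < dl, 0 <= K & forall t, 0 < t < dl ->
  `|pd Six V (tpt t 0) - A| <= K * t ^+ 2].
Proof.
have [dl [K [dl0 K0 H]]] := pds_locally_bounded [:: Tix; Tix; Six].
have H' t : 0 < t < dl -> 0 < t < r /\ `|pd Tix (pd Tix (pd Six V)) (tpt t 0)| <= K.
  by move=> tdl; apply: H; rewrite ?normr0.
have sS := Csmooth_pd Six open_Vint sVi.
have sT := Csmooth_pd Tix open_Vint sS.
pose g t := pd Six V (tpt t 0); pose g' t := pd Tix (pd Six V) (tpt t 0).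
pose g'' t := pd Tix (pd Tix (pd Six V)) (tpt t 0).
have VE t : 0 < t < r -> g' t = V_TS (tpt t 0).
  move=> tr; have Vt := Vint_tpt 0 tr.
  rewrite /g' -(pd_eq (hTS.1 _ (Vint_interior Vt))).
  apply: (pd_congr Tix open_Vint _ Vt) => z /Vint_interior Vz.
  exact: (pd_eq (hS.1 _ Vz)).
have [A HA] : exists A, forall t, 0 < t < dl -> `|g t - A| <= K * t ^+ 2.
  have h1 t : 0 < t < dl -> is_derive t 1 g (g' t).
    by move=> tdl; exact: (is_derive_tpt_T 0 sS (H' t tdl).1).
  have h2 t : 0 < t < dl -> is_derive t 1 g' (g'' t).
    by move=> tdl; exact: (is_derive_tpt_T 0 sT (H' t tdl).1).
  have h3 t : 0 < t < dl -> `|g'' t| <= K by move=> tdl; exact: (H' t tdl).2.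
  refine (taylor_flat_at_0 K0 h1 h2 h3 _ dl0).
  move=> t e /andP[t0 tdl] e0.
  have [dl1 dl10 Hdl1] := within_continuous_leP Vdom_tpt0 hTS.2 e0.
  pose b := Num.min t (dl1 / 2).
  have b0 : 0 < b by rewrite lt_min t0 divr_gt0.
  have bt : b <= t by rewrite ge_min lexx.
  have bdl : 0 < b < dl by rewrite b0 (le_lt_trans bt).
  have [br _] := H' b bdl.
  have b1 : `|b| < dl1.
    by rewrite ger0_norm ?(ltW b0)// gt_min [dl1 / 2 < _]ltr_pdivrMr// ltr_pMr// ltr1n orbT.
  have z1 : `|0 : R| < dl1 by rewrite normr0.
  have := Hdl1 _ (interior_subset (Vint_interior (Vint_tpt 0 br))) (ball_tpt b1 z1).
  by rewrite V_TS0 sub0r normrN -VE// => h; exists b => //; rewrite b0.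
by exists dl, K, A.
Qed.

(** Expand in [S] to second order at [S = t^M ln t]. The quadratic error is of order nearly
    [2 * M >= M + 2], and the linear term is [A t^M ln t] up to order nearly [M + 2]. *)
Lemma boundary_taylor : exists dl K A (a : nat -> R), [/\ 0 < dl, 0 <= K & forall t, 0 < t < dl ->
  `|V (tpt t (t ^+ M * ln t)) - \sum_(i < M.+2) a i * t ^+ i - A * (t ^+ M * ln t)| <=
  K * t `^ (M.+2%:R - 2^-1)].
Proof.
have [d1 [K1 [d10 K10 H1]]] := taylor_S.
have [d2 [K2 [a [d20 K20 H2]]]] := taylor_T.
have [d3 [K3 [A [d30 K30 H3]]]] := taylor_TS.
(* Each logarithm costs [t^(-1/4)], so even its square stays within the allowed loss of one half. *)
have q4 : 0 < 4^-1 :> R by rewrite invr_gt0.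
pose L := (4^-1)^-1 + 1 `^ (1 + 4^-1) : R.
have L0 : 0 <= L by rewrite addr_ge0 ?powR_ge0// invr_ge0 ltW.
pose m := Num.min (Num.min d1 d2) (Num.min d3 1).
have m0 : 0 < m by rewrite !lt_min d10 d20 d30 ltr01.
(* Then [|t^M ln t| <= L * t < d1], the range where the expansion in [S] is valid. *)
pose dl := Num.min m (d1 / (L + 1)).
have L1 : 0 < L + 1 by rewrite ltr_wpDl.
exists dl, (K1 * L ^+ 2 + K2 + L * K3), A, a; split.
- by rewrite lt_min m0 divr_gt0.
- by rewrite !addr_ge0 ?mulr_ge0 ?sqr_ge0.
move=> t /andP[t0]; rewrite !lt_min => /andP[/andP[/andP[t1 t2] /andP[t3 t4]] t5].
set phi := t ^+ M * ln t.
have lnt : `|ln t| <= L * t `^ (- 4^-1) by apply: abs_ln_le => //; rewrite t0.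
have pM e f : f <= e -> t `^ e <= t `^ f by move=> fe; apply: ger_powR => //; rewrite t0 ltW.
have tM n : t ^+ n = t `^ n%:R by rewrite powR_mulrn// ltW.
have phiL : `|phi| <= L * t `^ (M%:R - 4^-1).
  rewrite /phi normrM ger0_norm ?exprn_ge0 ?(ltW t0)// tM (powR_add _ _ t0) mulrCA.
  by rewrite ler_wpM2l ?powR_ge0.
have M2R : 2 <= M%:R :> R by rewrite ler_nat.
have phid : `|phi| < d1.
  apply: le_lt_trans phiL _; apply: (@le_lt_trans _ _ (L * t)).
    rewrite ler_wpM2l// -[leRHS](powRr1 (ltW t0)); apply: pM.
    have : 4^-1 <= 1 :> R by rewrite invf_le1// ler1n.
    by move: (4^-1) => b; lra.
  apply: (@le_lt_trans _ _ ((L + 1) * t)); first by rewrite ler_wpM2r ?(ltW t0)// lerDl.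
  by rewrite mulrC -ltr_pdivlMr.
have h1 := H1 t phi; rewrite t0 t1 in h1; move: (h1 isT phid) => {}h1.
have h2 := H2 t; rewrite t0 t2 in h2; move: (h2 isT) => {}h2.
have h3 := H3 t; rewrite t0 t3 in h3; move: (h3 isT) => {}h3.
have -> : V (tpt t phi) - \sum_(i < M.+2) a i * t ^+ i - A * phi =
  (V (tpt t phi) - V (tpt t 0) - phi * pd Six V (tpt t 0)) +
  (V (tpt t 0) - \sum_(i < M.+2) a i * t ^+ i) + phi * (pd Six V (tpt t 0) - A) by ring.
have E4 : 2^-1 = 4^-1 + 4^-1 :> R by field.
rewrite 2!mulrDl; apply: le_trans (ler_normD _ _) _; apply: lerD.
  apply: le_trans (ler_normD _ _) _; apply: lerD.
    apply: le_trans h1 _; rewrite -mulrA ler_wpM2l// -(real_normK (num_real phi)).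
    apply: (@le_trans _ _ ((L * t `^ (M%:R - 4^-1)) ^+ 2)).
      by rewrite lerXn2r// ?nnegrE// mulr_ge0// powR_ge0.
    rewrite exprMn ler_wpM2l ?sqr_ge0// expr2 -powR_add//; apply: pM.
    rewrite E4 -[M.+2%:R]natr1 -[M.+1%:R]natr1; move: (4^-1) => b; lra.
  apply: le_trans h2 _; rewrite tM ler_wpM2l//; apply: pM.
  by rewrite gerBl invr_ge0.
rewrite normrM; apply: (@le_trans _ _ ((L * t `^ (M%:R - 4^-1)) * (K3 * t ^+ 2))).
  by apply: ler_pM.
rewrite mulrACA ler_wpM2l ?mulr_ge0// tM -powR_add//; apply: pM.
rewrite E4 -[M.+2%:R]natr1 -[M.+1%:R]natr1; move: (4^-1) q4 => b b0; lra.
Qed.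

End BoundaryTaylor.

Section Regularity.
Context {R : realType} {d : nat}.
Variables (Rad : R) (M : nat) (v : 'rV[R]_(d + 1) -> R).
Hypotheses (Rad0 : 0 < Rad) (M2 : (2 <= M)%N) (hv : Oc Rad 2 v).
Hypothesis cv : {within closure (Gcyl Rad), continuous v}.

Lemma expQ_lt lg i j : expQ M lg i j -> (j < i)%N.
Proof. by case=> h1 [h2 _]; nia. Qed.

Lemma expQ_le lg i j : ~ (M * j + 1 <= i)%N -> ~ expQ M lg i j.
Proof. by move=> h [/h]. Qed.

Lemma curve_smooth r (phi : 'rV[R]_(d + 1) -> R) (O0 : set 'rV[R]_(d + 1)) V :
  open O0 -> (forall y, O0 y -> Bball r (lsubmx y)) -> Csmooth O0 phi ->
  Csmooth (cyl3 r) V -> Csmooth O0 (fun y => V (curve phi y)).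
Proof.
move=> oO Or sphi sV; apply: (Csmooth_comp oO (@open_cyl3 _ _ r)) => //.
  by move=> y /Or; rewrite /cyl3 /= Yco_curve.
move=> j; rewrite /curve; case: (split_ordP j) => j' ->.
  apply: (Csmooth_congr (f := fun x => x 0 j')); last exact: Csmooth_coord.
  by move=> y _; rewrite row_mxEl.
apply: Csmooth_congr sphi => y _.
by rewrite row_mxEr (ord1 j') mxE eqxx mulr1n.
Qed.

Lemma closure_cases r y : 0 < r < Rad -> closure (Gcyl r) y ->
  0 < tco y \/ tco y = 0 /\ v y = 0.
Proof.
move=> rR cy; have [_ /andP[t0 _]] := closure_Gcyl cy.
have [t1|t1] := ltP 0 (tco y); [by left|right].
by have y0 : tco y = 0; [apply/eqP; rewrite eq_le t1|split => //; exact: (boundary_value rR cv hv)].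
Qed.

(** On the curve [S = t^M ln t] the difference [v - V0] is flat; its extension depends on [(y', t)]
    alone and is added as a function constant in [S]. *)
Lemma log_smooth : (forall n, Ex Rad (n.+1%:R + 2^-1) (expQ M true) v) ->
  forall r, 0 < r < Rad -> exists V, log_repr M.+1 r v V.
Proof.
move=> /(Ex_all_coef Rad0 (@expQ_lt true)) [C [sC CP hvC]] r rR.
have /andP[r0 rR'] := rR; pose r' := (r + Rad) / 2.
have rr' : r < r' by rewrite midf_lt.
have r'R : r' < Rad by rewrite midf_lt.
have r'0 : 0 < r' := lt_trans r0 rr'.
have CM i j : ~ (M * j + 1 <= i)%N -> C i j = fun=> 0 by move=> /(@expQ_le true)/CP.
have [V0 [sV0 V00 HE]] := Csmooth_decomposition r'0 r'R M2 sC CM hvC.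
have o1 : Oc r' 1 (@mon R d M 1) by apply: Oc_mon; right; rewrite ltr1n.
have HU i y : Gcyl r' y -> Upoly M C i (curve (mon M 1) y) =
    \sum_(j < i) C i j (lsubmx y) * mon i j y.
  move=> _; rewrite /Upoly Yco_curve Tco_curve Sco_curve; apply: eq_bigr => j _.
  have [Mj|Mj] := leqP (M * j) i; last by rewrite CM ?mul0r//; lia.
  by rewrite /mon expr1 exprMn -exprM; congr (_ * _); rewrite mulrA -exprD subnK.
have sE := HE _ o1 HU.
set E := ext0 _ in sE.
pose D := [set z : 'rV[R]_(d + 1 + 1) | half_cyl r' (lsubmx z)].
have oD : open D by apply: open_comp; [move=> z _; exact: continuous_lsub'|exact: open_half_cyl].
exists (fun z => V0 z + E (lsubmx z)); split.
  apply: (Csmooth_sub (D := D)).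
    by move=> z; apply: half_cyl_closure; rewrite r0.
  apply: Csmooth_add => //; first by apply: Csmooth_sub sV0 => z [].
  apply: (Csmooth_comp oD (@open_half_cyl _ _ r')) => // j.
  apply: (Csmooth_congr (f := fun z => z 0 (lshift 1 j))); last exact: Csmooth_coord.
  by move=> z _; rewrite mxE.
move=> y cy; have [Hy tr] : half_cyl r' y by apply: half_cyl_closure cy; rewrite r0.
rewrite /= row_mxKl; case: (closure_cases rR cy) => [t0|[t0 vy]].
  by rewrite /E /ext0 t0 /mon /curve expr1 addrC subrK.
rewrite /E /ext0 t0 ltxx addr0 vy expr0n (negPf (lt0n_neq0 (ltnW M2))) mul0r V00//.
- by rewrite /cyl3 /= (Yco_curve (fun=> 0) y).
- by rewrite (Tco_curve (fun=> 0) y).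
- by rewrite (Sco_curve (fun=> 0) y).
Qed.

(** Without logarithms every component has only its [j = 0] term, so the slice [S = 0] of [V0]
    already carries the whole expansion. *)
Lemma boundary_smooth : (forall n, Ex Rad (n.+1%:R + 2^-1) (expQ M false) v) ->
  forall r, 0 < r < Rad -> Csmooth (closure (Gcyl r)) v.
Proof.
move=> /(Ex_all_coef Rad0 (@expQ_lt false)) [C [sC CP hvC]] r rR.
have /andP[r0 rR'] := rR; pose r' := (r + Rad) / 2.
have rr' : r < r' by rewrite midf_lt.
have r'R : r' < Rad by rewrite midf_lt.
have r'0 : 0 < r' := lt_trans r0 rr'.
have CM i j : ~ (M * j + 1 <= i)%N -> C i j = fun=> 0 by move=> /(@expQ_le false)/CP.
have [V0 [sV0 V00 HE]] := Csmooth_decomposition r'0 r'R M2 sC CM hvC.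
have C0 i j : (0 < j)%N -> C i j = fun=> 0.
  by move=> j0; apply: CP => -[_ [_ /eqP j00]]; rewrite j00 in j0.
have HU i y : Gcyl r' y -> Upoly M C i (curve (fun=> 0) y) =
    \sum_(j < i) C i j (lsubmx y) * mon i j y.
  move=> _; rewrite /Upoly Yco_curve Tco_curve Sco_curve; apply: eq_bigr => j _.
  have [j0|j0] := posnP j; last by rewrite C0 ?mul0r.
  by rewrite j0 /mon !expr0 muln0 subn0.
have sE := HE _ (Oc_zero _ _) HU.
set E := ext0 _ in sE.
apply: (Csmooth_congr (f := fun y => V0 (curve (fun=> 0) y) + E y)).
  move=> y cy; have [Hy tr] : half_cyl r' y by apply: half_cyl_closure cy; rewrite r0.
  case: (closure_cases rR cy) => [t0|[t0 vy]]; first by rewrite /E /ext0 t0 addrC subrK.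
  rewrite /E /ext0 t0 ltxx addr0 vy V00//.
  - by rewrite /cyl3 /= Yco_curve.
  - by rewrite Tco_curve.
  - by rewrite Sco_curve.
apply: (Csmooth_sub (D := half_cyl r')).
  by move=> y; apply: half_cyl_closure; rewrite r0.
apply: Csmooth_add => //; first exact: open_half_cyl.
apply: curve_smooth sV0; [exact: open_half_cyl|by move=> y []|].
exact: Csmooth_cst (@open_half_cyl _ _ _).
Qed.

End Regularity.

(** * Expansions of the solution and the coefficient of the first logarithm *)

Section Expansion.
Context {R : realType} {d : nat}.
Variable Rad : R.
Hypothesis Rad0 : 0 < Rad.

Lemma span_msum (P : nat -> nat -> Prop) K (c : nat -> nat -> 'rV[R]_d -> R) :
  (forall i j, Csmooth (Bball Rad) (c i j)) ->
  (forall i j, P i j \/ c i j = fun=> 0) -> span Rad P (msum K c).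
Proof.
move=> sc Pc; have sum_span (n : nat) (f : nat -> 'rV[R]_(d + 1) -> R) :
    (forall i, span Rad P (f i)) -> span Rad P (fun y => \sum_(i < n) f i y).
  move=> hf; elim: n => [|n IH].
    by apply: span_ext (span0 Rad P) => y; rewrite big_ord0.
  by apply: span_ext (span_add IH (hf n)) => y; rewrite big_ord_recr.
apply: (sum_span K (fun i y => \sum_(j < K) c i j (lsubmx y) * mon i j y)) => i.
apply: (sum_span K (fun j y => c i j (lsubmx y) * mon i j y)) => j.
have [Pij|cij] := Pc i j; first exact: span_mon.
by apply: span_ext (span0 Rad P) => y; rewrite cij mul0r.
Qed.

(** The two expansions along the vertical line through [x], conormal and Taylor, must agree below
    order [M + 2], and the latter has no [t^(M+1) ln t]. *)
Lemma log_coef_eq0 (M : nat) (v : 'rV[R]_(d + 1) -> R) K (c : nat -> nat -> 'rV[R]_d -> R) k x :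
  (2 <= M)%N -> Bball Rad x -> is_dt_dlog M.+1 Rad v x 0 ->
  M.+2%:R - 2^-1 <= k -> Oc Rad k (fun y => v y - msum K c y) ->
  (M.+1 < K)%N -> c M.+1 1%N x = 0.
Proof.
move=> M2 Bx [r [V [V_S [V_TS [/andP[xr rR] [sV vV] hS hTS V0]]]]] kM hc MK.
have tpt0 : tpt x 0 0 = row_mx (row_mx x 0) 0.
  by rewrite /tpt /curve /pt; congr (row_mx (row_mx _ _) _); apply/rowP => j;
    rewrite (ord1 j) !mxE.
rewrite -tpt0 in V0.
have [dl [B [A [a [dl0 B0 HT]]]]] := boundary_taylor M2 xr sV hS hTS V0.
have r0 : 0 < r := le_lt_trans (enorm_ge0 x) xr.
have rRad : 0 < r < Rad by rewrite r0.
have [B' HB'] := Oc_bound (Oc_le kM hc) rRad.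
(* Row [i] of the difference: the Taylor side contributes constants [a i] and one logarithm, in row
   [M]. Row [M + 1] therefore keeps its coefficient of [ln t]. *)
pose q i : {poly R} := \poly_(j < K) c i j x - (if (i < M.+2)%N then (a i)%:P else 0)
  - (if i == M then A *: 'X else 0).
have e0 : 0 < Num.min dl r by rewrite lt_min dl0.
have H t : 0 < t < Num.min dl r ->
    `|\sum_(i < K) t ^+ i * (q i).[ln t]| <= (B + B') * t `^ (M.+2%:R - 2^-1).
  rewrite lt_min => /and3P[t0 tdl tr].
  have tdl' : 0 < t < dl by rewrite t0.
  have Gt : Gcyl r (pt x t) by apply/Gcyl_pt; rewrite t0.
  have := HB' _ Gt; rewrite tco_pt msum_pt vV; last exact: subset_closure.
  have := HT t tdl'; rewrite tco_pt -[row_mx (pt x t) _]/(tpt x t (t ^+ M * ln t)).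
  set W := V _; move=> h1 h2.
  have -> : \sum_(i < K) t ^+ i * (q i).[ln t] =
      (W - \sum_(i < M.+2) a i * t ^+ i - A * (t ^+ M * ln t)) -
      (W - \sum_(i < K) t ^+ i * (\poly_(j < K) c i j x).[ln t]).
    have -> : \sum_(i < M.+2) a i * t ^+ i = \sum_(i < K) t ^+ i * (if (i < M.+2)%N then a i else 0).
      rewrite (big_ord_widen K (fun i => a i * t ^+ i))// big_mkcond /=.
      by apply: eq_bigr => i _; case: ifP; rewrite ?mulr0// mulrC.
    have -> : A * (t ^+ M * ln t) = \sum_(i < K) t ^+ i * (if i == M :> nat then A * ln t else 0).
      rewrite (bigD1 (Ordinal (ltnW MK)))//= eqxx big1 ?addr0 1?mulrCA//.
      by move=> i /eqP iM; case: eqP => [iM'|]; rewrite ?mulr0//; case: iM; apply: val_inj.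
    have cancel (a1 a2 a3 : R) : W - a1 - a2 - (W - a3) = a3 - a1 - a2 by ring.
    rewrite cancel -!sumrB; apply: eq_bigr => i _.
    rewrite /q !hornerD !hornerN !mulrDr !mulrN; congr (_ - t ^+ i * _ - t ^+ i * _).
      by case: ifP; rewrite ?hornerC.
    by case: ifP; rewrite ?hornerZ ?hornerX ?hornerC.
  apply: le_trans (ler_normB _ _) _; rewrite mulrDl; exact: lerD.
have := log_expansion_uniq e0 H MK (ltnSn _).
move=> /polyP/(_ 1%N); rewrite /q ltnSn !coefB coef_poly coefC coef0 /=.
have -> : (M.+1 == M) = false by apply/eqP; lia.
by rewrite coef0 !subr0 (leq_ltn_trans _ MK).
Qed.

Variables (M : nat) (F : 'rV[R]_(d + 1 + nargs d) -> R) (v : 'rV[R]_(d + 1) -> R).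
Variables (mlow p q : R).
Hypotheses (M2 : (2 <= M)%N) (hF : Csmooth (Fdom Rad) F) (hFlin : linear_in_quad Rad F).
Hypotheses (hv : Oc Rad 2 v) (hmlow : mlow <= 0) (hp : p = 1 - (mlow + M.+1%:R)).
Hypotheses (hq : q = mlow * M.+1%:R) (hsol : solves p q Rad F v).

Lemma expansion_base lg : Ex Rad (1%:R + 2^-1) (expQ M lg) v.
Proof.
apply: Ex_Oc; apply: Oc_le hv.
have : 2^-1 <= 1 :> R by rewrite invf_le1// ler1n.
by move: (2^-1) => b; lra.
Qed.

Lemma log_expansion n : Ex Rad (n.+1%:R + 2^-1) (expQ M true) v.
Proof.
elim: n => [|n IH]; first exact: expansion_base.
apply: (Ex_sub (lexx _)) (expansion_step Rad0 M2 hF hFlin hv IH hmlow hp hq hsol).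
by move=> i j [//|[-> ->]]; split; [lia|split; [lia|]].
Qed.

(** A step can introduce only the logarithm at [(M + 1, 1)]. Deleting it each time keeps the
    induction within exponents free of logarithms. *)
Lemma power_expansion n : (forall x, Bball Rad x -> is_dt_dlog M.+1 Rad v x 0) ->
  Ex Rad (n.+1%:R + 2^-1) (expQ M false) v.
Proof.
move=> hlog; elim: n => [|n IH]; first exact: expansion_base.
have [g sg hg] := expansion_step Rad0 M2 hF hFlin hv IH hmlow hp hq hsol.
have [c [K0 [sc cP cK gE]]] := span_coef sg.
pose K := maxn K0 M.+2.
have gE' y : g y = msum K c y.
  rewrite gE (@msum_widen _ _ K0 K)//; exact: leq_maxl.
have MK : (M.+1 < K)%N by exact: leq_maxr.
pose c' i j := if (i == M.+1) && (j == 1%N) then fun=> 0 else c i j.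
have sc' i j : Csmooth (Bball Rad) (c' i j).
  by rewrite /c'; case: ifP => // _; exact: (Csmooth_cst 0 (@open_Bball _ _ _)).
exists (msum K c').
  apply: span_msum => // i j; rewrite /c'; case: ifP => [_|/negbT ij]; first by right.
  have [Qij|Qij] := pselect (expQ M false i j); [by left|right; apply: cP].
  by case=> // -[iM j1]; move: ij; rewrite iM j1 !eqxx.
have cE y : msum K c y - msum K c' y = c M.+1 1%N (lsubmx y) * mon M.+1 1 y.
  rewrite /msum -sumrB (bigD1 (Ordinal MK))//= [X in _ + X]big1 ?addr0 => [|i iM].
    have K1 : (1 < K)%N by exact: leq_ltn_trans MK.
    rewrite -sumrB (bigD1 (Ordinal K1))//= [X in _ + X]big1 ?addr0 => [|j j1].
      by rewrite /c' !eqxx mul0r subr0.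
    rewrite /c'; case: ifP => [/andP[_ /eqP j1']|_]; last by rewrite subrr.
    by case/eqP: j1; apply: val_inj.
  rewrite -sumrB big1// => j _; rewrite /c'; case: ifP => [/andP[/eqP iM' _]|_]; last by rewrite subrr.
  by case/eqP: iM; apply: val_inj.
suff hL : Oc Rad (n.+2%:R + 2^-1) (fun y => c M.+1 1%N (lsubmx y) * mon M.+1 1 y).
  apply: Oc_congr (Oc_add hg hL) => y _; rewrite -cE gE'; ring.
(* Below the resonant order the deleted term fits into the remainder; from there on the remainder is
   fine enough to identify its coefficient, which vanishes. *)
have [nM|nM] := ltnP n.+2 M.+1.
  rewrite -[_ + _]add0r; apply: Oc_mul; first exact: Oc_lsub.
  apply: Oc_mon; right; move: nM; rewrite -(ltr_nat R) => nM.
  have : n.+2%:R + 1 <= M.+1%:R :> R by rewrite natr1 ler_nat -(ltr_nat R).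
  have : 2^-1 < 1 :> R by rewrite invf_lt1// ltr1n.
  by move: (2^-1) => b; lra.
apply: Oc_congr (Oc_zero Rad (n.+2%:R + 2^-1)) => y [By _].
have hc : Oc Rad (n.+2%:R + 2^-1) (fun y => v y - msum K c y).
  by apply: Oc_congr hg => z _; rewrite gE'.
rewrite (log_coef_eq0 M2 By (hlog _ By) _ hc MK) ?mul0r//.
have : M.+1%:R <= n.+2%:R :> R by rewrite ler_nat.
rewrite -[M.+2%:R]natr1; have : 2^-1 + 2^-1 = 1 :> R by field.
by move: (2^-1) => b; lra.
Qed.

End Expansion.

Theorem theorem5p3 (R : realType) (d : nat) (Rad alpha : R)
  (hRad : 0 < Rad) (halpha : 0 < alpha < 1)
  (mlow : R) (mbar : nat) (hmlow : mlow <= 0) (hmbar : (3 <= mbar)%N)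
  (p q : R) (hp : p = 1 - (mlow + mbar%:R)) (hq : q = mlow * mbar%:R)
  (F : 'rV[R]_(d + 1 + nargs d) -> R)
  (hF : Csmooth (Fdom Rad) F) (hFlin : linear_in_quad Rad F)
  (v : 'rV[R]_(d + 1) -> R)
  (hv11 : Cholder 1 1 (closure (Gcyl Rad)) v)
  (hvoo : Csmooth (Gcyl Rad) v)
  (hsol : solves p q Rad F v)
  (hreg : forall (r : R) (tau : nat) (s : tau.-tuple 'I_d), 0 < r < Rad ->
    let w := pds (map yix s) v in
    [/\ holder_bar alpha (Gcyl r) (fun y => tco y ^- 2 * w y),
        forall i, holder_bar alpha (Gcyl r) (fun y => (tco y)^-1 * pd i w y) &
        forall i j, holder_bar alpha (Gcyl r) (pd i (pd j w))]) :
  (forall r : R, 0 < r < Rad -> exists V, log_repr mbar r v V) /\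
  ((forall y' : 'rV[R]_d, Bball Rad y' -> is_dt_dlog mbar Rad v y' 0) ->
   forall r : R, 0 < r < Rad -> Csmooth (closure (Gcyl r)) v).
Proof.
have /andP[alpha0 _] := halpha; case: hv11 => cv _.
(* From here [M] is [mbar - 1], so that [t^(mbar-1) log t] is [t^M ln t] and [mbar >= 3] becomes
   [M >= 2]. *)
case: mbar hmbar hp hq => // M M2 hp hq.
have hv := Oc_v alpha0 hvoo hreg hF hsol.
split=> [|hlog].
  exact: (log_smooth hRad M2 hv cv (log_expansion hRad M2 hF hFlin hv hmlow hp hq hsol)).
apply: (boundary_smooth hRad M2 hv cv) => n.
exact: (power_expansion hRad M2 hF hFlin hv hmlow hp hq hsol).
Qed.
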